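(* Let $f:S_f\to S_f$ and $g:S_g\to S_g$ be two generalized pseudo-Anosov homeomorphisms that are conjugated through a homeomorphism $h:S_f\to S_g$. Then the compatibility orders of $f$ and $g$ coincide, i.e. $n(f)=n(g)$.
   Context: **Pseudo-Anosov maps.** A surface $S$ is a smooth closed orientable 2-manifold. A generalized pseudo-Anosov homeomorphism $f:S\to S$ is an orientation-preserving homeomorphism for which there are $\lambda>1$ and two $f$-invariant transverse measured foliations $(\mathcal{F}^s,\mu^s)$ (stable) and $(\mathcal{F}^u,\mu^u)$ (unstable), with singularities, possibly including 1-prong singularities (spines), with $f_*\mu^s=\lambda\mu^s$, $f_*\mu^u=\lambda^{-1}\mu^u$; the convention is that $f$ stretches unstable arcs (measured by $\mu^s$) by $\lambda$ and contracts stable arcs (measured by $\mu^u$) by $\lambda^{-1}$. $\mathbf{Sing}(f)$ is the set of singularities of the foliations; if the invariant foliations have no singularities, the set of singular points is assumed to coincide with a finite family of periodic points of $f$. $\mathcal{F}^{s}(p),\mathcal{F}^u(p)$ (also $F^s_p$, $F^u_p$) are the leaves through $p$ (for a singularity, including all its prongs); $\mathcal{F}^{s}(\mathbf{Sing}(f))$ and $\mathcal{F}^{u}(\mathbf{Sing}(f))$ are the unions of these over $p\in\mathbf{Sing}(f)$. A stable (unstable) separatrix $F^s(p)$ ($F^u(p)$) of $p\in\mathbf{Sing}(f)$ is a connected component of $\mathcal{F}^s(p)\setminus\{p\}$ ($\mathcal{F}^u(p)\setminus\{p\}$); for $x$ on it, $[p,x]^s$ ($[p,x]^u$) is the arc from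 $p$ to $x$ in the leaf. A stable (unstable) interval or segment is an arc in a stable (unstable) leaf. $f$ and $g$ are (topologically) conjugated through a homeomorphism $h:S_f\to S_g$ if $f=h^{-1}\circ g\circ h$. **First intersection points.** A point $x\notin\mathbf{Sing}(f)$ is a first intersection point of $f$ if there are $p,q\in\mathbf{Sing}(f)$, a stable separatrix $F^s(p)$ and an unstable separatrix $F^u(q)$ with $x\in F^s(p)\cap F^u(q)$ and $(p,x]^s\cap(q,x]^u=\{x\}$. **Rectangles.** For an open connected nonempty $r\subset S$ and $x\in r$, let $I_x$ (resp. $J_x$) be the closure of the connected component of $F^s_x\cap r$ (resp. $F^u_x\cap r$) containing $x$. The set $r$ is trivially bi-foliated if for all $x,y\in r$, $I_x$ and $J_y$ are homeomorphic to closed intervals and $I_x\cap J_y$ is a single point, lying in $r$. A rectangle $R$ is the closure of a trivially bi-foliated set. A parametrization of $R$ is a continuous map $\rho:[0,1]^2\to S$ with image $R$, restricting to an orientation-preserving homeomorphism from $(0,1)^2$ onto $\overset{o}{R}:=\rho((0,1)^2)$, mapping each horizontal (vertical) segment homeomorphically onto an arc of a single stable (unstable) leaf, called a horizontal (vertical) leaf of $R$. $\partial^sR=\rho([0,1]\times\{0,1\})$, $\partial^uR=\rho(\{0,1\}\times[0,1])$; the two arcs of $\partial^uR$ are the $u$-boundary components. $R$ is embedded if $\rho$ is a homeomorphism onto its image. **Adapted graphs.** An $s$-graph adapted to $f$ is a finite family $\delta^s=\{I_i\}$ of nondegenerate compact stable intervals such that, with $\cup\delta^s:=\bigcup_iI_i$: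 $f(\cup\delta^s)\subset\cup\delta^s$; each $I_i$ lies in $\mathcal{F}^s(p)$ for some $p\in\mathbf{Sing}(f)$; for every $p\in\mathbf{Sing}(f)$ and every stable separatrix of $p$ some $I_i$ lies in that separatrix (together with $p$) and has $p$ as an endpoint; endpoints of each $I_i$ lie in $\mathcal{F}^u(\mathbf{Sing}(f))$. A $u$-graph adapted to $f$ is defined exchanging $s,u$ and $f,f^{-1}$. **Rails and compatibility.** The regular part $\overset{o}{\delta^s}$ is $\cup\delta^s$ minus all endpoints of its intervals. A regular $u$-rail of $\delta^s$ is an unstable interval with interior disjoint from $\cup\delta^s$ and endpoints in $\overset{o}{\delta^s}$. An extreme $u$-rail of $\delta^s$ is an unstable segment $J$ with at least one endpoint not in $\overset{o}{\delta^s}$ for which there is an embedded rectangle $R$ with $\partial^sR\subset\cup\delta^s$, $J$ a $u$-boundary component of $R$, and every other vertical leaf of $R$ a regular $u$-rail. $s$-rails of $\delta^u$ are defined by exchanging $s$ and $u$. $\delta^s$ and $\delta^u$ are compatible if endpoints of intervals of $\delta^s$ lie in $\cup\delta^u$, endpoints of intervals of $\delta^u$ lie in $\cup\delta^s$, extreme $u$-rails of $\delta^s$ are contained in $\cup\delta^u$, and extreme $s$-rails of $\delta^u$ are contained in $\cup\delta^s$. **Compatibility order.** Let $z\in F^s(p)\cap F^u(q)$ be a first intersection point. Put $J^u(z)=[q,z]^u$ and $\mathcal{J}^u(z)=\bigcup_{i\in\mathbb{N}}f^{-i}(J^u(z))$ (including $i=0$), a finite union of compact arcs, $f^{-1}$-invariant.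 Let $\delta^s(z)$ be the family of all stable segments with one endpoint in $\mathbf{Sing}(f)$, the other in $\mathcal{J}^u(z)$, and interior disjoint from $\mathcal{J}^u(z)$; it is an $s$-graph adapted to $f$. Let $\delta^u(z)$ be the family of all unstable segments with one endpoint in $\mathbf{Sing}(f)$, the other in $\cup\delta^s(z)$, and interior disjoint from $\cup\delta^s(z)$; it is a $u$-graph adapted to $f$. The compatibility coefficient $n(z)$ is the least natural number such that $\delta^s(z)$ and $f^n(\delta^u(z))$ are compatible for all $n\ge n(z)$. The compatibility order of $f$ is $n(f)=\max\{n(z):z\text{ is a first intersection point of }f\}$ (the maximum exists). For $g$ the same objects are defined with $g$ in place of $f$.
   Formalization: When the invariant foliations of f have no singularities, so that Sing(f) is a chosen finite family of periodic points on which n(f) depends, it is assumed in addition that h maps the family chosen for f onto the one chosen for g. *)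

(* Defs.v *)
From HB Require Import structures.
From mathcomp Require Import all_boot all_order all_algebra.
From mathcomp Require Import all_classical all_reals all_analysis.
From mathcomp.real_closed Require Import complex.

Set Implicit Arguments.
Unset Strict Implicit.
Unset Printing Implicit Defensive.

Import Order.TTheory GRing.Theory Num.Theory.
Import numFieldNormedType.Exports.

Local Open Scope classical_set_scope.
Local Open Scope ring_scope.

Definition I01 (R : realType) : set R := `[0, 1]%classic.
Arguments I01 R : clear implicits.

Record homeo (S T : topologicalType) := Homeo {
  hmap :> S -> T;
  hinv : T -> S;
  hmap_continuous : continuous hmap;
  hinv_continuous : continuous hinv;
  hmapK : cancel hmap hinv;
  hinvK : cancel hinv hmap }.

(* f restricts to a homeomorphism from D onto f @` D, both with the
   subspace topology. *)
Definition embedding_on (S T : topologicalType) (D : set S) (f : S -> T) :=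
  [/\ {within D, continuous f},
      (forall x y, D x -> D y -> f x = f y -> x = y) &
      forall V, open V ->
        exists2 W, open W & f @` (D `&` V) = (f @` D) `&` W].

Definition arc_between (R : realType) (T : topologicalType)
    (A : set T) (a b : T) :=
  exists gamma : R -> T,
    [/\ embedding_on (I01 R) gamma, gamma @` I01 R = A,
        gamma 0 = a & gamma 1 = b].
Arguments arc_between R {T} A a b.

Section Plane.
Variable R : realType.

Definition circle (t : R) : R * R := (cos (2 * pi * t), sin (2 * pi * t)).

(* Topological notion, for injective maps that need not be differentiable:
   the images of the small positively oriented circles around x wind exactly
   once, positively, around tau x; theta is a continuous determination of the
   argument, in turns. *)
Definition preserves_orientation_at (tau : R * R -> R * R) (x : R * R) :=
  \forall r \near (0 : R)^'+, exists theta : R -> R,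
    [/\ {within I01 R, continuous theta},
        theta 1 = theta 0 + 1 &
        forall t, I01 R t ->
          exists2 s : R, 0 < s &
            tau (x + r *: circle t) = tau x + s *: circle (theta t)].

Definition e_x : R * R := (1, 0).
Definition e_y : R * R := (0, 1).

Fixpoint Ck (k : nat) (U : set (R * R)) (u : R * R -> R) : Prop :=
  (forall x, U x -> {for x, continuous u}) /\
  (if k is k'.+1 then
     [/\ (forall x, U x -> derivable u x e_x /\ derivable u x e_y),
         Ck k' U ('D_e_x u) & Ck k' U ('D_e_y u)]
   else True).

Definition smooth_on (U : set (R * R)) (tau : R * R -> R * R) :=
  forall k, Ck k U (fst \o tau) /\ Ck k U (snd \o tau).

Definition jacobian (tau : R * R -> R * R) (x : R * R) : R :=
  'D_e_x (fst \o tau) x * 'D_e_y (snd \o tau) x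
  - 'D_e_y (fst \o tau) x * 'D_e_x (snd \o tau) x.

End Plane.

(* A homeomorphism from an open set of T onto an open set of the plane. *)
Record plane_chart (R : realType) (T : topologicalType) := PlaneChart {
  dom : set T;
  chart :> T -> R * R;
  chart_inv : R * R -> T;
  dom_open : open dom;
  chart_image_open : open (chart @` dom);
  chart_continuous : forall x, dom x -> {for x, continuous chart};
  chart_inv_continuous :
    forall y, (chart @` dom) y -> {for y, continuous chart_inv};
  chartK : forall x, dom x -> chart_inv (chart x) = x }.

(* A smooth closed orientable 2-manifold, presented by a smooth atlas that
   defines one of its orientations. *)
Record surface (R : realType) := Surface {
  carrier :> topologicalType;
  surface_hausdorff : hausdorff_space carrier;
  surface_compact : compact [set: carrier];
  atlas : set (plane_chart R carrier);
  atlas_cover : forall x, exists2 c, atlas c & dom c x;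
  atlas_smooth : forall c c', atlas c -> atlas c' ->
    smooth_on (c @` (dom c `&` dom c')) (c' \o chart_inv c);
  atlas_oriented : forall c c', atlas c -> atlas c' ->
    forall y, (c @` (dom c `&` dom c')) y ->
    0 < jacobian (c' \o chart_inv c) y }.

Definition orientation_preserving (R : realType) (S T : surface R)
    (f : S -> T) :=
  forall c c' x, atlas c -> atlas c' -> dom c x -> dom c' (f x) ->
    preserves_orientation_at (c' \o f \o chart_inv c) (c x).

Definition orientation_preserving_on (R : realType) (S : surface R)
    (D : set (R * R)) (rho : R * R -> S) :=
  forall c y, D y -> atlas c -> dom c (rho y) ->
    preserves_orientation_at (c \o rho) y.

Section Foliations.
Variables (R : realType) (T : topologicalType).

(* In the chart phi around p (sent to the origin, z = phi), the foliation
   {Im z^(k/2) = const} has a k-prong at p, and so has {Re z^(k/2) = const}: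
   near each other point q, the function w + i v is, up to additive constants
   and signs, a continuous branch of z^(k/2). *)
Definition is_prong_branch (k : nat) (phi : plane_chart R T) (q : T)
    (w v : T -> R) :=
  exists (b : bool) (c d : R), \forall y \near q,
    (Complex (w y - c) ((-1) ^+ b * (v y - d))) ^+ 2
    = (Complex (phi y).1 (phi y).2) ^+ k.

(* The chart phi isolates the singularity p and the number of prongs is not 2
   (a 2-prong is a regular point; k = 1 is a spine). *)
Definition prong_setting (Sigma : set T) (k : nat) (phi : plane_chart R T)
    (p : T) :=
  [/\ (0 < k)%N, k != 2%N, dom phi `&` Sigma = [set p] & phi p = (0, 0)].

(* A measured foliation is given by local transverse coordinates (U, v): the
   plaques are the level sets of v : U -> R and the transverse measure is
   |dv|. On overlaps coordinates agree up to sign and additive constant. *)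
Record measured_foliation := MeasuredFoliation {
  sing : set T;
  tcoord : set (set T * (T -> R));
  sing_finite : finite_set sing;
  tcoord_open : forall U v, tcoord (U, v) -> open U;
  tcoord_cover : forall x, ~ sing x <-> exists U v, tcoord (U, v) /\ U x;
  tcoord_submersion : forall U v x, tcoord (U, v) -> U x ->
    exists phi : plane_chart R T,
      [/\ dom phi x, dom phi `<=` U &
          forall y, dom phi y -> (phi y).2 = v y];
  tcoord_compat : forall U v U' v' x, tcoord (U, v) -> tcoord (U', v') ->
    U x -> U' x -> exists (b : bool) (c : R),
      \forall y \near x, v' y = (-1) ^+ b * v y + c;
  sing_prong : forall p, sing p ->
    exists (k : nat) (phi : plane_chart R T),
      prong_setting sing k phi p /\
      forall q, dom phi q -> q <> p ->
        forall U v, tcoord (U, v) -> U q ->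
          exists2 w : T -> R, (\forall y \near q, {for y, continuous w}) &
            is_prong_branch k phi q w v }.

(* Same singularities, complementary coordinates at regular points, and at a
   singularity the horizontal and vertical foliations of one k-prong. *)
Definition transverse (F G : measured_foliation) :=
  [/\ sing F = sing G,
      (forall U v V w x, tcoord F (U, v) -> tcoord G (V, w) ->
         U x -> V x -> exists phi : plane_chart R T,
           [/\ dom phi x, dom phi `<=` U `&` V &
               forall y, dom phi y -> phi y = (w y, v y)]) &
      forall p, sing F p ->
        exists (k : nat) (phi : plane_chart R T),
          prong_setting (sing F) k phi p /\
          forall q, dom phi q -> q <> p ->
            forall U v V w, tcoord F (U, v) -> tcoord G (V, w) ->
              U q -> V q -> is_prong_branch k phi q w v].

(* f maps F to itself and multiplies its transverse measure by l. *)
Definition scales (f : T -> T) (F : measured_foliation) (l : R) :=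
  f @` sing F = sing F /\
  forall U v U' v' x, tcoord F (U, v) -> tcoord F (U', v') ->
    U x -> U' (f x) -> exists (b : bool) (c : R),
      \forall y \near x, v' (f y) = (-1) ^+ b * (l * v y) + c.

(* Paths inside leaves; they may run through singularities, from one prong to
   another. *)
Definition leaf_path (F : measured_foliation) (gamma : R -> T) :=
  {within I01 R, continuous gamma} /\
  forall t U v, I01 R t -> tcoord F (U, v) -> U (gamma t) ->
    \forall s \near t, I01 R s -> v (gamma s) = v (gamma t).

(* The connected component of x in (leaf of x) `&` A for the leaf topology.
   The topology induced by T would be wrong here: leaves may be dense and
   removing a point of a leaf need not disconnect it for that topology. *)
Definition leaf_component (F : measured_foliation) (A : set T) (x : T) :
    set T :=
  [set y | exists gamma : R -> T,
     [/\ leaf_path F gamma, gamma 0 = x, gamma 1 = y &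
         forall t, I01 R t -> A (gamma t)]].

Definition leaf (F : measured_foliation) (x : T) : set T :=
  leaf_component F setT x.

Definition separatrix (F : measured_foliation) (p : T) (A : set T) :=
  exists x, [/\ leaf F p x, x <> p & A = leaf_component F (~` [set p]) x].

(* Nondegenerate compact arc I of a leaf, with endpoints a and b. *)
Definition leaf_interval (F : measured_foliation) (I : set T) (a b : T) :=
  arc_between R I a b /\ I `<=` leaf F a.

(* The arc [p, x] of the leaf of p; leaves of a pseudo-Anosov foliation contain
   no closed curve, so that there is only one arc in this union. *)
Definition leaf_segment (F : measured_foliation) (p x : T) : set T :=
  [set y | exists2 A, leaf_interval F A p x & A y].

Definition interior_of (I : set T) (a b : T) : set T := I `\` [set a; b].

End Foliations.

(* The definitions below are for an ordered pair (F, G) of transverse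
   foliations: (stable, unstable) as written, and (unstable, stable) for the
   notions obtained by exchanging s and u. *)
Section Rectangles.
Variables (R : realType) (S : surface R).
Implicit Types (F G : measured_foliation R S).

Definition trivially_bifoliated F G (r : set S) :=
  [/\ open r, connected r, r !=set0 &
      forall x y, r x -> r y ->
        let I := closure (leaf_component F r x) in
        let J := closure (leaf_component G r y) in
        [/\ exists a b, arc_between R I a b,
            exists a b, arc_between R J a b &
            exists2 z, r z & I `&` J = [set z]]].

Definition rectangle F G (Q : set S) :=
  exists2 r, trivially_bifoliated F G r & Q = closure r.

Definition closed_square : set (R * R) := I01 R `*` I01 R.
Definition open_square : set (R * R) :=
  (`]0, 1[%classic : set R) `*` (`]0, 1[%classic : set R).

Definition hleaf (rho : R * R -> S) (y : R) : set S :=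
  (fun x => rho (x, y)) @` I01 R.
Definition vleaf (rho : R * R -> S) (x : R) : set S :=
  (fun y => rho (x, y)) @` I01 R.

Definition parametrization F G (Q : set S) (rho : R * R -> S) :=
  [/\ {within closed_square, continuous rho},
      rho @` closed_square = Q,
      embedding_on open_square rho /\
        orientation_preserving_on open_square rho,
      (forall y, I01 R y ->
         embedding_on (I01 R) (fun x => rho (x, y)) /\
         exists c, hleaf rho y `<=` leaf F c) &
      (forall x, I01 R x ->
         embedding_on (I01 R) (fun y => rho (x, y)) /\
         exists c, vleaf rho x `<=` leaf G c)].

Definition embedded_rectangle F G (Q : set S) (rho : R * R -> S) :=
  [/\ rectangle F G Q, parametrization F G Q rho &
      embedding_on closed_square rho].

(* delta : set (set S) is a family of intervals of leaves of F. *)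
Definition family_union (delta : set (set S)) : set S :=
  \bigcup_(I in delta) I.

Definition endpoints (delta : set (set S)) : set S :=
  [set a | exists I b, delta I /\ arc_between R I a b].

Definition regular_part (delta : set (set S)) : set S :=
  family_union delta `\` endpoints delta.

Definition regular_rail G (delta : set (set S)) (J : set S) :=
  exists a b, [/\ leaf_interval G J a b,
    interior_of J a b `&` family_union delta = set0,
    regular_part delta a & regular_part delta b].

Definition extreme_rail F G (delta : set (set S)) (J : set S) :=
  (exists a b, leaf_interval G J a b /\
     (~ regular_part delta a \/ ~ regular_part delta b)) /\
  exists Q rho, [/\ embedded_rectangle F G Q rho,
    hleaf rho 0 `|` hleaf rho 1 `<=` family_union delta &
    exists x0, [/\ x0 = 0 \/ x0 = 1, J = vleaf rho x0 &
      forall x, I01 R x -> x <> x0 ->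
        regular_rail G delta (vleaf rho x)]].

Definition compatible F G (delta delta' : set (set S)) :=
  [/\ endpoints delta `<=` family_union delta',
      endpoints delta' `<=` family_union delta,
      (forall J, extreme_rail F G delta J -> J `<=` family_union delta') &
      (forall J, extreme_rail G F delta' J -> J `<=` family_union delta)].

(* Segments of F from a point of P to a point of B, with interior disjoint
   from B. *)
Definition segments_to F (P B : set S) : set (set S) :=
  [set I | exists a b, [/\ leaf_interval F I a b, P a, B b &
                           interior_of I a b `&` B = set0]].

End Rectangles.

Record gen_pseudo_Anosov (R : realType) := GenPseudoAnosov {
  pA_surface : surface R;
  pA_map :> homeo pA_surface pA_surface;
  pA_orient : orientation_preserving pA_map;
  Fs : measured_foliation R pA_surface;
  Fu : measured_foliation R pA_surface;
  Fs_Fu_transverse : transverse Fs Fu;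
  dilatation : R;
  dilatation_gt1 : 1 < dilatation;
  (* the transverse measure of Fs measures unstable arcs, stretched by f *)
  Fs_scaled : scales pA_map Fs dilatation;
  Fu_scaled : scales pA_map Fu dilatation^-1;
  (* the singular points, or the chosen finite family of periodic points when
     the foliations are regular *)
  Sing : set pA_surface;
  Sing_singular : sing Fs !=set0 -> Sing = sing Fs;
  Sing_regular : sing Fs = set0 ->
    finite_set Sing /\
    forall p, Sing p -> exists2 n, (0 < n)%N & iter n pA_map p = p }.

Arguments Sing {R} g.
Arguments Fs {R} g.
Arguments Fu {R} g.

Section CompatibilityOrder.
Variables (R : realType) (f : gen_pseudo_Anosov R).
Local Notation S := (pA_surface f).

(* x is a first intersection point, on separatrices of p and q. *)
Definition first_intersection (p q x : S) :=
  [/\ Sing f p, Sing f q, ~ Sing f x,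
      (exists A B, [/\ separatrix (Fs f) p A, separatrix (Fu f) q B,
                       A x & B x]) &
      (leaf_segment (Fs f) p x `\ p) `&` (leaf_segment (Fu f) q x `\ q)
        = [set x]].

(* q is determined by z: an unstable leaf contains at most one point of
   Sing f. *)
Definition backward_orbit_arc (q z : S) : set S :=
  \bigcup_i (iter i (hinv f) @` leaf_segment (Fu f) q z).

Definition delta_s (q z : S) : set (set S) :=
  segments_to (Fs f) (Sing f) (backward_orbit_arc q z).

Definition delta_u (q z : S) : set (set S) :=
  segments_to (Fu f) (Sing f) (family_union (delta_s q z)).

Definition push_family (n : nat) (delta : set (set S)) : set (set S) :=
  (fun I => iter n f @` I) @` delta.

Definition eventually_compatible (q z : S) : set nat :=
  [set N | forall n, (N <= n)%N ->
     compatible (Fs f) (Fu f) (delta_s q z) (push_family n (delta_u q z))].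

(* xget returns 0 when the minimum, resp. the maximum, does not exist. *)
Definition compat_coefficient (q z : S) : nat :=
  xget 0%N [set N | eventually_compatible q z N /\
                    forall M, eventually_compatible q z M -> (N <= M)%N].

Definition compat_coefficients : set nat :=
  [set N | exists p q z, first_intersection p q z /\
                         N = compat_coefficient q z].

Definition compat_order : nat :=
  xget 0%N [set N | compat_coefficients N /\
                    forall M, compat_coefficients M -> (M <= N)%N].

End CompatibilityOrder.

Definition conjugated_through (R : realType) (f g : gen_pseudo_Anosov R)
    (h : homeo (pA_surface f) (pA_surface g)) :=
  forall x, f x = hinv h (g (h x)).

(* Main.v *)
Require Import Defs.
From HB Require Import structures.
From mathcomp Require Import all_boot all_order all_algebra.
From mathcomp Require Import all_classical all_reals all_analysis.
From mathcomp.real_closed Require Import complex.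
From mathcomp Require Import ring lra zify separable cyclotomic.

(* The compatibility order is built from the leaves, the marked points, the
   surface topology and, through the rectangles, the orientation.  A conjugacy
   h respects all of these up to reversing the orientation.

   Leaves.  Near a regular point, the iterates of f shrink a stable arc below
   any open cover, hence those of g shrink its image; but g stretches every
   path transverse to its stable foliation.  So h maps stable plaques to stable
   plaques, and dually with the inverse maps for unstable ones.  It then maps
   the prongs at a point into those of its image, whence equal numbers of prongs
   and the preservation of singularities.

   Orientation.  Read in charts, h is a local homeomorphism of the plane, so its
   local degree is invertible, and charts of the surface of g are compatible for
   the degree because g itself preserves it.  On the connected open square
   the degree of a parametrization composed with h is therefore constantly 1 or
   constantly -1, and in the second case (x, y) |-> (1 - x, y) corrects it. *)

Set Implicit Arguments.
Unset Strict Implicit.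
Unset Printing Implicit Defensive.
Import Order.TTheory GRing.Theory Num.Theory.
Import numFieldNormedType.Exports.
Local Open Scope classical_set_scope.
Local Open Scope ring_scope.

(** * Winding numbers *)

(** A mere homeomorphism gives no control of lengths, so the smallness of an image arc is expressed
    only by membership in one set of a cover by neighbourhoods, and compactness supplies the
    threshold. Even at a regular point, the argument follows iterates that may come near
    singularities, where transverse coordinates branch. Hence the functions [im_sq] and [re_sq],
    defined on a whole chart around any point: a bound on [im_sq] bounds the variation of the
    transverse coordinate along a path.

    Likewise h has no derivative, so orientation is treated through winding numbers of images of
    small circles, which make sense for continuous injective maps, are locally constant and multiply
    under composition. Reversing orientation is harmless because rails use a parametrization only
    through its horizontal and vertical leaves, which a reflection of the square permutes.

    Most other notions are transported as inclusions, and equality follows by applying them to the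
    inverse of h. At the end the two sets of coefficients are equal, so [xget] selects the same
    value. *)

(** Connectedness of the segment, in the form that serves the passages from local to global below:
    liftings, degrees, additive constants of transverse coordinates. *)
Lemma segment_invariant (R : realType) (a b : R) (P : R -> Prop) :
  (forall s, a <= s <= b ->
     \forall s' \near s, a <= s' <= b -> (P s' <-> P s)) ->
  forall s s', a <= s <= b -> a <= s' <= b -> P s -> P s'.
Proof.
move=> hP s s' hs hs' Ps.
pose B := [set x | a <= x <= b /\ P x].
suff: B = `[a, b]%classic.
  by move=> /seteqP[_ /(_ s')]; rewrite /= in_itv /= => /(_ hs') [].
apply: (@segment_connected R a b).
- by exists s.
- exists ([set x | a <= x <= b -> P x])°%classic; first exact: open_interior.
  apply/seteqP; split=> x; rewrite /B /= in_itv /=.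
    move=> [hx Px]; split=> //; rewrite /interior /=.
    by apply: filterS (hP x hx) => y hy /hy [_]; apply.
  by move=> [hx /nbhs_singleton /= h]; split=> //; apply: h.
- exists (~` ([set x | a <= x <= b -> ~ P x])°%classic).
    by apply: open_closedC; exact: open_interior.
  apply/seteqP; split=> x; rewrite /B /= in_itv /=.
    by move=> [hx Px]; split=> // /nbhs_singleton /= h; exact: (h hx).
  move=> [hx nI]; split=> //; apply: contrapT => nPx; apply: nI.
  rewrite /interior /=; apply: filterS (hP x hx) => y hy /hy [h _] /h.
  exact: nPx.
Qed.

Section Winding.
Variable R : realType.
Local Notation circle := (@circle R).
Implicit Types (p q : R -> R * R) (t u r s a b : R) (z w : R * R).

Lemma scale_pairE s a b : s *: (a, b) = (s * a, s * b) :> R * R.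
Proof. by []. Qed.

Lemma circle_continuous : continuous circle.
Proof.
move=> t.
have h : {for t, continuous (fun t : R => 2 * pi * t)}.
  by apply: cvgM; [exact: cvg_cst|exact: cvg_id].
apply: (@cvg_pair _ _ _ _ (nbhs _) (nbhs _)).
  exact: (continuous_comp h (@continuous_cos _ _)).
exact: (continuous_comp h (@continuous_sin _ _)).
Qed.

Lemma circle_periodic t : circle (t + 1) = circle t.
Proof.
rewrite /Defs.circle.
have -> : 2 * pi * (t + 1) = 2 * pi * t + pi *+ 2 :> R by ring.
by rewrite cosD2pi sinD2pi.
Qed.

Lemma circle_int t (k : int) : circle (t + k%:~R) = circle t.
Proof.
case: k => k.
  elim: k t => [|k IH] t; first by rewrite addr0.
  by rewrite -addn1 PoszD intrD addrA circle_periodic IH.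
rewrite NegzE; elim: k.+1 t => [|j IH] t; first by rewrite oppr0 addr0.
rewrite -[RHS]IH -[LHS]circle_periodic; congr circle.
by rewrite -addn1 PoszD opprD intrD; ring.
Qed.

(** [dot] and [det2] are |z||w| times the cosine and the sine of the angle from z to w, for
    Euclidean lengths. *)
Definition dot (z w : R * R) : R := z.1 * w.1 + z.2 * w.2.
Definition det2 (z w : R * R) : R := z.1 * w.2 - z.2 * w.1.

Lemma dot_circle t : dot (circle t) (circle t) = 1.
Proof. by rewrite /dot /= -!expr2 cos2Dsin2. Qed.

Lemma dotC z w : dot z w = dot w z.
Proof. by rewrite /dot; ring. Qed.

Lemma dot_gt0 z : z <> 0 -> 0 < dot z z.
Proof.
case: z => a b hz; rewrite /dot /= -!expr2.
have [a0|a0] := eqVneq a 0.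
  have [b0|b0] := eqVneq b 0; first by case: hz; rewrite a0 b0.
  by rewrite ltr_wpDl ?sqr_ge0// exprn_even_gt0.
by rewrite ltr_pwDl ?sqr_ge0// exprn_even_gt0.
Qed.

Lemma scale_circle_neq0 s t : 0 < s -> s *: circle t <> 0.
Proof.
move=> s0 h; have := dot_circle t.
have : dot (s *: circle t) (s *: circle t) = 0.
  by rewrite h /dot /= mulr0 addr0.
rewrite (_ : dot _ _ = s ^+ 2 * dot (circle t) (circle t)); last first.
  by rewrite /dot /= /GRing.scale /=; ring.
by move=> + h1; rewrite h1 mulr1 => /eqP; rewrite sqrf_eq0 gt_eqF.
Qed.

(** The angle from z to w in turns, correct when [0 < dot z w]; it then lies between -1/4 and
    1/4. *)
Definition turn_by (z w : R * R) : R := atan (det2 z w / dot z w) / (2 * pi).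

Lemma twopi_neq0 : 2 * pi != 0 :> R.
Proof. by rewrite mulf_neq0// ?gt_eqF ?pi_gt0. Qed.

Lemma turn_byP z w a s : 0 < s -> z = s *: circle a -> 0 < dot z w ->
  exists2 s', 0 < s' & w = s' *: circle (a + turn_by z w).
Proof.
move=> s0 hz h.
pose b := atan (det2 z w / dot z w).
pose k := (Num.sqrt (1 + (det2 z w / dot z w) ^+ 2))^-1.
have k0 : 0 < k by rewrite invr_gt0 sqrtr_gt0 ltr_pwDl ?sqr_ge0.
have cb : cos b = k by rewrite /b cos_atan.
have sb : sin b = k * (det2 z w / dot z w).
  have := atanK (det2 z w / dot z w); rewrite /tan -/b cb => /(canRL (divfK _)).
  by rewrite gt_eqF// mulrC => ->.
(* [dot z w] is |z||w| cos b with |z| = s and cos b = k, so this quotient is |w|. *)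
exists (dot z w / (s * k)); first by rewrite divr_gt0// mulr_gt0.
have hd : 2 * pi * (a + turn_by z w) = 2 * pi * a + b.
  by rewrite mulrDr /turn_by -/b mulrCA mulfV ?mulr1// twopi_neq0.
rewrite /Defs.circle hd cosD sinD cb sb.
have hc : cos (2 * pi * a) ^+ 2 + sin (2 * pi * a) ^+ 2 = 1 := cos2Dsin2 _.
move: hz h; rewrite /Defs.circle.
set C := cos _ in hc *; set S := sin _ in hc * => hz h.
clear hd cb sb; clearbody k; clear b; case: w h => w1 w2 h.
have dE : dot z (w1, w2) = s * (C * w1 + S * w2).
  by rewrite hz /dot /= /GRing.scale /=; ring.
have eE : det2 z (w1, w2) = s * (C * w2 - S * w1).
  by rewrite hz /det2 /= /GRing.scale /=; ring.
have s1 : s != 0 by rewrite gt_eqF.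
have k1 : k != 0 by rewrite gt_eqF.
have d1 : dot z (w1, w2) != 0 by rewrite gt_eqF.
rewrite [RHS](_ : _ = (s^-1 * (C * dot z (w1,w2) - S * det2 z (w1, w2)),
                s^-1 * (S * dot z (w1, w2) + C * det2 z (w1, w2)))); last first.
  by rewrite scale_pairE; congr pair; field; rewrite s1 k1 d1.
rewrite dE eE.
congr pair.
  by transitivity ((C ^+ 2 + S ^+ 2) * w1); [rewrite hc mul1r|field].
by transitivity ((C ^+ 2 + S ^+ 2) * w2); [rewrite hc mul1r|field].
Qed.

Lemma circle_scale_eq s s' a b : 0 < s -> 0 < s' ->
  s *: circle a = s' *: circle b -> exists n : int, b = a + n%:~R.
Proof.
move=> s0 s'0 h.
have eqs : s = s'.
  have : dot (s *: circle a) (s *: circle a) =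
         dot (s' *: circle b) (s' *: circle b) by rewrite h.
  have e x y : dot (x *: circle y) (x *: circle y) = x ^+ 2.
    by rewrite -[RHS]mulr1 -(dot_circle y) /dot /= /GRing.scale /=; ring.
  by rewrite !e => /eqP; rewrite eqrXn2 ?ltW// => /eqP.
rewrite -eqs in h; move: h => [/(mulfI (lt0r_neq0 s0)) hc /(mulfI (lt0r_neq0 s0)) hs].
have cb1 : cos (2 * pi * b - 2 * pi * a) = 1.
  by rewrite cosB -hc -hs -!expr2 cos2Dsin2.
pose n := Num.floor (b - a).
pose d := b - a - n%:~R.
have /andP[d0 d1] : 0 <= d < 1.
  have /andP[h1] := floor_itv (b - a); rewrite -/n intrD => h2.
  by apply/andP; rewrite /d; move: h1 h2; split; lra.
have cd : cos (2 * pi * d) = 1.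
  have -> : 2 * pi * d = (2 * pi * b - 2 * pi * a) + (pi *+ 2) *~ - n.
    by rewrite /d -(mulrzl (pi *+ 2)) mulrNz; ring.
  rewrite -[RHS]cb1; case: (- n) => m.
    by rewrite -pmulrn periodicn//; exact: cosD2pi.
  rewrite NegzE mulrNz -pmulrn.
  rewrite -[in RHS](subrK ((pi *+ 2) *+ m.+1) (2 * pi * b - 2 * pi * a)).
  by rewrite [RHS]periodicn//; exact: cosD2pi.
exists n; suff : d = 0 by rewrite /d => /eqP; rewrite subr_eq0 => /eqP; lra.
have pi0 := pi_gt0 R.
(* [cos] is injective on [0, pi]. Beyond pi, injectivity is applied to [1 - d] instead, which gives
   d = 1, against [d < 1]. *)
case: (leP (2 * pi * d) pi) => hd.
  have : 2 * pi * d = 0.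
    apply: cos_inj; rewrite ?cd ?cos0// in_itv /=.
      by rewrite hd andbT mulr_ge0// mulr_ge0// ltW.
    by rewrite lexx ltW.
  by move=> /eqP; rewrite mulf_eq0 (negPf twopi_neq0) /= => /eqP.
have : 2 * pi * (1 - d) = 0.
  apply: cos_inj; rewrite ?cos0 ?in_itv /=.
  - apply/andP; split; last by lra.
    by rewrite mulr_ge0// ?mulr_ge0// ?subr_ge0 ltW.
  - by rewrite lexx ltW.
  - rewrite (_ : 2 * pi * (1 - d) = - (2 * pi * d) + pi *+ 2); last by ring.
    by rewrite cosD2pi cosN.
by move=> /eqP; rewrite mulf_eq0 (negPf twopi_neq0) /= subr_eq0 => /eqP h; lra.
Qed.

End Winding.

Section Pairs.
Variables (T A B : topologicalType) (x : T).

Lemma continuous_fst (f : T -> A * B) :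
  {for x, continuous f} -> {for x, continuous (fun y => (f y).1)}.
Proof. by move=> h; apply: (continuous_comp h); exact: cvg_fst. Qed.

Lemma continuous_snd (f : T -> A * B) :
  {for x, continuous f} -> {for x, continuous (fun y => (f y).2)}.
Proof. by move=> h; apply: (continuous_comp h); exact: cvg_snd. Qed.

Lemma continuous_pair (f : T -> A) (g : T -> B) :
  {for x, continuous f} -> {for x, continuous g} ->
  {for x, continuous (fun y => (f y, g y))}.
Proof. by move=> hf hg; apply: (@cvg_pair _ _ _ _ (nbhs _) (nbhs _)). Qed.

End Pairs.

(** * Continuous arguments of paths in the punctured plane *)

Section Lifting.
Variable R : realType.
Local Notation circle := (@circle R).
Implicit Types (p q : R -> R * R) (t u r s a b : R) (z w : R * R).

(** The argument of [p] in turns; it forces [p] to be nonzero on [A]. Continuity is required at the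
    points of [A] in the whole line, so no subspace topology is involved. *)
Definition lift_on (A : set R) p (th : R -> R) :=
  forall t, A t -> {for t, continuous th} /\
    exists2 s, 0 < s & p t = s *: circle (th t).

Lemma dot_continuous (T : topologicalType) (f g : T -> R * R) x :
  {for x, continuous f} -> {for x, continuous g} ->
  {for x, continuous (fun y => dot (f y) (g y))}.
Proof.
move=> hf hg; apply: cvgD; apply: cvgM.
- exact: (continuous_fst hf).
- exact: (continuous_fst hg).
- exact: (continuous_snd hf).
- exact: (continuous_snd hg).
Qed.

Lemma det2_continuous (T : topologicalType) (f g : T -> R * R) x :
  {for x, continuous f} -> {for x, continuous g} ->
  {for x, continuous (fun y => det2 (f y) (g y))}.
Proof.
move=> hf hg; apply: cvgB; apply: cvgM.
- exact: (continuous_fst hf).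
- exact: (continuous_snd hg).
- exact: (continuous_snd hf).
- exact: (continuous_fst hg).
Qed.

Lemma turn_by_continuous p q t :
  {for t, continuous p} -> {for t, continuous q} -> 0 < dot (p t) (q t) ->
  {for t, continuous (fun t => turn_by (p t) (q t))}.
Proof.
move=> hp hq h; apply: cvgM; last exact: cvg_cst.
apply: (@continuous_comp _ _ _ (fun t => det2 (p t) (q t) / dot (p t) (q t))
  (@atan R)); last exact: continuous_atan.
apply: cvgM; first exact: det2_continuous.
by apply: cvgV; [rewrite gt_eqF|exact: dot_continuous].
Qed.

(** Vectors with positive dot product are less than a quarter turn apart, so [turn_by] carries a
    lifting from one value of u to a nearby one. The second clause holds because the corrections at
    s and t agree; for the points t and t + 1 of a loop it preserves the increment over a period. *)
Lemma lift_homotopy (A : set R) (H : R -> R -> R * R) :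
  (forall u t, 0 <= u <= 1 -> A t -> {for t, continuous (H u)}) ->
  (forall u, 0 <= u <= 1 -> \forall u' \near u, 0 <= u' <= 1 ->
     forall t, A t -> 0 < dot (H u t) (H u' t)) ->
  forall u u' th, 0 <= u <= 1 -> 0 <= u' <= 1 -> lift_on A (H u) th ->
  exists2 th', lift_on A (H u') th' &
    forall s t, A s -> A t -> (forall v, 0 <= v <= 1 -> H v s = H v t) ->
      th' t - th' s = th t - th s.
Proof.
move=> Hc Hd u u' th hu hu' hth.
pose P v := exists2 th', lift_on A (H v) th' &
    forall s t, A s -> A t -> (forall v, 0 <= v <= 1 -> H v s = H v t) ->
      th' t - th' s = th t - th s.
have step v v' : 0 <= v <= 1 -> 0 <= v' <= 1 ->
  (forall t, A t -> 0 < dot (H v t) (H v' t)) -> P v -> P v'.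
  move=> hv hv' hd [th1 h1 e1].
  exists (fun t => th1 t + turn_by (H v t) (H v' t)).
    move=> t At; have [c1 [s s0 hs]] := h1 t At; split.
      apply: cvgD => //; apply: turn_by_continuous; [exact: Hc|exact: Hc|].
      exact: hd.
    have [s' s'0 hs'] := turn_byP s0 hs (hd t At).
    by exists s'.
  by move=> s t As At e; rewrite (e v)// (e v')// -(e1 s t)//; ring.
suff key : forall s, 0 <= s <= 1 -> \forall s' \near s, 0 <= s' <= 1 ->
    (P s' <-> P s) by apply: (segment_invariant key hu hu'); exists th.
move=> s hs; apply: filterS (Hd s hs) => s' h hs'; split; apply: step => //.
  by move=> t At; rewrite dotC; exact: h.
by move=> t At; exact: h.
Qed.

(** For [u' = u] the product is the squared length of [H u t], hence positive; compactness of
    [[a, b]] makes the neighbourhood of u independent of t. *)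
Lemma dot_gt0_uniform (H : R -> R -> R * R) a b :
  (forall u t, 0 <= u <= 1 -> a <= t <= b ->
     {for (u, t), continuous (fun z => H z.1 z.2)} /\ H u t <> 0) ->
  forall u, 0 <= u <= 1 -> \forall u' \near u, 0 <= u' <= 1 ->
     forall t, a <= t <= b -> 0 < dot (H u t) (H u' t).
Proof.
move=> Hc u hu.
have : \forall u' \near u, `[a, b]%classic `<=` [set t | 0 < dot (H u t) (H u' t)].
  have /compact_near_coveringP hK := @segment_compact R a b.
  apply: (hK R (nbhs u) (fun u' t => 0 < dot (H u t) (H u' t))) => t.
  rewrite /= in_itv /= => ht.
  have [c nz] := Hc u t hu ht.
  have ct : {for (t, u), continuous (fun z => H z.2 z.1)}.
    apply: (@continuous_comp _ _ _ (fun z : R * R => (z.2, z.1))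
      (fun z => H z.1 z.2)) => //.
    by apply: (@cvg_pair _ _ _ _ (nbhs _) (nbhs _)); [exact: cvg_snd|exact: cvg_fst].
  have cu : {for (t, u), continuous (fun z : R * R => H u z.1)}.
    apply: (@continuous_comp _ _ _ (fun z : R * R => (u, z.1))
      (fun z => H z.1 z.2)) => //.
    by apply: (@cvg_pair _ _ _ _ (nbhs _) (nbhs _)); [exact: cvg_cst|exact: cvg_fst].
  have cd := dot_continuous cu ct.
  exact: (cvgr_gt _ cd _ (dot_gt0 nz)).
apply: filterS => u' h _ t ht.
by have := h t; rewrite /= in_itv /=; exact.
Qed.

(** The difference of two liftings is continuous with integer values. *)
Lemma lift_diff_const p th th' a b :
  lift_on [set t | a <= t <= b] p th -> lift_on [set t | a <= t <= b] p th' ->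
  forall s t, a <= s <= b -> a <= t <= b -> th' t - th t = th' s - th s.
Proof.
move=> h h' s t hs ht.
pose d t := th' t - th t.
have dn x : a <= x <= b -> exists n : int, d x = n%:~R.
  move=> hx; have [_ [r r0 e]] := h x hx; have [_ [r' r'0 e']] := h' x hx.
  rewrite e in e'; have [n hn] := circle_scale_eq r0 r'0 e'.
  by exists n; rewrite /d hn; ring.
suff key : forall x, a <= x <= b -> \forall y \near x, a <= y <= b ->
    (d y = d s <-> d x = d s) by exact: (segment_invariant key hs ht).
move=> x hx.
have cd : {for x, continuous d}.
  by apply: cvgB; [case: (h' x hx)|case: (h x hx)].
have hn : \forall y \near x, `|d y - d x| < 1 by exact: cvgr_distC_lt cd _ ltr01.
apply: filterS hn => y /= hy hyab.
have -> // : d y = d x.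
have [n hn] := dn y hyab; have [m hm] := dn x hx.
move: hy; rewrite hn hm -intrB -intr_norm -[1]/(1%:~R) ltr_int.
by move=> hnm; congr _%:~R; lia.
Qed.

Lemma lift_exists_segment p (N : R) : 0 < N -> continuous p ->
  (forall t, p t <> 0) -> exists th, lift_on [set t | - N <= t <= N] p th.
Proof.
move=> N0 cp p0.
(* Shrinking the parameter contracts [p] to the constant path [p 0], which has a constant
   lifting. *)
pose H u t := p (u * t).
have HC : continuous (fun z : R * R => H z.1 z.2).
  move=> z; apply: (@continuous_comp _ _ _ (fun z : R * R => z.1 * z.2) p); last exact: cp.
  by apply: cvgM; [exact: cvg_fst|exact: cvg_snd].
have Hc : forall u t, 0 <= u <= 1 -> [set t | - N <= t <= N] t ->
    {for t, continuous (H u)}.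
  move=> u t _ _.
  apply: (@continuous_comp _ _ _ (fun t => u * t) p); last exact: cp.
  by apply: cvgM; [exact: cvg_cst|exact: cvg_id].
have Hd : forall u, 0 <= u <= 1 -> \forall u' \near u, 0 <= u' <= 1 ->
    forall t, - N <= t <= N -> 0 < dot (H u t) (H u' t).
  move=> u hu; apply: (@dot_gt0_uniform H (- N) N _ u hu) => v t1 _ _.
  split; last exact: p0.
  exact: (HC (v, t1)).
have [th0 h0] : exists th, lift_on [set t | - N <= t <= N] (H 0) th.
  have pe := p0 0; set z := p 0 in pe.
  have [a [s s0 hz]] : exists a, exists2 s, 0 < s & z = s *: circle a.
    (* [turn_by] reaches only the open half-plane around its reference direction; the directions 0,
       1/2, 1/4 and -1/4, in turns, together reach every nonzero vector. *)
    have [h|h] := ltP 0 z.1.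
      have hd : 0 < dot (1 *: circle 0) z.
        by rewrite /dot /= mulr0 cos0 sin0 /GRing.scale /=; lra.
      have [s s0 e] := turn_byP ltr01 erefl hd.
      by exists (0 + turn_by (1 *: circle 0) z); exists s.
    have [h1|h1] := ltP z.1 0.
      have hd : 0 < dot (1 *: circle (2^-1)) z.
        have q2 : 2 * pi * 2^-1 = pi :> R by field.
        rewrite /dot /= q2 cospi sinpi.
        by rewrite /GRing.scale /=; lra.
      have [s s0 e] := turn_byP ltr01 erefl hd.
      by exists (2^-1 + turn_by (1 *: circle (2^-1)) z); exists s.
    have z10 : z.1 = 0 by apply/eqP; rewrite eq_le h h1.
    have q4 : 2 * pi * 4^-1 = pi / 2 :> R by field.
    have [h2|h2] := ltP 0 z.2.
      have hd : 0 < dot (1 *: circle (4^-1)) z.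
        rewrite /dot /= q4 cos_pihalf sin_pihalf.
        by rewrite /GRing.scale /=; lra.
      have [s s0 e] := turn_byP ltr01 erefl hd.
      by exists (4^-1 + turn_by (1 *: circle (4^-1)) z); exists s.
    have hd : 0 < dot (1 *: circle (- 4^-1)) z.
      rewrite /dot /= mulrN q4 cosN sinN cos_pihalf sin_pihalf.
      rewrite /GRing.scale /=.
      suff : z.2 != 0 by move=> h3; have : z.2 < 0 by [rewrite lt_neqAle h3]; lra.
      by apply/eqP => z20; apply: pe; case: z z10 z20 {h h1 h2} => ? ? /= -> ->.
    have [s s0 e] := turn_byP ltr01 erefl hd.
    by exists (- 4^-1 + turn_by (1 *: circle (- 4^-1)) z); exists s.
  exists (fun=> a) => t _; split; first exact: cvg_cst.
  by exists s => //; rewrite /H mul0r.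
have [||th1 h1 _] := lift_homotopy Hc Hd _ _ h0 (u' := 1).
- by rewrite lexx ler01.
- by rewrite lexx ler01.
exists th1; move=> t At; have := h1 t At.
by rewrite /H mul1r.
Qed.

Lemma lift_exists p : continuous p -> (forall t, p t <> 0) ->
  exists th, lift_on setT p th.
Proof.
move=> cp p0.
have /choice[TH hTH] : forall n : nat, exists th,
    lift_on [set t | - n.+1%:R <= t <= n.+1%:R] p th.
  by move=> n; apply: lift_exists_segment => //; rewrite ltr0n.
(* Liftings on growing segments are shifted by integers to take the same value at 0; they then agree
   on common domains and glue together. *)
pose L n t := TH n t - TH n 0 + TH 0%N 0.
have L_lift n : lift_on [set t | - n.+1%:R <= t <= n.+1%:R] p (L n).
  have z0 m : - m.+1%:R <= (0 : R) <= m.+1%:R by rewrite oppr_le0 ler0n.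
  have [_ [s s0 e]] := hTH n 0 (z0 n).
  have [_ [s' s'0 e']] := hTH 0%N 0 (z0 0%N).
  rewrite e in e'; have [k hk] := circle_scale_eq s0 s'0 e'.
  move=> t ht; have [c [r r0 er]] := hTH n t ht; split.
    by apply: cvgD; [apply: cvgB => //; exact: cvg_cst|exact: cvg_cst].
  exists r => //; rewrite er; congr (_ *: _).
  by rewrite /L hk addrA addrNK circle_int.
have L0 n : L n 0 = TH 0%N 0 by rewrite /L subrr add0r.
have Lagree n m t : (n <= m)%N -> - n.+1%:R <= t <= n.+1%:R -> L n t = L m t.
  move=> nm /andP[t1 t2].
  have nmR : n.+1%:R <= m.+1%:R :> R by rewrite ler_nat ltnS.
  have hm : lift_on [set t | - n.+1%:R <= t <= n.+1%:R] p (L m).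
    move=> x /andP[x1 x2]; apply: L_lift.
    by rewrite /= (le_trans _ x1) ?lerN2// (le_trans x2).
  have := lift_diff_const (L_lift n) hm (s := 0) (t := t).
  rewrite !L0 subrr oppr_le0 ler0n t1 t2 => /(_ isT isT) /eqP.
  by rewrite subr_eq0 => /eqP.
pose N t := Num.bound t.
have Nt t : - (N t).+1%:R < t < (N t).+1%:R.
  rewrite -ltr_norml /N; apply: lt_trans (_ : (Num.bound t)%:R < _).
    exact: unstable.ltr_norm_bound.
  by rewrite ltr_nat.
exists (fun t => L (N t) t) => t _; split; last first.
  have [|_ //] := L_lift (N t) t.
  by have /andP[h1 h2] := Nt t; rewrite /= !ltW.
have ht : - (N t).+1%:R <= t <= (N t).+1%:R.
  by have /andP[h1 h2] := Nt t; rewrite !ltW.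
have [c _] := L_lift (N t) t ht.
have e : \forall x \near t, L (N t) x = L (N x) x.
  have /andP[h1 h2] := Nt t.
  near=> x.
  have hx : - (N t).+1%:R <= x <= (N t).+1%:R.
    by apply/andP; split; apply: ltW; near: x; [exact: lt_nbhsr|exact: lt_nbhsl].
  have hx' : - (N x).+1%:R <= x <= (N x).+1%:R.
    by have /andP[? ?] := Nt x; rewrite !ltW.
  by have [hN|/ltnW hN] := leqP (N t) (N x); rewrite (Lagree _ _ _ hN).
apply: cvg_trans c; exact: near_eq_cvg.
Unshelve. all: by end_near. Qed.

End Lifting.

Section Clamp.
Variables (R : realType) (T : topologicalType).

(** Retraction of the line onto [0, 1]; precomposing with it turns a path continuous within the
    interval into one continuous everywhere. *)
Definition clamp (t : R) : R := Num.max 0 (Num.min 1 t).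

Lemma clamp_I01 t : I01 R (clamp t).
Proof.
by rewrite /I01 /= in_itv /= /clamp le_max lexx ge_max ler01 ge_min lexx.
Qed.

Lemma clamp_id t : 0 <= t <= 1 -> clamp t = t.
Proof. by move=> /andP[t0 t1]; rewrite /clamp min_r// max_r. Qed.

Lemma I01P (t : R) : I01 R t <-> 0 <= t <= 1.
Proof. by rewrite /I01 /= in_itv. Qed.

Lemma continuous_clamp : continuous clamp.
Proof.
move=> t; apply: continuous_max; first exact: cvg_cst.
by apply: continuous_min; [exact: cvg_cst|exact: cvg_id].
Qed.

Lemma within_clamp (g : R -> T) :
  {within I01 R, continuous g} -> continuous (g \o clamp).
Proof.
move=> /subspace_continuousP h t.
have hc := h _ (clamp_I01 t).
apply: cvg_trans hc => A /= hA.
have hn : \forall s \near t, I01 R (clamp s) -> A (g (clamp s)).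
  exact: (continuous_clamp hA).
by apply: filterS hn => s; apply; exact: clamp_I01.
Qed.

End Clamp.

(** * Winding numbers of loops and local degrees *)

Section Index.
Variable R : realType.
Local Notation circle := (@circle R).
Implicit Types (p q : R -> R * R) (t u r s a b : R) (z w : R * R).
Implicit Types (tau sigma : R * R -> R * R).

(** When [p] has period 1, n is its winding number around 0. *)
Definition loop_lift p (n : int) :=
  exists2 th, lift_on setT p th & forall t, th (t + 1) = th t + n%:~R.

Lemma loop_lift_exists p : continuous p -> (forall t, p t <> 0) ->
  (forall t, p (t + 1) = p t) -> exists n, loop_lift p n.
Proof.
move=> cp p0 per; have [th hth] := lift_exists cp p0.
have [_ [s s0 e]] := hth 0 I; have [_ [s' s'0 e']] := hth 1 I.
rewrite -[1]add0r per e in e'.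
have [n hn] := circle_scale_eq s0 s'0 e'; exists n.
exists th => // t.
pose b := `|t|.
have hl1 : lift_on [set t | - b <= t <= b] p th by move=> x _; exact: hth.
have hl2 : lift_on [set t | - b <= t <= b] p (fun t => th (t + 1)).
  move=> x _; split.
    apply: (@continuous_comp R R R (fun x : R => x + 1) th x).
      by apply: cvgD; [exact: cvg_id|exact: cvg_cst].
    by case: (hth (x + 1) I).
  by rewrite -per; case: (hth (x + 1) I).
have := lift_diff_const hl1 hl2 (s := 0) (t := t).
rewrite -!ler_norml /b lexx normr0 normr_ge0 add0r => /(_ isT isT).
rewrite add0r in hn; rewrite hn addrAC subrr add0r => <-.
by ring.
Qed.

(** Any argument along one period computes the winding number, even one given on [I01 R] alone as in
    [preserves_orientation_at]. *)
Lemma loop_lift_unique p n th : loop_lift p n -> {within I01 R, continuous th} ->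
  (forall t, I01 R t -> exists2 s, 0 < s & p t = s *: circle (th t)) ->
  th 1 = th 0 + n%:~R.
Proof.
move=> [th' h' e'] cth hth.
have h1 : lift_on [set t | 0 <= t <= 1] p th'.
  by move=> t _; exact: h'.
have h2 : lift_on [set t | 0 <= t <= 1] (p \o @clamp R) (th \o @clamp R).
  move=> t ht; split; first exact: (within_clamp cth).
  by apply: hth; exact: clamp_I01.
have h3 : lift_on [set t | 0 <= t <= 1] (p \o @clamp R) (th' \o @clamp R).
  move=> t ht; split.
    apply: continuous_comp; first exact: continuous_clamp.
    by case: (h' (clamp t) I).
  by case: (h' (clamp t) I).
have := lift_diff_const h3 h2 (s := 0) (t := 1).
rewrite !lexx !ler01 /= !clamp_id ?lexx ?ler01// => /(_ isT isT).
have := e' 0; rewrite add0r => ->; lra.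
Qed.

Lemma loop_lift_homotopy (H : R -> R -> R * R) (n : int) :
  (forall u t, 0 <= u <= 1 ->
     {for (u, t), continuous (fun z => H z.1 z.2)} /\ H u t <> 0) ->
  (forall u t, 0 <= u <= 1 -> H u (t + 1) = H u t) ->
  loop_lift (H 0) n <-> loop_lift (H 1) n.
Proof.
move=> Hc Hp.
have in0 : 0 <= (0 : R) <= 1 by rewrite lexx ler01.
have in1 : 0 <= (1 : R) <= 1 by rewrite lexx ler01.
have c1 u t : 0 <= u <= 1 -> {for t, continuous (H u)}.
  move=> hu; apply: (@continuous_comp _ _ _ (fun t => (u, t))
    (fun z => H z.1 z.2)); last by case: (Hc u t hu).
  by apply: continuous_pair; [exact: cvg_cst|exact: cvg_id].
have c2 u : 0 <= u <= 1 -> \forall u' \near u, 0 <= u' <= 1 ->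
    forall t, [set: R] t -> 0 < dot (H u t) (H u' t).
  move=> hu.
  have := @dot_gt0_uniform R H 0 1 (fun u t hu _ => Hc u t hu) u hu.
  apply: filterS => u' h hu' t _.
  (* Periodicity reduces the estimate on the line to the compact segment [0, 1]. *)
  have red (m : int) x : H u (x + m%:~R) = H u x /\ H u' (x + m%:~R) = H u' x.
    elim: m x => [|m IH|m IH] x; first by rewrite addr0.
      by rewrite -addn1 PoszD intrD addrA !Hp//; exact: IH.
    rewrite -addn1 PoszD opprD intrD addrA -Hp// -[X in _ /\ X = _]Hp//.
    by rewrite subrK; exact: IH.
  have /andP[f1 f2] := floor_itv t.
  have [<- <-] := red (- Num.floor t) t.
  apply: h => //; rewrite intrN; move: f1 f2; rewrite intrD.
  by move=> f1 f2; apply/andP; split; lra.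
have key u u' : 0 <= u <= 1 -> 0 <= u' <= 1 -> loop_lift (H u) n -> loop_lift (H u') n.
  move=> hu hu' [th hth e].
  have [th' h' e'] := lift_homotopy (fun u t hu _ => c1 u t hu) c2 hu hu' hth.
  exists th' => // t; have := e' t (t + 1) I I.
  rewrite e => h; have := h (fun v hv => esym (Hp v t hv)).
  by lra.
by split; exact: key.
Qed.

(** The local degree of [tau] at z, as a relation: existence is established separately, for maps
    continuous and injective near z. *)
Definition winding tau z (n : int) :=
  \forall r \near (0 : R)^'+, loop_lift (fun t => tau (z + r *: circle t) - tau z) n.

Lemma circle_norm t : `|circle t| <= 1.
Proof. by rewrite prod_normE /= ge_max cos_max sin_max. Qed.

Lemma scale_circle_norm r t : `|r *: circle t| <= `|r|.
Proof. by rewrite normrZ ler_piMr//; exact: circle_norm. Qed.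

Lemma near_disc z (Q : R * R -> Prop) : (\forall y \near z, Q y) ->
  exists2 e : R, 0 < e & forall r t, `|r| < e -> Q (z + r *: circle t).
Proof.
move=> /nbhs_normP[e e0 he]; exists e => // r t hr; apply: he.
rewrite /= opprD addNKr normrN.
exact: le_lt_trans (scale_circle_norm r t) hr.
Qed.

Lemma near_right (Q : R -> Prop) :
  (\forall r \near (0 : R)^'+, Q r) <->
  exists2 e : R, 0 < e & forall r, 0 < r < e -> Q r.
Proof.
split.
  move=> /nbhs_normP[e e0 he]; exists e => // r /andP[r0 re].
  by apply: he => //=; rewrite sub0r normrN gtr0_norm.
move=> [e e0 he]; near=> r; apply: he.
apply/andP; split; near: r; [exact: nbhs_right_gt|exact: nbhs_right_lt].
Unshelve. all: by end_near. Qed.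

(* On a disc where tau is continuous and injective, all the loops
   tau (x + r circle) - tau x are homotopic through nonvanishing loops. *)
Lemma winding_locally_const tau z :
  (exists2 e, 0 < e & forall y, `|y - z| < e -> {for y, continuous tau} /\
     forall y', `|y' - z| < e -> tau y = tau y' -> y = y') ->
  exists n, \forall y \near z, winding tau y n.
Proof.
move=> [e e0 he].
(* Centre and radius both move linearly; sharing e equally between them keeps every circle in the
   disc where [tau] is injective. *)
pose H (y1 : R * R) (r1 : R) (y2 : R * R) (r2 u t : R) :=
  tau (y1 + u *: (y2 - y1) + (r1 + u * (r2 - r1)) *: circle t)
  - tau (y1 + u *: (y2 - y1)).
pose L (y : R * R) r t := tau (y + r *: circle t) - tau y.
have e4 : 0 < e / 4 by rewrite divr_gt0.
have circ_neq y r t : 0 < r -> y + r *: circle t <> y.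
  move=> r0 h; apply: (@scale_circle_neq0 R r t r0).
  by rewrite -[LHS](addKr y) h addNr.
have in_disc y r t : `|y - z| < e / 2 -> 0 < r < e / 2 ->
    `|y + r *: circle t - z| < e.
  move=> hy /andP[r0 hr]; rewrite addrAC.
  rewrite (le_lt_trans (ler_normD _ _))// [e]splitr ltrD//.
  by rewrite (le_lt_trans (scale_circle_norm r t))// gtr0_norm.
have in_e y : `|y - z| < e / 2 -> `|y - z| < e.
  by move=> h; rewrite (lt_trans h)// ltr_pdivrMr// mulr_natr mulr2n ltrDl.
have L_neq0 y r t : `|y - z| < e / 2 -> 0 < r < e / 2 -> L y r t <> 0.
  move=> hy hr /eqP; rewrite subr_eq0 => /eqP h.
  have [_ inj] := he _ (in_disc y r t hy hr).
  have /andP[r0 _] := hr.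
  exact: (circ_neq _ _ _ r0 (inj _ (in_e _ hy) h)).
have shift_cont y r t : `|y - z| < e / 2 -> 0 < r < e / 2 ->
    {for t, continuous (L y r)}.
  move=> hy hr; apply: cvgB; last exact: cvg_cst.
  apply: (@continuous_comp _ _ _ (fun t => y + r *: circle t) tau); last first.
    by case: (he _ (in_disc y r t hy hr)).
  apply: cvgD; first exact: cvg_cst.
  by apply: cvgZr; exact: circle_continuous.
have [n hn] : exists n, loop_lift (L z (e / 4)) n.
  have hz : `|z - z| < e / 2 by rewrite subrr normr0 divr_gt0.
  have hr : 0 < e / 4 < e / 2 by rewrite e4 /=; lra.
  apply: loop_lift_exists.
  - by move=> t; exact: shift_cont.
  - by move=> t; exact: L_neq0.
  - by move=> t; rewrite /L circle_periodic.
exists n; apply/nbhs_normP; exists (e / 2); first by rewrite /= divr_gt0.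
move=> y; rewrite /= distrC => hy; apply/near_right.
exists (e / 2); first by rewrite divr_gt0.
move=> r hr.
have eH0 : H z (e / 4) y r 0 = L z (e / 4).
  by apply/funext => t; rewrite /H scale0r mul0r !addr0.
have eH1 : H z (e / 4) y r 1 = L y r.
  by apply/funext => t; rewrite /H scale1r mul1r (addrC z) subrK (addrC (e / 4)) subrK.
rewrite -[X in loop_lift X](_ : H z (e / 4) y r 1 = _)//.
apply/loop_lift_homotopy; last by rewrite eH0.
  move=> u t /andP[u0 u1].
  have hy' : `|z + u *: (y - z) - z| < e / 2.
    rewrite addrAC subrr add0r normrZ ger0_norm//.
    by rewrite (le_lt_trans _ hy)// ler_piMl.
  have hr' : 0 < e / 4 + u * (r - e / 4) < e / 2.
    have /andP[r0 re] := hr.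
    have [h|h] := leP 0 (r - e / 4).
      have := ler_piMl h u1; have := mulr_ge0 u0 h; by lra.
    have h' : 0 <= - (r - e / 4) by lra.
    have := ler_piMl h' u1; have := mulr_ge0 u0 h'; by rewrite mulrN; lra.
  split; last exact: L_neq0.
  have cy : {for (u, t), continuous (fun v : R * R => z + v.1 *: (y - z))}.
    by apply: cvgD; [exact: cvg_cst|apply: cvgZl; exact: cvg_fst].
  apply: cvgB.
    apply: (@continuous_comp _ _ _ (fun v : R * R => z + v.1 *: (y - z) +
      (e / 4 + v.1 * (r - e / 4)) *: circle v.2) tau); last first.
      by case: (he _ (in_disc _ _ t hy' hr')).
    apply: cvgD; first exact: cy.
    apply: cvgZ.
      apply: cvgD; first exact: cvg_cst.
      by apply: cvgM; [exact: cvg_fst|exact: cvg_cst].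
    apply: (@continuous_comp _ _ _ (@snd R R) circle); first exact: cvg_snd.
    exact: circle_continuous.
  apply: (@continuous_comp _ _ _ (fun v : R * R => z + v.1 *: (y - z)) tau).
    exact: cy.
  by case: (he _ (in_e _ hy')).
by move=> u t _; rewrite /H circle_periodic.
Qed.

End Index.

Section WindTheory.
Variable R : realType.
Local Notation circle := (@circle R).
Implicit Types (p q : R -> R * R) (t u r s a b : R) (z w : R * R).
Implicit Types (tau sigma : R * R -> R * R).

Lemma loop_lift_within p n : loop_lift p n -> exists th : R -> R,
  [/\ {within I01 R, continuous th}, th 1 = th 0 + n%:~R &
   forall t, exists2 s, 0 < s & p t = s *: circle (th t)].
Proof.
move=> [th h e]; exists th; split.
- by apply: continuous_subspaceT => t; case: (h t I).
- by rewrite -(e 0) add0r.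
- by move=> t; case: (h t I).
Qed.

Lemma loop_lift_inj p n m : loop_lift p n -> loop_lift p m -> n = m.
Proof.
move=> hn /loop_lift_within[th [c e h]].
have := loop_lift_unique hn c (fun t _ => h t).
by rewrite e => /addrI /intr_inj.
Qed.

Lemma winding_inj tau z n m : winding tau z n -> winding tau z m -> n = m.
Proof.
move=> /near_right[e e0 he] /near_right[d d0 hd].
have [r r0] : exists r, 0 < r < Num.min e d.
  have m0 : 0 < Num.min e d by rewrite lt_min e0.
  by exists (Num.min e d / 2); apply/andP; split; lra.
move: r0; rewrite lt_min => /and3P[r0 re rd].
by apply: loop_lift_inj (he r _) (hd r _); rewrite r0.
Qed.

Lemma winding_ext tau tau' z n : (\forall y \near z, tau y = tau' y) ->
  winding tau z n -> winding tau' z n.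
Proof.
move=> h /near_right[e e0 he].
have [d d0 hd] := near_disc h.
apply/near_right; exists (Num.min e d); first by rewrite lt_min e0.
move=> r /andP[r0]; rewrite lt_min => /andP[re rd].
rewrite (_ : (fun _ => _) = fun t => tau (z + r *: circle t) - tau z).
  by apply: he; rewrite r0.
by apply/funext => t; rewrite hd ?gtr0_norm// (nbhs_singleton h).
Qed.

Lemma winding_id z : winding id z 1.
Proof.
near=> r; exists id => // t _; split; first exact: cvg_id.
by exists r => //; rewrite addrAC subrr add0r.
Unshelve. all: by end_near. Qed.

Definition reflection z : R * R := (1 - z.1, z.2).

Lemma reflection_continuous : continuous reflection.
Proof.
move=> z; have c1 : {for z, continuous (fun z : R * R => 1 - z.1)}.
  by apply: cvgB; [exact: cvg_cst|exact: cvg_fst].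
have c2 : {for z, continuous (fun z : R * R => z.2)} by exact: cvg_snd.
exact: (continuous_pair c1 c2).
Qed.

Lemma winding_reflection z : winding reflection z (-1).
Proof.
(* Changing the sign of the first coordinate sends the direction t, in turns, to 1/2 - t. *)
near=> r; exists (fun t => 2^-1 - t) => [t _|t]; last by rewrite intrN; ring.
split; first by apply: cvgB; [exact: cvg_cst|exact: cvg_id].
exists r => //.
have e : 2 * pi * (2^-1 - t) = pi - 2 * pi * t :> R by field.
rewrite /Defs.circle e cosB sinB cospi sinpi !mul0r addr0 mulN1r sub0r mulN1r opprK.
case: z => z1 z2; rewrite !scale_pairE /reflection /=.
transitivity (1 - (z1 + r * cos (2 * pi * t)) - (1 - z1),
  z2 + r * sin (2 * pi * t) - z2); first by [].
by congr pair; ring.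
Unshelve. all: by end_near. Qed.

Lemma quasiperiodic_int (th : R -> R) (n m : int) t :
  (forall t, th (t + 1) = th t + n%:~R) -> th (t + m%:~R) = th t + (m * n)%:~R.
Proof.
move=> e.
elim: m => [|m IH|m IH]; first by rewrite mul0r !addr0.
  rewrite -addn1 PoszD intrD addrA e IH mulrDl mul1r intrD; ring.
have := e (t + (- m.+1%:Z)%:~R).
rewrite -addrA -(intrD _ _ 1) (_ : - m.+1%:Z + 1 = - m%:Z); last by lia.
rewrite IH => h; apply: (@addIr _ (n%:~R)); rewrite -h -addrA -intrD.
by congr (_ + _%:~R); rewrite -addn1 PoszD; ring.
Qed.

(** The Euclidean norm, adapted to [circle]; the norm of a pair is the maximum norm. *)
Definition radius z : R := Num.sqrt (dot z z).

Lemma radius_circle r t : 0 < r -> radius (r *: circle t) = r.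
Proof.
move=> r0; rewrite /radius (_ : dot _ _ = r ^+ 2).
  by rewrite sqrtr_sqr gtr0_norm.
by rewrite -[RHS]mulr1 -(dot_circle t) /dot /= /GRing.scale /=; ring.
Qed.

Lemma radius_continuous (T : topologicalType) (f : T -> R * R) (x : T) :
  {for x, continuous f} -> {for x, continuous (fun y => radius (f y))}.
Proof.
move=> h; apply: (@continuous_comp _ _ _ (fun y => dot (f y) (f y)) Num.sqrt).
  exact: dot_continuous.
exact: sqrt_continuous.
Qed.

(** In polar coordinates around [tau z], the image of a small circle has radius S and argument th.
    Interpolating linearly from S to the constant [S 0] and from th to n t stays in a punctured disc
    where [sigma] avoids its value at the centre. The final loop is the image under [sigma] of a
    circle run n times, and so winds n m times. *)
Lemma winding_comp tau sigma z n m :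
  (\forall y \near z, {for y, continuous tau}) ->
  (\forall y \near tau z, {for y, continuous sigma}) ->
  winding tau z n -> winding sigma (tau z) m -> winding (sigma \o tau) z (n * m).
Proof.
move=> ct cs /near_right[e1 e10 h1] /near_right[e2 e20 h2].
have [e3 e30 h3] := near_disc ct; have [e4 e40 h4] := near_disc cs.
pose e := Num.min e2 e4.
have e0 : 0 < e by rewrite lt_min e20.
have ctz : {for z, continuous (fun y => radius (tau y - tau z))}.
  apply: radius_continuous; apply: cvgB; last exact: cvg_cst.
  exact: (nbhs_singleton ct).
have hrad : \forall y \near z, radius (tau y - tau z) < e.
  apply: (cvgr_lt _ ctz).
  by rewrite subrr /radius /dot /= !mul0r addr0 sqrtr0.
have [e5 e50 h5] := near_disc hrad.
apply/near_right; exists (Num.min e1 (Num.min e3 e5)).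
  by rewrite !lt_min e10 e30.
move=> r /andP[r0]; rewrite !lt_min => /and3P[r1 r3 r5].
have [th hth eth] := h1 r (introT andP (conj r0 r1)).
pose S t := radius (tau (z + r *: circle t) - tau z).
have S_spec t : 0 < S t < e /\ tau (z + r *: circle t) = tau z + S t *: circle (th t).
  have [_ [s s0 hs]] := hth t I.
  have eS : S t = s by rewrite /S hs radius_circle.
  rewrite eS s0 -{1}eS h5 ?gtr0_norm//; split=> //.
  by rewrite -hs addrCA subrr addr0.
have S_per t : S (t + 1) = S t by rewrite /S circle_periodic.
have cC t : {for t, continuous (fun t => tau (z + r *: circle t))}.
  apply: (@continuous_comp _ _ _ (fun t => z + r *: circle t) tau).
    apply: cvgD; first exact: cvg_cst.
    by apply: cvgZr; exact: circle_continuous.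
  by apply: h3; rewrite gtr0_norm.
have S_cont t : {for t, continuous S}.
  by apply: radius_continuous; apply: cvgB; [exact: cC|exact: cvg_cst].
pose SS u t := (1 - u) * S t + u * S 0.
pose TT u t := (1 - u) * th t + u * (n%:~R * t).
pose H u t := sigma (tau z + SS u t *: circle (TT u t)) - sigma (tau z).
have SS_in u t : 0 <= u <= 1 -> 0 < SS u t < e.
  move=> /andP[u0 u1].
  have [/andP[a0 a1] _] := S_spec t; have [/andP[b0 b1] _] := S_spec 0.
  have u1' : 0 <= 1 - u by lra.
  have [h|h] := leP (S t) (S 0).
    have d0 : 0 <= S 0 - S t by lra.
    have := mulr_ge0 u0 d0; have := mulr_ge0 u1' d0.
    by rewrite /SS => x y; apply/andP; split; lra.
  have d0 : 0 <= S t - S 0 by lra.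
  have := mulr_ge0 u0 d0; have := mulr_ge0 u1' d0.
  by rewrite /SS => x y; apply/andP; split; lra.
have HH : loop_lift (H 0) (n * m) <-> loop_lift (H 1) (n * m).
  apply: loop_lift_homotopy => [u t hu|u t _].
    have /andP[s0] := SS_in u t hu; rewrite lt_min => /andP[s2 s4]; split.
      apply: cvgB; last exact: cvg_cst.
      apply: (@continuous_comp _ _ _ (fun v : R * R =>
        tau z + SS v.1 v.2 *: circle (TT v.1 v.2)) sigma); last first.
        by apply: h4; rewrite gtr0_norm.
      have c2 (f : R -> R) : {for t, continuous f} ->
          {for (u, t), continuous (fun v : R * R => f v.2)}.
        move=> hf; apply: (@continuous_comp _ _ _ (@snd R R) f) => //.
        exact: cvg_snd.
      have c1 : {for (u, t), continuous (fun v : R * R => 1 - v.1)}.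
        by apply: cvgB; [exact: cvg_cst|exact: cvg_fst].
      apply: cvgD; first exact: cvg_cst.
      apply: cvgZ.
        apply: cvgD; first by apply: cvgM => //; exact: c2.
        by apply: cvgM; [exact: cvg_fst|exact: cvg_cst].
      apply: (@continuous_comp _ _ _ (fun v : R * R => TT v.1 v.2) circle).
        apply: cvgD; first by apply: cvgM => //; apply: c2; case: (hth t I).
        apply: cvgM; first exact: cvg_fst.
        by apply: c2; apply: cvgM; [exact: cvg_cst|exact: cvg_id].
      exact: circle_continuous.
    have [th2 hth2 _] := h2 _ (introT andP (conj s0 s2)).
    have [_ [s s'0 hs]] := hth2 (TT u t) I.
    rewrite /H hs; exact: scale_circle_neq0.
  rewrite /H; congr (sigma (_ + _) - _).
  rewrite /SS S_per; congr (_ *: _).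
  have -> : TT u (t + 1) = TT u t + n%:~R by rewrite /TT eth; ring.
  by rewrite circle_int.
rewrite (_ : (fun _ => _) = H 0).
  apply/HH.
  have [/andP[s0]] := S_spec 0; rewrite lt_min => /andP[s2 s4] _.
  have [th2 hth2 eth2] := h2 _ (introT andP (conj s0 s2)).
  exists (fun t => th2 (n%:~R * t)).
    move=> t _; split.
      apply: (@continuous_comp _ _ _ (fun t => n%:~R * t) th2).
        by apply: cvgM; [exact: cvg_cst|exact: cvg_id].
      by case: (hth2 (n%:~R * t) I).
    have [_] := hth2 (n%:~R * t) I.
    by rewrite /H /SS /TT subrr !mul0r !add0r !mul1r.
  move=> t; rewrite mulrDr mulr1.
  exact: quasiperiodic_int.
apply/funext => t; rewrite /H /SS /TT subr0 !mul0r !addr0 !mul1r.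
by have [_ <-] := S_spec t.
Qed.

(** An argument on one period shows that the loop avoids 0 there, hence everywhere. The loop then
    has a winding number, which the increment 1 of the given argument identifies. *)
Lemma preserves_orientationP tau z :
  (\forall y \near z, {for y, continuous tau}) ->
  preserves_orientation_at tau z <-> winding tau z 1.
Proof.
move=> ct; split; last first.
  move=> /near_right[e e0 he]; apply/near_right; exists e => // r hr.
  have [th [c e1 h]] := loop_lift_within (he r hr).
  exists th; split => // t _; have [s s0 hs] := h t.
  by exists s => //; rewrite -hs addrCA subrr addr0.
move=> /near_right[e e0 he].
have [d d0 hd] := near_disc ct.
apply/near_right; exists (Num.min e d); first by rewrite lt_min e0.
move=> r /andP[r0]; rewrite lt_min => /andP[re rd].
have [th [c e1 h]] := he r (introT andP (conj r0 re)).
have h' t : I01 R t -> exists2 s, 0 < s &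
    tau (z + r *: circle t) - tau z = s *: circle (th t).
  by move=> /h[s s0 hs]; exists s => //; rewrite hs addrAC subrr add0r.
have per t : tau (z + r *: circle (t + 1)) - tau z = tau (z + r *: circle t) - tau z.
  by rewrite circle_periodic.
have [n hn] : exists n, loop_lift (fun t => tau (z + r *: circle t) - tau z) n.
  apply: loop_lift_exists => //.
    move=> t; apply: cvgB; last exact: cvg_cst.
    apply: (@continuous_comp _ _ _ (fun t => z + r *: circle t) tau).
      apply: cvgD; first exact: cvg_cst.
      by apply: cvgZr; exact: circle_continuous.
    by apply: hd; rewrite gtr0_norm.
  move=> t; have /andP[f1 f2] := floor_itv t.
  have [|s s0] := h' (t + (- Num.floor t)%:~R).
    by apply/I01P; rewrite intrN; move: f1 f2; rewrite intrD => f1 f2; apply/andP; split; lra.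
  rewrite circle_int => ->; exact: scale_circle_neq0.
have := loop_lift_unique hn c h'.
rewrite e1 -[X in _ + X = _]/(1%:~R) => /addrI /intr_inj e2.
by rewrite e2.
Qed.

End WindTheory.

(** * Orientation and homeomorphisms of surfaces *)

Definition homeo_id (S : topologicalType) : homeo S S :=
  @Homeo S S id id (fun x => cvg_id) (fun x => cvg_id)
    (fun x => erefl) (fun x => erefl).

Definition homeo_sym (S T : topologicalType) (h : homeo S T) : homeo T S :=
  Homeo (@hinv_continuous _ _ h) (@hmap_continuous _ _ h)
    (@hinvK _ _ h) (@hmapK _ _ h).

Section Charts.
Variable R : realType.

Lemma chart_invK (T : topologicalType) (c : plane_chart R T) y :
  (c @` dom c) y -> dom c (chart_inv c y) /\ c (chart_inv c y) = y.
Proof. by move=> [x dx <-]; rewrite chartK. Qed.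

Lemma near_dom (T : topologicalType) (c : plane_chart R T) x : dom c x ->
  \forall y \near x, dom c y.
Proof. by move=> dx; apply: open_nbhs_nbhs; split=> //; exact: dom_open. Qed.

Lemma near_chart_image (T : topologicalType) (c : plane_chart R T) x :
  dom c x -> \forall y \near c x, (c @` dom c) y.
Proof.
move=> dx; apply: open_nbhs_nbhs; split; first exact: chart_image_open.
by exists x.
Qed.

Section ChartMap.
Variables (S T : topologicalType) (h : homeo S T).
Variables (c : plane_chart R S) (c' : plane_chart R T) (x : S).
Hypotheses (dx : dom c x) (dhx : dom c' (h x)).

Lemma near_chart_map :
  \forall y \near c x, (c @` dom c) y /\ dom c' (h (chart_inv c y)).
Proof.
have h1 : \forall y \near c x, dom c' (h (chart_inv c y)).
  have cc : {for c x, continuous (fun y => h (chart_inv c y))}.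
    apply: continuous_comp; last exact: hmap_continuous.
    by apply: chart_inv_continuous; exists x.
  apply: cc; apply: near_dom.
  by rewrite chartK.
by near=> y; split; near: y; [exact: near_chart_image|exact: h1].
Unshelve. all: by end_near. Qed.

Lemma chart_map_continuous y : (c @` dom c) y /\ dom c' (h (chart_inv c y)) ->
  {for y, continuous (c' \o h \o chart_inv c)}.
Proof.
move=> [cy dy]; apply: continuous_comp; first exact: chart_inv_continuous.
by apply: continuous_comp; [exact: hmap_continuous|exact: chart_continuous].
Qed.

Lemma chart_map_winding_exists :
  exists n, \forall y \near c x, winding (c' \o h \o chart_inv c) y n.
Proof.
apply: winding_locally_const.
have /nbhs_normP[e e0 he] := near_chart_map.
exists e => // y hy.
have hy' := he y; rewrite /= distrC in hy'; have {}hy' := hy' hy.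
split; first exact: chart_map_continuous.
move=> y2 hy2; have hy2' := he y2; rewrite /= distrC in hy2'.
have {}hy2' := hy2' hy2.
rewrite /= => /(congr1 (chart_inv c')); rewrite !chartK; [|by case: hy2'|by case: hy'].
move=> /(congr1 (hinv h)); rewrite !hmapK => /(congr1 c).
by rewrite (chart_invK hy'.1).2 (chart_invK hy2'.1).2.
Qed.

End ChartMap.

(* The degrees of a homeomorphism and of its inverse multiply to 1. *)
Lemma chart_map_winding (S T : topologicalType) (h : homeo S T)
    (c : plane_chart R S) (c' : plane_chart R T) x :
  dom c x -> dom c' (h x) -> exists2 n, n = 1 \/ n = -1 &
    \forall y \near c x, winding (c' \o h \o chart_inv c) y n.
Proof.
move=> dx dhx.
have [n hn] := chart_map_winding_exists dx dhx.
exists n => //.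
have dx' : dom c (homeo_sym h (h x)) by rewrite /= hmapK.
have [m hm] := chart_map_winding_exists dhx dx'.
have e1 : (c' \o h \o chart_inv c) (c x) = c' (h x) by rewrite /= chartK.
have hnm : winding ((c \o homeo_sym h \o chart_inv c') \o
    (c' \o h \o chart_inv c)) (c x) (n * m).
  apply: winding_comp; rewrite ?e1.
  - by apply: filterS (near_chart_map dx dhx) => y; exact: chart_map_continuous.
  - by apply: filterS (near_chart_map dhx dx') => y; exact: chart_map_continuous.
  - exact: nbhs_singleton hn.
  - exact: nbhs_singleton hm.
have h1 : winding id (c x) (n * m).
  apply: winding_ext hnm.
  apply: filterS (near_chart_map dx dhx) => y [iy dy] /=.
  by rewrite chartK// hmapK (chart_invK iy).2.
have /esym /eqP := winding_inj h1 (winding_id _).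
clear; case: n => [[|[|n]]|[|n]]; case: m => [[|m]|m] //= ; try lia.
all: move=> /eqP h; first [by left|by right|exfalso; lia].
Qed.

(** f read from [c1] and f read from [c2] both have degree 1 and differ by the transition map, whose
    degree is therefore 1. *)
Lemma transition_winding (S : surface R) (f : homeo S S)
    (c1 c2 : plane_chart R S) x :
  orientation_preserving f -> atlas c1 -> atlas c2 -> dom c1 x -> dom c2 x ->
  winding (c2 \o chart_inv c1) (c1 x) 1.
Proof.
move=> of1 a1 a2 d1 d2.
have [c' a' d'] := atlas_cover (f x).
have wf (c : plane_chart R S) (ac : atlas c) (dc : dom c x) :
    winding (c' \o f \o chart_inv c) (c x) 1.
  apply/preserves_orientationP; last exact: of1.
  by apply: filterS (near_chart_map dc d') => y; exact: chart_map_continuous.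
have [n _ /nbhs_singleton hn] := @chart_map_winding _ _ (homeo_id S) c1 c2 x d1 d2.
have e1 : (c2 \o homeo_id S \o chart_inv c1) (c1 x) = c2 x by rewrite /= chartK.
have hc : winding ((c' \o f \o chart_inv c2) \o (c2 \o homeo_id S \o chart_inv c1))
    (c1 x) (n * 1).
  apply: winding_comp; rewrite ?e1 //; last exact: wf.
  - apply: filterS (@near_chart_map _ _ (homeo_id S) _ _ _ d1 d2) => y.
    exact: chart_map_continuous.
  - by apply: filterS (near_chart_map d2 d') => y; exact: chart_map_continuous.
have h1 : winding (c' \o f \o chart_inv c1) (c1 x) (n * 1).
  apply: winding_ext hc.
  apply: filterS (@near_chart_map _ _ (homeo_id S) _ _ _ d1 d2) => y [iy dy] /=.
  by rewrite chartK.
have := winding_inj h1 (wf _ a1 d1); rewrite mulr1 => n1.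
by rewrite n1 in hn.
Qed.

Lemma open_open_square : open (@open_square R).
Proof.
have oi : open (`]0, 1[%classic : set R) by exact: interval_open.
have c1 : continuous (@fst R R) by move=> z; exact: cvg_fst.
have c2 : continuous (@snd R R) by move=> z; exact: cvg_snd.
move/continuousP: c1 => /(_ _ oi) o1; move/continuousP: c2 => /(_ _ oi) o2.
exact: openI o1 o2.
Qed.

Lemma open_squareP (z : R * R) :
  open_square z <-> 0 < z.1 < 1 /\ 0 < z.2 < 1.
Proof. by rewrite /open_square /= !in_itv. Qed.

Lemma orientation_transport (S T : surface R) (f : homeo S S) (g : homeo T T)
    (h : homeo S T) (rho : R * R -> S) :
  orientation_preserving f -> orientation_preserving g ->
  {within @open_square R, continuous rho} ->
  orientation_preserving_on (@open_square R) rho ->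
  orientation_preserving_on (@open_square R) (h \o rho) \/
  orientation_preserving_on (@open_square R) (h \o rho \o @reflection R).
Proof.
move=> of1 og crho orho.
have c_rho (y : R * R) : open_square y -> {for y, continuous rho}.
  move=> hy.
  have : {in @open_square R, continuous rho}.
    by rewrite -continuous_open_subspace; [|exact: open_open_square].
  by apply; rewrite inE.
have near_sq (y : R * R) : open_square y -> \forall y' \near y, open_square y'.
  by move=> hy; apply: open_nbhs_nbhs; split=> //; exact: open_open_square.
(* Quantifying over all charts around the image makes the degree comparable between points covered
   by different charts. *)
pose Q (y : R * R) (n : int) := forall c' : plane_chart R T, atlas c' -> dom c' (h (rho y)) ->
  winding (c' \o (h \o rho)) y n.
have cch (y : R * R) (c' : plane_chart R T) : open_square y -> dom c' (h (rho y)) ->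
    \forall y' \near y, {for y', continuous (c' \o (h \o rho))}.
  move=> hy dy.
  have chr (y' : R * R) : open_square y' -> {for y', continuous (h \o rho)}.
    by move=> hy'; apply: continuous_comp; [exact: c_rho|exact: hmap_continuous].
  have h1 : \forall y' \near y, dom c' (h (rho y')).
    by apply: (chr y hy); exact: near_dom.
  near=> y'; apply: continuous_comp.
    by apply: chr; near: y'; exact: near_sq.
  by apply: chart_continuous; near: y'; exact: h1.
have QA (y : R * R) : open_square y -> exists2 n, n = 1 \/ n = -1 &
    \forall y' \near y, open_square y' /\ Q y' n.
  move=> hy.
  have [c ac dc] := atlas_cover (rho y).
  have [c' ac' dc'] := atlas_cover (h (rho y)).
  have [n hn wn] := chart_map_winding dc dc'; exists n => //.
  have h1 : \forall y' \near y, winding (c' \o h \o chart_inv c) (c (rho y')) n.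
    have cc : {for y, continuous (c \o rho)}.
      by apply: continuous_comp; [exact: c_rho|exact: chart_continuous].
    exact: (cc _ wn).
  have h2 : \forall y' \near y, dom c (rho y').
    by apply: (c_rho y hy); exact: near_dom.
  have h3 : \forall y' \near y, dom c' (h (rho y')).
    have cc : {for y, continuous (h \o rho)}.
      by apply: continuous_comp; [exact: c_rho|exact: hmap_continuous].
    by apply: cc; exact: near_dom.
  have key (y' : R * R) : open_square y' -> dom c (rho y') -> dom c' (h (rho y')) ->
      winding (c' \o h \o chart_inv c) (c (rho y')) n -> Q y' n.
    move=> sy dy dy' wy.
    have cnear : \forall y2 \near y', {for y2, continuous (c \o rho)}.
      have hd : \forall y2 \near y', dom c (rho y2).
        by apply: (c_rho y' sy); exact: near_dom.
      near=> y2; apply: continuous_comp.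
        by apply: c_rho; near: y2; exact: near_sq.
      by apply: chart_continuous; near: y2; exact: hd.
    have w1 : winding (c \o rho) y' 1.
      by apply/preserves_orientationP => //; exact: orho.
    have w2 : winding ((c' \o h \o chart_inv c) \o (c \o rho)) y' (1 * n).
      apply: winding_comp => //.
      by apply: filterS (near_chart_map dy dy') => z; exact: chart_map_continuous.
    have w3 : winding (c' \o (h \o rho)) y' n.
      rewrite -[n]mul1r; apply: winding_ext w2.
      have hd : \forall y2 \near y', dom c (rho y2).
        by apply: (c_rho y' sy); exact: near_dom.
      by apply: filterS hd => y2 dy2 /=; rewrite chartK.
    move=> c2 ac2 d2.
    have w4 : winding ((c2 \o chart_inv c') \o (c' \o (h \o rho))) y' (n * 1).
      apply: winding_comp => //; first exact: cch.
        apply: filterS (@near_chart_map _ _ (homeo_id T) _ _ _ dy' d2) => z.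
        exact: (@chart_map_continuous _ _ (homeo_id T)).
      exact: (transition_winding og).
    rewrite -[n]mulr1; apply: winding_ext w4.
    have chr : {for y', continuous (h \o rho)}.
      by apply: continuous_comp; [exact: c_rho|exact: hmap_continuous].
    have hd : \forall y2 \near y', dom c' (h (rho y2)).
      by apply: chr; exact: near_dom.
    by apply: filterS hd => y2 dy2 /=; rewrite chartK.
  near=> y'; split; first by near: y'; exact: near_sq.
  apply: key; near: y' => //; exact: near_sq.
pose y0 : R * R := (2^-1, 2^-1).
have sy0 : open_square y0.
  by apply/open_squareP; rewrite /=; split; apply/andP; split; lra.
have [n0 hn0 hQ0] := QA y0 sy0.
have Qall (y : R * R) : open_square y -> Q y n0.
  move=> sy.
  (* The square is star-shaped about its centre: the locally constant degree is followed along the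
     segment from the centre to y. *)
  pose ys s : R * R := (2^-1 + s * (y.1 - 2^-1), 2^-1 + s * (y.2 - 2^-1)).
  have ys_cont : continuous ys.
    have cl (a : R) : continuous (fun s : R => 2^-1 + s * a).
      move=> s; apply: cvgD; first exact: cvg_cst.
      by apply: cvgM; [exact: cvg_id|exact: cvg_cst].
    move=> s; exact: (continuous_pair (cl _ s) (cl _ s)).
  have mid (a s : R) : 0 < a < 1 -> 0 <= s <= 1 ->
      0 < 2^-1 + s * (a - 2^-1) < 1.
    move=> /andP[a0 a1] /andP[s0 s1].
    have s1' : 0 <= 1 - s by lra.
    have := mulr_ge0 s0 (ltW a0).
    have a1' : 0 <= 1 - a by lra.
    have := mulr_ge0 s0 a1'.
    have [->|s01] := eqVneq s 0; first by move=> _ _; apply/andP; split; lra.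
    have {}s0 : 0 < s by rewrite lt_neqAle eq_sym s01.
    have a1'' : 0 < 1 - a by lra.
    have := mulr_gt0 s0 a0; have := mulr_gt0 s0 a1''.
    by move=> *; apply/andP; split; lra.
  have sys (s : R) : 0 <= s <= 1 -> open_square (ys s).
    move=> hs; have /open_squareP[y1 y2] := sy.
    by apply/open_squareP; split; apply: mid.
  have e1 : ys 1 = y by rewrite /ys !mul1r !(addrC 2^-1) !subrK; case: (y).
  have e0 : ys 0 = y0 by rewrite /ys !mul0r !addr0.
  have inv : forall s : R, 0 <= s <= 1 -> \forall s' \near s, 0 <= s' <= 1 ->
      (Q (ys s') n0 <-> Q (ys s) n0).
    move=> s hs; have [n _ hQ] := QA _ (sys s hs).
    have Quniq (z : R * R) (m m' : int) : Q z m -> Q z m' -> m = m'.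
      move=> q q'; have [c' ac' dc'] := atlas_cover (h (rho z)).
      exact: winding_inj (q c' ac' dc') (q' c' ac' dc').
    have hQ' : \forall s' \near s, open_square (ys s') /\ Q (ys s') n.
      exact: (ys_cont s _ hQ).
    have [_ Qs] := nbhs_singleton hQ.
    apply: filterS hQ' => s' [_ Qs'] _.
    by split=> q; [rewrite -(Quniq _ _ _ Qs' q)|rewrite -(Quniq _ _ _ Qs q)].
  rewrite -e1; apply: (segment_invariant inv) (_ : Q (ys 0) n0).
  - by rewrite lexx ler01.
  - by rewrite lexx ler01.
  - by rewrite e0; case: (nbhs_singleton hQ0).
case: hn0 => n0E; rewrite n0E in Qall.
  left => c' y sy ac' dy.
  apply/preserves_orientationP; first exact: cch.
  exact: Qall.
right => c' y sy ac' dy.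
have sy' : open_square (reflection y).
  move: sy => /open_squareP[/andP[h1 h2] h3]; apply/open_squareP.
  by split => //=; apply/andP; split; lra.
have cc := cch _ _ sy' dy.
have -> : c' \o (h \o rho \o @reflection R) = (c' \o (h \o rho)) \o @reflection R by [].
apply/preserves_orientationP.
  have cc' : \forall z \near y, {for reflection z, continuous (c' \o (h \o rho))}.
    exact: (@reflection_continuous R y _ cc).
  apply: filterS cc' => z hz; apply: continuous_comp => //; exact: reflection_continuous.
rewrite (_ : 1 = -1 * -1)//; apply: winding_comp => //.
- by apply: filterS (near_sq _ sy) => z _; exact: reflection_continuous.
- exact: winding_reflection.
- exact: Qall.
Unshelve. all: by end_near. Qed.

End Charts.

(** * Prongs and measured foliations *)

Section Prongs.
Variable R : realType.
Implicit Types (z : R * R) (x : R[i]).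

Definition toC z : R[i] := Complex z.1 z.2.
Definition sqn x : R := complex.Re x ^+ 2 + complex.Im x ^+ 2.

Lemma sqnM x y : sqn (x * y) = sqn x * sqn y.
Proof. by case: x y => [a b] [c d]; rewrite /sqn /=; ring. Qed.

Lemma sqn1 : sqn 1 = 1.
Proof. by rewrite /sqn /= expr1n expr0n addr0. Qed.

Lemma sqnX x k : sqn (x ^+ k) = sqn x ^+ k.
Proof. by elim: k => [|k IH]; rewrite ?expr0 ?sqn1// !exprS sqnM IH. Qed.

Lemma sqn_ge0 x : 0 <= sqn x.
Proof. by rewrite addr_ge0 ?sqr_ge0. Qed.

(* With w + i v = z^(k/2), these are |z|^k, v^2 and w^2; unlike w and v
   they are single-valued. *)
Definition pow_norm k z : R := Num.sqrt (sqn (toC z) ^+ k).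
Definition im_sq k z : R := (pow_norm k z - complex.Re (toC z ^+ k)) / 2.
Definition re_sq k z : R := (pow_norm k z + complex.Re (toC z ^+ k)) / 2.

Lemma im_sqDre_sq k z : im_sq k z + re_sq k z = pow_norm k z.
Proof. by rewrite /im_sq /re_sq; field. Qed.

Lemma Re_pow_le k z : `|complex.Re (toC z ^+ k)| <= pow_norm k z.
Proof.
rewrite -sqrtr_sqr /pow_norm ler_sqrt; first by rewrite -sqnX lerDl sqr_ge0.
by rewrite exprn_ge0// sqn_ge0.
Qed.

Lemma re_sq_ge0 k z : 0 <= re_sq k z.
Proof.
by rewrite /re_sq divr_ge0//; have := Re_pow_le k z; rewrite ler_norml; lra.
Qed.

Lemma im_sq_ge0 k z : 0 <= im_sq k z.
Proof.
by rewrite /im_sq divr_ge0//; have := Re_pow_le k z; rewrite ler_norml; lra.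
Qed.

Lemma im_sq_le k z : im_sq k z <= pow_norm k z.
Proof. by rewrite -im_sqDre_sq lerDl re_sq_ge0. Qed.

(** The modulus of the square is a^2 + b^2 and its real part a^2 - b^2. *)
Lemma square_root_parts k z (a b : R) : (Complex a b) ^+ 2 = toC z ^+ k ->
  im_sq k z = b ^+ 2 /\ re_sq k z = a ^+ 2.
Proof.
move=> h.
have hn : pow_norm k z = a ^+ 2 + b ^+ 2.
  by rewrite /pow_norm -sqnX -h sqnX sqrtr_sqr ger0_norm// sqn_ge0.
have hr : complex.Re (toC z ^+ k) = a ^+ 2 - b ^+ 2.
  by rewrite -h expr2 /=; ring.
by rewrite /im_sq /re_sq hn hr; split; field.
Qed.

Lemma pow_norm0 k : (0 < k)%N -> pow_norm k 0 = 0.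
Proof.
by move=> k0; rewrite /pow_norm /sqn /= expr0n addr0 expr0n gtn_eqF// sqrtr0.
Qed.

Lemma im_sq0 k : (0 < k)%N -> im_sq k 0 = 0.
Proof.
move=> k0; rewrite /im_sq pow_norm0//.
have -> : toC 0 = 0 by [].
by rewrite expr0n gtn_eqF//= subr0 mul0r.
Qed.

Lemma pow_norm_lt k z (e : R) : (0 < k)%N -> 0 < e -> pow_norm k z < e ^+ k ->
  `|z| < e.
Proof.
move=> k0 e0 h.
have h2 : sqn (toC z) < e ^+ 2.
  rewrite -(@ltr_pXn2r _ k)// ?nnegrE ?sqn_ge0 ?exprn_ge0 ?ltW//.
  rewrite -exprM mulnC exprM -ltr_sqrt; last by rewrite exprn_gt0// exprn_gt0.
  by rewrite sqrtr_sqr gtr0_norm// exprn_gt0.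
rewrite prod_normE /= gt_max.
have sq (a : R) : a ^+ 2 < e ^+ 2 -> `|a| < e.
  by move=> ha; rewrite -(@ltr_pXn2r _ 2)// ?nnegrE ?ltW// real_normK ?num_real.
apply/andP; split; apply: sq; apply: le_lt_trans h2; rewrite /sqn /=.
  by rewrite lerDl sqr_ge0.
by rewrite lerDr sqr_ge0.
Qed.

Lemma pow_continuous k : continuous (fun z => complex.Re (toC z ^+ k)) /\
  continuous (fun z => complex.Im (toC z ^+ k)).
Proof.
elim: k => [|k [IH1 IH2]].
  by split => z; exact: cvg_cst.
have e z : toC z ^+ k.+1 = Complex
    (z.1 * complex.Re (toC z ^+ k) - z.2 * complex.Im (toC z ^+ k))
    (z.1 * complex.Im (toC z ^+ k) + z.2 * complex.Re (toC z ^+ k)).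
  by rewrite exprS; case: (toC z ^+ k).
split.
  under eq_fun do rewrite e /=.
  move=> z; apply: cvgB; (apply: cvgM; first by (exact: cvg_fst || exact: cvg_snd)).
    exact: IH1.
  exact: IH2.
under eq_fun do rewrite e /=.
move=> z; apply: cvgD; (apply: cvgM; first by (exact: cvg_fst || exact: cvg_snd)).
  exact: IH2.
exact: IH1.
Qed.

Lemma pow_norm_continuous k : continuous (pow_norm k).
Proof.
move=> z.
have e z' : sqn (toC z') ^+ k = sqn (toC z' ^+ k) by rewrite sqnX.
rewrite /pow_norm; under eq_fun do rewrite e.
apply: (@continuous_comp _ _ _ (fun z => sqn (toC z ^+ k)) Num.sqrt); last first.
  exact: sqrt_continuous.
have [h1 h2] := pow_continuous k.
by apply: cvgD; apply: cvgM; (exact: h1 || exact: h2).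
Qed.

Lemma im_sq_continuous k : continuous (im_sq k).
Proof.
move=> z; apply: cvgM; last exact: cvg_cst.
apply: cvgB; first exact: pow_norm_continuous.
exact: (pow_continuous k).1.
Qed.

End Prongs.

(** * Charts followed by homeomorphisms of the plane *)

Section ChartComp.
Variables (R : realType) (T : topologicalType).
Variables (c : plane_chart R T) (s : homeo (R * R)%type (R * R)%type).

Lemma chart_comp_image : (s \o c) @` dom c = hinv s @^-1` (c @` dom c).
Proof.
apply/seteqP; split=> [_ [x dx <-]|y [x dx e]]; rewrite /=.
  by rewrite hmapK; exists x.
by exists x => //; rewrite /= e hinvK.
Qed.

Lemma chart_comp_image_open : open ((s \o c) @` dom c).
Proof.
rewrite chart_comp_image.
have /continuousP := @hinv_continuous _ _ s; apply; exact: chart_image_open.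
Qed.

Lemma chart_comp_continuous x : dom c x -> {for x, continuous (s \o c)}.
Proof.
by move=> dx; apply: continuous_comp; [exact: chart_continuous|exact: hmap_continuous].
Qed.

Lemma chart_comp_inv_continuous y :
  ((s \o c) @` dom c) y -> {for y, continuous (chart_inv c \o hinv s)}.
Proof.
rewrite chart_comp_image => hy; apply: continuous_comp.
  exact: hinv_continuous.
exact: chart_inv_continuous.
Qed.

Lemma chart_compK x : dom c x -> (chart_inv c \o hinv s) ((s \o c) x) = x.
Proof. by move=> dx; rewrite /= hmapK chartK. Qed.

Definition chart_comp : plane_chart R T :=
  PlaneChart (@dom_open _ _ c) chart_comp_image_open chart_comp_continuous
    chart_comp_inv_continuous chart_compK.

End ChartComp.

Section PlaneHomeos.
Variable R : realType.

Lemma translation_continuous (a : R * R) : continuous (fun z : R * R => z + a).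
Proof. by move=> z; apply: cvgD; [exact: cvg_id|exact: cvg_cst]. Qed.

Definition translation (a : R * R) : homeo (R * R)%type (R * R)%type :=
  Homeo (@translation_continuous a) (@translation_continuous (- a))
    (addrK a) (subrK a).

Definition twist_map (x : R[i]) (z : R * R) : R * R :=
  (complex.Re x * z.1 + complex.Im x * z.2,
   complex.Im x * z.1 - complex.Re x * z.2).

Lemma toC_twist x z : toC (twist_map x z) = x * conjc (toC z).
Proof. by case: x => a b; rewrite /toC /twist_map /=; congr Complex; ring. Qed.

Lemma twist_continuous x : continuous (twist_map x).
Proof.
move=> z.
have c1 (a b : R) : {for z, continuous (fun z : R * R => a * z.1 + b * z.2)}.
  apply: cvgD; apply: cvgM; try exact: cvg_cst; [exact: cvg_fst|exact: cvg_snd].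
have c2 (a b : R) : {for z, continuous (fun z : R * R => a * z.1 - b * z.2)}.
  apply: cvgB; apply: cvgM; try exact: cvg_cst; [exact: cvg_fst|exact: cvg_snd].
exact: (continuous_pair (c1 _ _) (c2 _ _)).
Qed.

Lemma twistK x : sqn x = 1 -> cancel (twist_map x) (twist_map x).
Proof.
case: x => a b; rewrite /sqn /= => h [z1 z2]; rewrite /twist_map /=.
congr pair.
  by transitivity ((a ^+ 2 + b ^+ 2) * z1); [ring|rewrite h mul1r].
by transitivity ((a ^+ 2 + b ^+ 2) * z2); [ring|rewrite h mul1r].
Qed.

(* z |-> x * conj z, an involution when |x| = 1. *)
Definition twist x (hx : sqn x = 1) : homeo (R * R)%type (R * R)%type :=
  Homeo (@twist_continuous x) (@twist_continuous x) (twistK hx) (twistK hx).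

(** With such an x, the map z |-> x conj z sends z^k to minus its conjugate, which exchanges the two
    foliations of a k-prong. *)
Lemma root_of_minus1 k : (0 < k)%N ->
  exists2 x : R[i], sqn x = 1 & x ^+ k = -1.
Proof.
move=> k0.
have [x] : exists x : R[i], root ('X^k + 1%:P) x.
  by apply/closed_rootP; rewrite size_XnaddC// eqSS -lt0n.
rewrite /root !hornerE addr_eq0 => /eqP hx; exists x => //.
have : sqn x ^+ k = 1.
  rewrite -sqnX hx -[RHS](sqn1 R) /sqn /=; ring.
by move=> h; apply: (pexpIrn k0); rewrite ?nnegrE ?sqn_ge0//= h expr1n.
Qed.

End PlaneHomeos.

(** * Local models of a transverse pair of foliations *)

Section LocalModel.
Variables (R : realType) (T : topologicalType).
Implicit Types (F G : measured_foliation R T).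

Lemma regular_coord F x : ~ sing F x -> exists U v, tcoord F (U, v) /\ U x.
Proof. by move/tcoord_cover. Qed.

Lemma coord_regular F x U v : tcoord F (U, v) -> U x -> ~ sing F x.
Proof. by move=> h Ux; apply/tcoord_cover; exists U, v. Qed.

(** If (a + i b)^2 = z^k, then (b + i a)^2 is minus the conjugate of z^k. Exchanging the foliations
    thus amounts to following the chart by a twist: with x = i at regular points, where it swaps the
    coordinates, and with a k-th root of -1 at a k-prong. *)
Lemma transverse_sym F G : transverse F G -> transverse G F.
Proof.
move=> [eS hr hs]; split; first by rewrite eS.
  move=> V w U v x hw hv Vx Ux; have [phi [dx sub e]] := hr _ _ _ _ x hv hw Ux Vx.
  have hi : sqn (Complex 0 1 : R[i]) = 1 by rewrite /sqn /= expr0n expr1n add0r.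
  exists (chart_comp phi (twist hi)); split => //.
    by move=> y /sub [].
  move=> y dy; rewrite /= /twist_map e//=; congr pair; ring.
rewrite -eS => p sp; have [k [phi [[k0 k2 iso p0] hb]]] := hs p sp.
have [x x1 xk] := root_of_minus1 R k0.
exists k, (chart_comp phi (twist x1)); split.
  split => //=; rewrite p0 /twist_map /= !mulr0 addr0 subr0//.
move=> q dq qp V w U v hw hv Vq Uq.
have [b [c [d hn]]] := hb q dq qp _ _ _ _ hv hw Uq Vq.
exists b, d, c; apply: filterS hn => y.
rewrite -!/(toC _) /= toC_twist exprMn xk mulN1r -rmorphXn => <-.
have s2 : ((-1) ^+ b) ^+ 2 = 1 :> R by rewrite sqrr_sign.
move: s2; set s := (-1) ^+ b => s2.
rewrite !expr2 /=; congr Complex.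
  transitivity ((v y - d) ^+ 2 - s ^+ 2 * (w y - c) ^+ 2);
    [ring|rewrite s2].
  transitivity (- ((w y - c) ^+ 2 - s ^+ 2 * (v y - d) ^+ 2));
    [rewrite s2; ring|ring].
by ring.
Qed.

(** The case k = 2 is that of regular points: w + i v is then z itself up to signs and constants.
    Allowing it gives one normal form for all points, singular or not. *)
Definition local_model F G (p : T) (k : nat) (phi : plane_chart R T) :=
  [/\ (0 < k)%N, dom phi p, phi p = 0,
      (forall q, dom phi q -> q <> p -> ~ sing F q) &
      forall q, dom phi q -> forall U v V w, tcoord F (U, v) ->
        tcoord G (V, w) -> U q -> V q -> is_prong_branch k phi q w v].

Lemma local_modelP F G p : transverse F G ->
  exists k phi, local_model F G p k phi /\ (sing F p <-> k != 2%N).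
Proof.
move=> [eS hr hs].
have [sp|nsp] := pselect (sing F p).
  have [k [phi [[k0 k2 iso p0] hb]]] := hs p sp.
  have [dp _] : (dom phi `&` sing F) p by rewrite iso.
  exists k, phi; split; last by split.
  split => // [q dq qp sq|q dq U v V w hv hw Uq Vq].
    have : (dom phi `&` sing F) q by [].
    by rewrite iso.
  apply: (hb q dq _ U v V w hv hw Uq Vq) => qp.
  by move: Uq; rewrite qp => /(coord_regular hv).
have [U [v [hv Up]]] := regular_coord nsp.
have [V [w [hw Vp]]] : exists V w, tcoord G (V, w) /\ V p.
  by apply: regular_coord; rewrite -eS.
have [phi [dp sub e]] := hr _ _ _ _ p hv hw Up Vp.
exists 2%N, (chart_comp phi (translation (- phi p))); split; last first.
  by split => // /nsp.
split => //=; first by rewrite subrr.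
  by move=> q /sub[Uq _] _; exact: coord_regular hv Uq.
move=> q dq U' v' V' w' hv' hw' Uq' Vq'.
have [Uq Vq] := sub q dq.
have [b1 [c1 h1]] := tcoord_compat hv' hv Uq' Uq.
have [b2 [c2 h2]] := tcoord_compat hw' hw Vq' Vq.
pose s1 : R := (-1) ^+ b1; pose s2 : R := (-1) ^+ b2.
have s11 : s1 ^+ 2 = 1 by rewrite sqrr_sign.
have s22 : s2 ^+ 2 = 1 by rewrite sqrr_sign.
(* Since w = s2 w' + c2, the first constant c satisfies w' - c = s2 (w - w p); the second does the
   same for v' and v. The sign [b1 (+) b2] makes s2 a common factor, which disappears in the
   square. *)
exists (b1 (+) b2), (s2 * (w p - c2)), (s1 * (v p - c1)).
near=> y.
have dy : dom phi y by near: y; exact: near_dom.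
have -> : chart_comp phi (translation (- phi p)) y = (w y - w p, v y - v p).
  by rewrite /= e// e//.
have -> : w y = s2 * w' y + c2 by near: y; exact: h2.
have -> : v y = s1 * v' y + c1 by near: y; exact: h1.
have -> : (-1) ^+ (b1 (+) b2) = s1 * s2 :> R by rewrite signr_addb.
rewrite !expr2 /=; congr Complex.
  transitivity (s2 ^+ 2 * (w' y - s2 * (w p - c2)) ^+ 2 - s1 ^+ 2 * (v' y - s1 * (v p - c1)) ^+ 2).
    transitivity ((w' y - s2 * (w p - c2)) ^+ 2 - s1 ^+ 2 * s2 ^+ 2 * (v' y - s1 * (v p - c1)) ^+ 2);
    first by ring.
    by rewrite s11 s22; ring.
  transitivity ((s2 * w' y - s2 ^+ 2 * (w p - c2)) ^+ 2 - (s1 * v' y - s1 ^+ 2 * (v p - c1)) ^+ 2);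
    first by ring.
  by rewrite s11 s22; ring.
transitivity (2 * (s2 * w' y - s2 ^+ 2 * (w p - c2)) * (s1 * v' y - s1 ^+ 2 * (v p - c1))); first by ring.
by rewrite s11 s22; ring.
Unshelve. all: by end_near. Qed.

Lemma local_model_squares F G p k phi q U v V w : local_model F G p k phi ->
  dom phi q -> tcoord F (U, v) -> tcoord G (V, w) -> U q -> V q ->
  exists c d, \forall y \near q,
    im_sq k (phi y) = (v y + d) ^+ 2 /\ re_sq k (phi y) = (w y + c) ^+ 2.
Proof.
move=> [_ _ _ _ hb] dq hv hw Uq Vq.
have [b [c [d hn]]] := hb q dq U v V w hv hw Uq Vq.
exists (- c), (- d); apply: filterS hn => y /square_root_parts[-> ->].
by rewrite exprMn sqrr_sign mul1r.
Qed.

End LocalModel.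

(** * Contraction and expansion along leaves *)

(* The constant c is determined near each point because A is not locally
   constant there; hence it does not vary along the path. *)
Lemma square_along_path (R : realType) (T : topologicalType) (xi : R -> T)
    (a b : R) (A B : T -> R) :
  a <= b ->
  (forall s, a <= s <= b -> {for s, continuous xi}) ->
  (forall s, a <= s <= b -> exists c, \forall y \near xi s, B y = (A y + c) ^+ 2) ->
  (forall s (P : T -> Prop), a <= s <= b -> (\forall y \near xi s, P y) ->
     exists2 y, P y & A y <> A (xi s)) ->
  exists c, forall s, a <= s <= b -> B (xi s) = (A (xi s) + c) ^+ 2.
Proof.
move=> ab cxi hB hA.
have ha : a <= a <= b by rewrite lexx.
have [c0 h0] := hB a ha.
have uniq s c c' : a <= s <= b -> (\forall y \near xi s, B y = (A y + c) ^+ 2) ->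
    (\forall y \near xi s, B y = (A y + c') ^+ 2) -> c = c'.
  move=> hs h h'.
  have [y [e e'] ne] := hA s _ hs (filterI h h').
  have f := nbhs_singleton h; have f' := nbhs_singleton h'.
  rewrite e in e'; rewrite f in f'.
  apply/eqP; rewrite -subr_eq0; apply/negPn/negP => cc.
  have z x : (A x + c) ^+ 2 = (A x + c') ^+ 2 -> A x = - (c + c') / 2.
    move=> hx; have : (c - c') * (A x *+ 2 + c + c') = 0.
      transitivity ((A x + c) ^+ 2 - (A x + c') ^+ 2); first by ring.
      by rewrite hx subrr.
    move=> /eqP; rewrite mulf_eq0 (negPf cc) /= => /eqP; lra.
  by apply: ne; rewrite (z _ e') (z _ f').
exists c0 => s hs.
pose P s := \forall y \near xi s, B y = (A y + c0) ^+ 2.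
suff inv : forall s, a <= s <= b ->
    \forall s' \near s, a <= s' <= b -> (P s' <-> P s).
  exact: nbhs_singleton (segment_invariant inv ha hs h0).
move=> r hr; have [c hc] := hB r hr.
have hc' : \forall r' \near r, \forall y \near xi r', B y = (A y + c) ^+ 2.
  have hh : \forall z \near xi r, \forall y \near z, B y = (A y + c) ^+ 2.
    exact: nbhs_interior hc.
  exact: (cxi r hr _ hh).
apply: filterS hc' => r' hr' ab'; split=> h.
  by rewrite /P -(uniq _ _ _ ab' hr' h).
by rewrite /P -(uniq _ _ _ hr hc h).
Qed.

Section Scaling.
Variables (R : realType) (T : topologicalType).
Implicit Types (F G : measured_foliation R T) (f g : homeo T T).

Lemma scales_sing f F l : scales f F l -> forall x, sing F (f x) <-> sing F x.
Proof.
move=> [e _] x; split=> h; last by rewrite -e; exists x.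
have [y sy /(congr1 (hinv f))] : (f @` sing F) (f x) by rewrite e.
by rewrite !hmapK => <-.
Qed.

Lemma iter_continuous (f : T -> T) n : continuous f -> continuous (iter n f).
Proof.
move=> cf; elim: n => [|n IH] x; first exact: cvg_id.
apply: (@continuous_comp _ _ _ (iter n f) f); [exact: IH|exact: cf].
Qed.

Lemma iterK (S : Type) (f f' : S -> S) n : cancel f f' -> cancel (iter n f) (iter n f').
Proof.
move=> fK; elim: n => // n IH x.
have -> : iter n.+1 f' (iter n.+1 f x) = iter n f' (f' (f (iter n f x))).
  by rewrite -iterSr.
by rewrite fK IH.
Qed.

Definition homeo_iter f n : homeo T T :=
  Homeo (@iter_continuous f n (@hmap_continuous _ _ f))
    (@iter_continuous (hinv f) n (@hinv_continuous _ _ f))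
    (iterK n (@hmapK _ _ f)) (iterK n (@hinvK _ _ f)).

Lemma scales_iter f F l n : scales f F l -> scales (homeo_iter f n) F (l ^+ n).
Proof.
move=> hf; have hs := scales_sing hf; elim: n => [|n [IH1 IH2]].
  split; first by rewrite /= image_id.
  move=> U v U' v' x hv hv' Ux Ux'.
  have [b [c h]] := tcoord_compat hv hv' Ux Ux'.
  exists b, c; apply: filterS h => y /= ->.
  by rewrite expr0 mul1r.
split.
  have -> : (homeo_iter f n.+1 : T -> T) = f \o homeo_iter f n by [].
  by rewrite -image_comp IH1 hf.1.
move=> U v U' v' x hv hv' Ux Ux'.
have nx : ~ sing F (homeo_iter f n x).
  by move=> /hs; exact: coord_regular hv' Ux'.
have [V [w [hw Vx]]] := regular_coord nx.
have [b1 [c1 h1]] := IH2 _ _ _ _ x hv hw Ux Vx.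
have [b2 [c2 h2]] := hf.2 _ _ _ _ (homeo_iter f n x) hw hv' Vx Ux'.
have h2' : \forall y \near x, v' (f (homeo_iter f n y)) =
    (-1) ^+ b2 * (l * w (homeo_iter f n y)) + c2.
  exact: (@hmap_continuous _ _ (homeo_iter f n) x _ h2).
exists (b2 (+) b1), ((-1) ^+ b2 * l * c1 + c2).
near=> y.
have -> : homeo_iter f n.+1 y = f (homeo_iter f n y) by [].
have -> : v' (f (homeo_iter f n y)) = (-1) ^+ b2 * (l * w (homeo_iter f n y)) + c2.
  by near: y; exact: h2'.
have -> : w (homeo_iter f n y) = (-1) ^+ b1 * (l ^+ n * v y) + c1.
  by near: y; exact: h1.
by rewrite signr_addb exprS; ring.
Unshelve. all: by end_near. Qed.

Lemma scales_sym f F l : l != 0 -> scales f F l -> scales (homeo_sym f) F l^-1.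
Proof.
move=> l0 [e h]; split.
  rewrite -[in LHS]e; apply/seteqP; split=> [_ [_ [x sx <-] <-]|x sx] /=.
    by rewrite hmapK.
  by exists (f x); [exists x|rewrite hmapK].
move=> U v U' v' x hv hv' Ux Ux'.
have Uf : U (f (hinv f x)) by rewrite hinvK.
have [b [c hn]] := h _ _ _ _ (hinv f x) hv' hv Ux' Uf.
have hn' : \forall y \near x, v (f (hinv f y)) = (-1) ^+ b * (l * v' (hinv f y)) + c.
  exact: (@hinv_continuous _ _ f x _ hn).
exists b, (- (-1) ^+ b * l^-1 * c).
apply: filterS hn' => y; rewrite hinvK => ->.
have s2 : ((-1) ^+ b) ^+ 2 = 1 :> R by rewrite sqrr_sign.
move: s2; set s := (-1) ^+ b => s2.
transitivity (s ^+ 2 * v' (hinv f y)); first by rewrite s2 mul1r.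
by rewrite /=; field.
Qed.

Lemma coord_not_const F U v x (P : T -> Prop) : tcoord F (U, v) -> U x ->
  (\forall y \near x, P y) -> exists2 y, P y & v y <> v x.
Proof.
move=> hv Ux hP; have [phi [dx sub e]] := tcoord_submersion hv Ux.
have hi : \forall z \near phi x, (phi @` dom phi) z /\ P (chart_inv phi z).
  have h1 := near_chart_image dx.
  have cc : {for phi x, continuous (chart_inv phi)}.
    by apply: chart_inv_continuous; exists x.
  have h2 : \forall z \near phi x, P (chart_inv phi z).
    by apply: cc; rewrite chartK.
  exact: filterI h1 h2.
have /nbhs_normP[d d0 hd] := hi.
pose z := phi x + (0, d / 2).
have [|iz Pz] := hd z.
  rewrite /= opprD addNKr normrN prod_normE /= normr0 gt_max d0 /=.
  rewrite gtr0_norm ?divr_gt0//; move: (d0) => /=; lra.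
exists (chart_inv phi z) => //.
have [dz ez] := chart_invK iz.
rewrite -!e// ez /z /= => /eqP; rewrite -subr_eq0 addrAC subrr add0r.
by rewrite mulf_eq0 invr_eq0 pnatr_eq0 orbF gt_eqF.
Qed.

(* A regular path in a leaf of F whose transverse G-measure has constant
   speed |l|. *)
Definition thin_path F G (l : R) (eta : R -> T) := forall s, 0 <= s <= 1 ->
  [/\ {for s, continuous eta}, ~ sing F (eta s),
    (forall U v, tcoord F (U, v) -> U (eta s) ->
       \forall s' \near s, v (eta s') = v (eta s)) &
    (forall V w, tcoord G (V, w) -> V (eta s) -> exists (b : bool) (c : R),
       \forall s' \near s, w (eta s') = (-1) ^+ b * (l * s') + c)].

Lemma thin_path_image F G f l m n eta : transverse F G ->
  scales f F l -> scales f G m -> thin_path F G n eta ->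
  thin_path F G (m * n) (f \o eta).
Proof.
move=> tFG hF hG h s hs; have [c ns hv hw] := h s hs.
have sG : sing F = sing G by case: tFG.
split.
- by apply: continuous_comp => //; exact: hmap_continuous.
- by move=> /(scales_sing hF).
- move=> U v cv Uf.
  have [U' [v' [cv' Uv']]] := regular_coord ns.
  have [b [d hn]] := hF.2 _ _ _ _ (eta s) cv' cv Uv' Uf.
  have hn' : \forall s' \near s, v (f (eta s')) = (-1) ^+ b * (l * v' (eta s')) + d.
    exact: (c _ hn).
  have e := nbhs_singleton hn.
  near=> s'.
  have -> : v ((f \o eta) s') = (-1) ^+ b * (l * v' (eta s')) + d.
    by near: s'; exact: hn'.
  rewrite /= e; congr (_ * (_ * _) + _).
  by near: s'; exact: (hv _ _ cv' Uv').
- move=> U v cv Uf.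
  have [U' [v' [cv' Uv']]] : exists U' v', tcoord G (U', v') /\ U' (eta s).
    by apply: regular_coord; rewrite -sG.
  have [b [d hn]] := hG.2 _ _ _ _ (eta s) cv' cv Uv' Uf.
  have hn' : \forall s' \near s, v (f (eta s')) = (-1) ^+ b * (m * v' (eta s')) + d.
    exact: (c _ hn).
  have [b' [d' hn2]] := hw _ _ cv' Uv'.
  exists (b (+) b'), ((-1) ^+ b * m * d' + d).
  near=> s'.
  have -> : v ((f \o eta) s') = (-1) ^+ b * (m * v' (eta s')) + d.
    by near: s'; exact: hn'.
  have -> : v' (eta s') = (-1) ^+ b' * (n * s') + d'.
    by near: s'; exact: hn2.
  by rewrite signr_addb; ring.
Unshelve. all: by end_near. Qed.

Lemma thin_path_iter F G f l m n eta k : transverse F G ->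
  scales f F l -> scales f G m -> thin_path F G n eta ->
  thin_path F G (m ^+ k * n) (iter k f \o eta).
Proof.
move=> tFG hF hG h; elim: k => [|k IH]; first by rewrite expr0 mul1r.
rewrite exprS -mulrA.
exact: (thin_path_image tFG hF hG IH).
Qed.

End Scaling.

(** * Thin paths inside a chart *)

Section Contraction.
Variables (R : realType) (T : topologicalType).
Implicit Types (F G : measured_foliation R T).

(** Estimates along a path are available only while it stays in the domain O of a chart. If they
    then place it in a closed K inside O, the times up to which it has stayed in O form a set both
    open and closed. *)
Lemma trapped_path (eta : R -> T) (O K : set T) :
  open O -> closed K -> K `<=` O ->
  (forall s, 0 <= s <= 1 -> {for s, continuous eta}) ->
  O (eta 0) ->
  (forall t, 0 <= t <= 1 -> (forall s, 0 <= s <= t -> O (eta s)) -> K (eta t)) ->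
  forall t, 0 <= t <= 1 -> O (eta t).
Proof.
move=> oO cK KO ceta O0 hK t ht.
pose P t := forall s, 0 <= s <= t -> O (eta s).
have P0 : P 0.
  by move=> s /andP[s0 s1]; have -> : s = 0 by apply/eqP; rewrite eq_le s0 s1.
have in0 : 0 <= (0 : R) <= 1 by rewrite lexx ler01.
suff inv : forall s : R, 0 <= s <= 1 ->
    \forall s' \near s, 0 <= s' <= 1 -> (P s' <-> P s).
  have Pt : P t := segment_invariant inv in0 ht P0.
  by apply: Pt; rewrite lexx andbT; case/andP: ht.
move=> s hs; have /andP[s0 s1] := hs.
have [Ps|nPs] := pselect (P s).
  have Os : \forall s' \near s, O (eta s').
    apply: (ceta s hs); apply: open_nbhs_nbhs; split => //.
    by apply: Ps; rewrite lexx s0.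
  have /nbhs_normP[e e0 he] := Os.
  apply/nbhs_normP; exists e => // s' hs' s'01; split=> // _ r /andP[r0 rs'].
  have [rs|sr] := leP r s; first by apply: Ps; rewrite r0.
  apply: he; rewrite /= distrC gtr0_norm ?subr_gt0//.
  move: hs'; rewrite /= distrC; apply: le_lt_trans.
  by rewrite (le_trans _ (ler_norm _))// lerB.
(* If all earlier times were good, the path would be in K before s, hence at s because K is closed.
   So a failure at s comes from a failure at some r < s, and the latter persists near s. *)
have [r [r0 rs nPr]] : exists r, [/\ 0 <= r, r < s & ~ P r].
  apply: contrapT => hn; apply: nPs.
  have hP r : 0 <= r -> r < s -> P r.
    by move=> r0 rs; apply: contrapT => nP; apply: hn; exists r.
  have [s00|s00] := eqVneq s 0; first by rewrite s00.
  have {}s00 : 0 < s by rewrite lt_neqAle eq_sym s00.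
  suff Ks : K (eta s).
    move=> r /andP[r0]; rewrite le_eqVlt => /orP[/eqP ->|rs]; first exact: KO.
    by apply: (hP r r0 rs); rewrite r0 lexx.
  apply: contrapT => nK.
  have : \forall s' \near s, (~` K) (eta s').
    apply: (ceta s hs); apply: open_nbhs_nbhs; split => //.
    exact: closed_openC.
  move=> /nbhs_normP[e e0 he].
  pose r := Num.max 0 (s - e / 2).
  have r0 : 0 <= r by rewrite /r le_max lexx.
  have e20 : 0 < e / 2 by rewrite divr_gt0.
  have rs : r < s by rewrite /r gt_max s00 /= ltrBlDr ltrDl.
  have re : s - r < e.
    have : s - e / 2 <= r by rewrite /r le_max lexx orbT.
    move: e20; lra.
  apply: (he r).
    by rewrite /= gtr0_norm// subr_gt0.
  apply: hK; first by rewrite r0 (le_trans (ltW rs)).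
  exact: hP.
near=> s'; move=> _; split=> h; exfalso; last by [].
apply: nPr => x /andP[x0 xr]; apply: h; rewrite x0 (le_trans xr)//.
by apply: ltW; near: s'; exact: lt_nbhsr.
Unshelve. all: by end_near. Qed.

(** The half box is closed in the whole space, not merely in [dom phi]: it is the image of a compact
    square in a Hausdorff space. *)
Lemma chart_box (phi : plane_chart R T) p N : hausdorff_space T ->
  dom phi p -> phi p = 0 -> nbhs p N ->
  exists e, [/\ 0 < e, open [set y | dom phi y /\ `|phi y| < e],
    closed [set y | dom phi y /\ `|phi y| <= e / 2] &
    [set y | dom phi y /\ `|phi y| < e] `<=` N].
Proof.
move=> hT dp p0 hN.
have hi : \forall z \near phi p, (phi @` dom phi) z /\ N (chart_inv phi z).
  have cc : {for phi p, continuous (chart_inv phi)}.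
    by apply: chart_inv_continuous; exists p.
  have h2 : \forall z \near phi p, N (chart_inv phi z).
    by apply: cc; rewrite chartK.
  exact: filterI (near_chart_image dp) h2.
have /nbhs_normP[e e0 he] := hi.
have {}he z : `|z| < e -> (phi @` dom phi) z /\ N (chart_inv phi z).
  by move=> hz; apply: he; rewrite /= p0 sub0r normrN.
exists e; split => //.
- rewrite openE => y [dy hy]; rewrite /interior.
  have cn : {for y, continuous (fun y => `|phi y|)}.
    by apply: cvg_norm; exact: chart_continuous.
  have h1 : \forall y' \near y, `|phi y'| < e by exact: cvgr_lt cn _ hy.
  exact: filterI (near_dom dy) h1.
- have -> : [set y | dom phi y /\ `|phi y| <= e / 2] = chart_inv phi @`
      (`[- (e / 2), e / 2]%classic `*` `[- (e / 2), e / 2]%classic).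
    apply/seteqP; split=> [y [dy hy]|_ [z hz <-]].
      exists (phi y); last by rewrite chartK.
      move: hy; rewrite prod_normE /= ge_max !in_itv /= -!ler_norml => /andP[? ?].
      by [].
    have hn : `|z| <= e / 2.
      move: hz; rewrite /= !in_itv /= -!ler_norml => -[h1 h2].
      by rewrite prod_normE /= ge_max h1.
    have [iz _] : (phi @` dom phi) z /\ N (chart_inv phi z).
      apply: he; apply: le_lt_trans hn _; move: (e0) => /=; lra.
    by have [d e1] := chart_invK iz; rewrite /= e1.
  apply: compact_closed => //; apply: continuous_compact; last first.
    by apply: compact_setX; exact: segment_compact.
  apply/subspace_continuousP => z hz.
  have hn : `|z| < e.
    move: hz; rewrite /= !in_itv /= -!ler_norml => -[h1 h2].
    by rewrite prod_normE /= gt_max; apply/andP; split; move: (e0) => /=; lra.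
  have [iz _] := he z hn.
  have cc := chart_inv_continuous iz.
  apply: cvg_trans cc; apply: cvg_app; exact: cvg_within.
- move=> y [dy hy]; have [_] := he _ hy; by rewrite chartK.
Qed.

(** Inside the chart, [im_sq] is constant along the path and [re_sq] is (l s + c)^2, at most 2 l^2 +
    2 c^2. Both [im_sq] and c^2 are bounded by [pow_norm] at the start, whence the coefficient 3 = 1
    + 2. *)
Lemma thin_path_norm F G p k phi l eta t : transverse F G ->
  local_model F G p k phi -> l != 0 -> thin_path F G l eta -> 0 <= t <= 1 ->
  (forall s, 0 <= s <= t -> dom phi (eta s)) ->
  pow_norm k (phi (eta t)) <= 3 * pow_norm k (phi (eta 0)) + 2 * l ^+ 2.
Proof.
move=> tFG lm l0 th /andP[t0 t1] hd.
have in01 s : 0 <= s <= t -> 0 <= s <= 1.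
  by move=> /andP[-> h] /=; exact: le_trans t1.
have sG : sing F = sing G by case: tFG.
have loc s : 0 <= s <= t -> (\forall s' \near s, im_sq k (phi (eta s')) =
      im_sq k (phi (eta s))) /\
    exists c, \forall s' \near s, re_sq k (phi (eta s')) = (l * s' + c) ^+ 2.
  move=> hs; have [ce ns hv hw] := th s (in01 s hs).
  have [U [v [cv Uv]]] := regular_coord ns.
  have [V [w [cw Vw]]] : exists V w, tcoord G (V, w) /\ V (eta s).
    by apply: regular_coord; rewrite -sG.
  have [c [d hn]] := local_model_squares lm (hd s hs) cv cw Uv Vw.
  have hn' : \forall s' \near s, im_sq k (phi (eta s')) = (v (eta s') + d) ^+ 2 /\
    re_sq k (phi (eta s')) = (w (eta s') + c) ^+ 2 by exact: (ce _ hn).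
  have [b [c' hw']] := hw _ _ cw Vw.
  have hv' := hv _ _ cv Uv.
  have [e1 _] := nbhs_singleton hn.
  split.
    near=> s'.
    have [-> _] : im_sq k (phi (eta s')) = (v (eta s') + d) ^+ 2 /\
      re_sq k (phi (eta s')) = (w (eta s') + c) ^+ 2 by near: s'; exact: hn'.
    by rewrite e1; congr ((_ + _) ^+ 2); near: s'; exact: hv'.
  exists ((-1) ^+ b * (c' + c)); near=> s'.
  have [_ ->] : im_sq k (phi (eta s')) = (v (eta s') + d) ^+ 2 /\
    re_sq k (phi (eta s')) = (w (eta s') + c) ^+ 2 by near: s'; exact: hn'.
  have -> : w (eta s') = (-1) ^+ b * (l * s') + c' by near: s'; exact: hw'.
  have s2 : ((-1) ^+ b) ^+ 2 = 1 :> R by rewrite sqrr_sign.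
  move: s2; set sg := (-1) ^+ b => s2.
  transitivity (sg ^+ 2 * (l * s') ^+ 2 + 2 * sg * (l * s') * (c' + c) + (c' + c) ^+ 2); first by ring.
  transitivity ((l * s') ^+ 2 + 2 * sg * (l * s') * (c' + c) + sg ^+ 2 * (c' + c) ^+ 2); last by ring.
  by rewrite s2; ring.
have h0 : 0 <= (0 : R) <= t by rewrite lexx.
have ht : 0 <= t <= t by rewrite lexx t0.
have im0 : im_sq k (phi (eta t)) = im_sq k (phi (eta 0)).
  apply: (@segment_invariant R 0 t (fun s => im_sq k (phi (eta s)) =
    im_sq k (phi (eta 0))) _ 0 t) => // s hs.
  by have [h _] := loc s hs; apply: filterS h => s' ->.
have nc (s : R) (P : R -> Prop) : 0 <= s <= t -> (\forall y \near s, P y) ->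
    exists2 y, P y & l * y <> l * s.
  move=> hs hP; have /nbhs_normP[e e0 he] := hP.
  exists (s + e / 2).
    apply: he; rewrite /= opprD addNKr normrN gtr0_norm ?divr_gt0//.
    move: (e0) => /=; lra.
  move=> /(mulfI l0) /eqP; rewrite -subr_eq0 addrAC subrr add0r.
  by rewrite gt_eqF// divr_gt0.
have [c hc] := @square_along_path R R id 0 t (fun s => l * s)
    (fun s => re_sq k (phi (eta s))) t0 (fun s _ => cvg_id)
    (fun s hs => (loc s hs).2) nc.
have r0 := hc 0 h0; have rt := hc t ht; rewrite /= mulr0 add0r in r0.
rewrite -[X in X <= _]im_sqDre_sq im0 rt.
have b1 := im_sq_le k (phi (eta 0)).
have b2 : c ^+ 2 <= pow_norm k (phi (eta 0)).
  by rewrite -r0 -im_sqDre_sq lerDr im_sq_ge0.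
have b3 : (l * t + c) ^+ 2 <= 2 * (l * t) ^+ 2 + 2 * c ^+ 2.
  rewrite -subr_ge0 (_ : _ - _ = (l * t - c) ^+ 2); [exact: sqr_ge0|by ring].
have b4 : (l * t) ^+ 2 <= l ^+ 2.
  by rewrite exprMn ler_piMr ?sqr_ge0// expr_le1.
lra.
Unshelve. all: by end_near. Qed.

End Contraction.

(** * Contraction against expansion under a conjugacy *)

Section Dynamics.
Variables (R : realType).

Lemma short_thin_path (T : topologicalType) (F G : measured_foliation R T)
    (p : T) (N : set T) :
  hausdorff_space T -> transverse F G -> nbhs p N ->
  \forall y \near p & d \near (0 : R)^'+, forall l eta, l != 0 -> `|l| < d ->
    thin_path F G l eta -> eta 0 = y -> forall t, 0 <= t <= 1 -> N (eta t).
Proof.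
move=> hT tFG hN.
have [k [phi [lm _]]] := local_modelP p tFG.
have [k0 dp p0 _ _] := lm.
have [e [e0 oO cK ON]] := chart_box hT dp p0 hN.
set O := [set y : T | dom phi y /\ `|phi y| < e] in oO ON.
set K := [set y : T | dom phi y /\ `|phi y| <= e / 2] in cK.
have e20 : 0 < e / 2 by rewrite divr_gt0.
pose m := (e / 2) ^+ k; have m0 : 0 < m by rewrite exprn_gt0.
have KO : K `<=` O.
  by move=> y [dy hy]; split => //; apply: le_lt_trans hy _; move: (e0) => /=; lra.
have cpn : {for p, continuous (fun y => pow_norm k (phi y))}.
  by apply: continuous_comp; [exact: chart_continuous|exact: pow_norm_continuous].
have h1 : \forall y \near p, pow_norm k (phi y) < m / 6.
  apply: cvgr_lt cpn _ _.
  by rewrite p0 pow_norm0// divr_gt0.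
have m6 : m / 6 < m by move: (m0) => /=; lra.
(* With these bounds [thin_path_norm] gives less than 3 m/6 + 2 m/8 = 3 m/4 < m, which places the
   path in the half box. The minimum with 1 gives l^2 <= |l| < m/8. *)
exists ([set y | dom phi y /\ pow_norm k (phi y) < m / 6],
        [set d : R | d < Num.min 1 (m / 8)]).
  split => /=; first exact: filterI (near_dom dp) h1.
  apply: nbhs_right_lt; rewrite lt_min ltr01 divr_gt0//.
move=> [y d] [/= [dy hy] hd] l eta l0 ld th ey t ht.
have tO : forall t, 0 <= t <= 1 -> O (eta t).
  apply: (trapped_path oO cK KO).
  - by move=> s hs; case: (th s hs).
  - rewrite ey; split => //; apply: lt_le_trans (_ : _ < e / 2) _; last first.
      by move: (e0) => /=; lra.
    by apply: (pow_norm_lt k0 e20); apply: lt_trans hy m6.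
  - move=> s hs hO; have /andP[s0 _] := hs.
    have [ds _] : O (eta s) by apply: hO; rewrite lexx s0.
    split => //; apply/ltW/(pow_norm_lt k0 e20).
    have := thin_path_norm tFG lm l0 th hs (fun r hr => (hO r hr).1).
    rewrite ey => hn; apply: le_lt_trans hn _.
    have hd' : d < Num.min 1 (m / 8) := hd.
    have := lt_trans ld hd'; rewrite lt_min => /andP[l1 l8].
    have : l ^+ 2 < m / 8.
      rewrite -real_normK ?num_real// expr2.
      by apply: le_lt_trans l8; rewrite ler_piMl// ltW.
    move: hy; rewrite -/m /=; lra.
exact/ON/tO.
Qed.

(** A Lebesgue number for thin paths: [short_thin_path] bounds the length near each point and
    compactness makes the bound uniform. *)
Lemma thin_path_in_cover (T : topologicalType) (F G : measured_foliation R T)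
    (C : set (set T)) : hausdorff_space T -> compact [set: T] ->
  transverse F G -> (forall p : T, exists2 A, C A & nbhs p A) ->
  \forall d \near (0 : R)^'+, forall l eta, l != 0 -> `|l| < d ->
    thin_path F G l eta -> exists2 A, C A & forall t, 0 <= t <= 1 -> A (eta t).
Proof.
move=> hT cT tFG hC.
have : \forall d \near (0 : R)^'+, [set: T] `<=` [set y | forall l eta,
    l != 0 -> `|l| < d -> thin_path F G l eta -> eta 0 = y ->
    exists2 A, C A & forall t, 0 <= t <= 1 -> A (eta t)].
  have /compact_near_coveringP hK := cT.
  apply: (hK R ((0 : R)^'+) (fun d y => forall l eta,
    l != 0 -> `|l| < d -> thin_path F G l eta -> eta 0 = y ->
    exists2 A, C A & forall t, 0 <= t <= 1 -> A (eta t))) => p _.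
  have [A CA hA] := hC p.
  apply: filterS (short_thin_path hT tFG hA) => -[y d] /= h l eta l0 ld th ey.
  by exists A => //; exact: h l eta l0 ld th ey.
by apply: filterS => d h l eta l0 ld th; exact: (h (eta 0) I l eta l0 ld th erefl).
Qed.

(** Along the image of [xi], the single-valued function [im_sq] equals (m v + c)^2 with a single
    constant c, so its bound confines m v + c to [-1, 1]. The chart is allowed to be centred at a
    singularity. *)
Lemma expanded_path (T : topologicalType) (F G : measured_foliation R T)
    (f : homeo T T) m p k phi U v (xi : R -> T) : transverse F G -> local_model F G p k phi ->
  0 < m -> scales f F m -> tcoord F (U, v) ->
  (forall s, 0 <= s <= 1 -> {for s, continuous xi} /\ U (xi s)) ->
  (forall s, 0 <= s <= 1 -> dom phi (f (xi s)) /\ im_sq k (phi (f (xi s))) <= 1) ->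
  m * `|v (xi 1) - v (xi 0)| <= 2.
Proof.
move=> tFG lm m0 hs hv hxi hphi.
have sG : sing F = sing G by case: tFG.
have [c hc] : exists c, forall s, 0 <= s <= 1 ->
    im_sq k (phi (f (xi s))) = (m * v (xi s) + c) ^+ 2.
  apply: (@square_along_path R T xi 0 1 (fun y => m * v y)
    (fun y => im_sq k (phi (f y)))) => //.
  - by move=> s /hxi[].
  - move=> s h; have [ds _] := hphi s h; have [cx Ux] := hxi s h.
    have ns : ~ sing F (f (xi s)).
      by move=> /(scales_sing hs); exact: coord_regular hv Ux.
    have [U' [v' [hv' Ux']]] := regular_coord ns.
    have [V' [w' [hw' Vx']]] : exists V w, tcoord G (V, w) /\ V (f (xi s)).
      by apply: regular_coord; rewrite -sG.
    have [c [d hn]] := local_model_squares lm ds hv' hw' Ux' Vx'.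
    have hn' : \forall y \near xi s, im_sq k (phi (f y)) = (v' (f y) + d) ^+ 2.
      have hn1 : \forall y \near xi s, im_sq k (phi (f y)) = (v' (f y) + d) ^+ 2 /\
        re_sq k (phi (f y)) = (w' (f y) + c) ^+ 2.
        exact: (@hmap_continuous _ _ f (xi s) _ hn).
      by apply: filterS hn1 => y [].
    have [b [c2 hb]] := hs.2 _ _ _ _ _ hv hv' Ux Ux'.
    exists ((-1) ^+ b * (c2 + d)).
    near=> y.
    have -> : im_sq k (phi (f y)) = (v' (f y) + d) ^+ 2 by near: y; exact: hn'.
    have -> : v' (f y) = (-1) ^+ b * (m * v y) + c2 by near: y; exact: hb.
    have s2 : ((-1) ^+ b) ^+ 2 = 1 :> R by rewrite sqrr_sign.
    move: s2; set sg := (-1) ^+ b => s2.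
    transitivity (sg ^+ 2 * (m * v y) ^+ 2 + 2 * sg * (m * v y) * (c2 + d) + (c2 + d) ^+ 2); first by ring.
    transitivity ((m * v y) ^+ 2 + 2 * sg * (m * v y) * (c2 + d) + sg ^+ 2 * (c2 + d) ^+ 2); last by ring.
    by rewrite s2; ring.
  - move=> s P h hP; have [_ Ux] := hxi s h.
    have [y Py ny] := coord_not_const hv Ux hP.
    by exists y => // /(mulfI (lt0r_neq0 m0)).
have b s : 0 <= s <= 1 -> -1 <= m * v (xi s) + c <= 1.
  move=> h; have [_] := hphi s h; rewrite hc// => h1.
  by rewrite -ler_norml -(@expr_le1 _ 2)// real_normK ?num_real.
have /andP[a1 a2] := b 0 (introT andP (conj (lexx 0) ler01)).
have /andP[b1 b2] := b 1 (introT andP (conj ler01 (lexx 1))).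
rewrite -[X in X * _](gtr0_norm m0) -normrM ler_norml mulrBr.
by apply/andP; split; lra.
Unshelve. all: by end_near. Qed.

Lemma geometric_to0 (q : R) (a : R) : 0 <= q < 1 ->
  (fun n => q ^+ n * a) @ \oo --> (0 : R).
Proof.
move=> /andP[q0 q1]; rewrite -[X in _ --> X](mul0r a); apply: cvgM.
  by apply: cvg_expr; rewrite ger0_norm.
exact: cvg_cst.
Qed.

(* f contracts the leaves of F, whose lengths are measured by G. *)
Record contracting (T : topologicalType) (f : homeo T T)
    (F G : measured_foliation R T) (l : R) : Prop := Contracting {
  contracting_hausdorff : hausdorff_space T;
  contracting_compact : compact [set: T];
  contracting_transverse : transverse F G;
  contracting_gt1 : 1 < l;
  contracting_F : scales f F l;
  contracting_G : scales f G l^-1 }.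

Section Conjugacy.
Variables (T1 T2 : topologicalType) (h : homeo T1 T2).
Variables (f1 : homeo T1 T1) (f2 : homeo T2 T2).
Variables (F1 G1 : measured_foliation R T1) (F2 G2 : measured_foliation R T2).
Variables (l1 l2 : R).
Hypotheses (H1 : contracting f1 F1 G1 l1) (H2 : contracting f2 F2 G2 l2).
Hypothesis commutes : forall x, h (f1 x) = f2 (h x).

(* f1^n shrinks a plaque to a point, hence f2^n shrinks its image; but f2^n
   expands every path that crosses F2. *)
Lemma plaque_to_plaque U v U' v' x : tcoord F1 (U, v) -> tcoord F2 (U', v') ->
  U x -> U' (h x) -> \forall y \near x, v y = v x -> v' (h y) = v' (h x).
Proof.
move=> hv hv' Ux Ux'.
have [hT1 cT1 t1 l1g F1s G1s] := H1; have [hT2 cT2 t2 l2g F2s G2s] := H2.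
have s1 : sing F1 = sing G1 by case: t1.
have [V [w [hw Vx]]] : exists V w, tcoord G1 (V, w) /\ V x.
  by apply: regular_coord; rewrite -s1; exact: coord_regular hv Ux.
have [phi [dx sub ephi]] : exists phi : plane_chart R T1,
   [/\ dom phi x, dom phi `<=` U `&` V & forall y, dom phi y -> phi y = (w y, v y)].
  by case: t1 => _ + _; apply.
have hbox : \forall z \near phi x,
    (phi @` dom phi) z /\ U' (h (chart_inv phi z)).
  have cc : {for phi x, continuous (fun z => h (chart_inv phi z))}.
    apply: continuous_comp; last exact: hmap_continuous.
    by apply: chart_inv_continuous; exists x.
  have h2 : \forall z \near phi x, U' (h (chart_inv phi z)).
    apply: cc; apply: open_nbhs_nbhs; split; first exact: tcoord_open hv'.
    by rewrite chartK.
  exact: filterI (near_chart_image dx) h2.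
have /nbhs_normP[e e0 he] := hbox.
have cw : {for x, continuous phi} by exact: chart_continuous.
have hy : \forall y \near x, `|phi y - phi x| < e / 2.
  by apply: cvgr_distC_lt cw _ _; rewrite divr_gt0.
near=> y => vyx.
have dy : dom phi y by near: y; exact: near_dom.
have hwy : `|w y - w x| < e / 2.
  have : `|phi y - phi x| < e / 2 by near: y; exact: hy.
  rewrite !ephi// prod_normE /= gt_max => /andP[]; by [].
have [ww|ww] := eqVneq (w y) (w x).
  by rewrite -(chartK dy) ephi// ww vyx -ephi// chartK.
(* [eta] is the segment from x to y inside the plaque, parametrized so that w varies with constant
   speed l. *)
pose l := w y - w x.
have l0 : l != 0 by rewrite subr_eq0.
pose z s : R * R := (w x + s * l, v x).
pose eta s := chart_inv phi (z s).
have z_cont : continuous z.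
  move=> s; have c1 : {for s, continuous (fun s : R => w x + s * l)}.
    by apply: cvgD; [exact: cvg_cst|apply: cvgM; [exact: cvg_id|exact: cvg_cst]].
  exact: (continuous_pair c1 (cvg_cst _)).
have z_in (s : R) : 0 <= s <= 1 -> (phi @` dom phi) (z s) /\ U' (h (eta s)).
  move=> /andP[s0 s1']; apply: he.
  rewrite /= ephi// prod_normE /= subrr normr0 gt_max e0 andbT.
  rewrite opprD addNKr normrN normrM (ger0_norm s0).
  apply: le_lt_trans (_ : _ <= `|l|) _; first by rewrite ler_piMl.
  by apply: lt_trans hwy _; rewrite ltr_pdivrMr// ltr_pMr// ltr1n.
have eta_cont (s : R) : 0 <= s <= 1 -> {for s, continuous eta}.
  move=> hs; apply: continuous_comp; first exact: z_cont.
  by apply: chart_inv_continuous; case: (z_in s hs).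
have eta_dom (s : R) : 0 <= s <= 1 -> dom phi (eta s) /\ phi (eta s) = z s.
  by move=> hs; apply: chart_invK; case: (z_in s hs).
have eta_near (s : R) : 0 <= s <= 1 ->
    \forall s' \near s, w (eta s') = w x + s' * l /\ v (eta s') = v x.
  move=> hs; have [iz _] := z_in s hs.
  have hi : \forall s' \near s, (phi @` dom phi) (z s').
    apply: z_cont; apply: open_nbhs_nbhs; split => //.
    exact: chart_image_open.
  apply: filterS hi => s' iz'.
  by have [d] := chart_invK iz'; rewrite ephi// /z => -[-> ->].
have thin : thin_path F1 G1 l eta.
  move=> s hs; have [de pe] := eta_dom s hs; have [Ue Ve] := sub _ de.
  have en := eta_near s hs; have [we ve] := nbhs_singleton en.
  split.
  - exact: eta_cont.
  - exact: coord_regular hv Ue.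
  - move=> U2 v2 hv2 Ue2.
    have [b [c hn]] := tcoord_compat hv hv2 Ue Ue2.
    have hn' : \forall s' \near s, v2 (eta s') = (-1) ^+ b * v (eta s') + c.
      exact: (eta_cont s hs _ hn).
    rewrite (nbhs_singleton hn') ve; near=> s'.
    have -> : v2 (eta s') = (-1) ^+ b * v (eta s') + c by near: s'; exact: hn'.
    congr (_ * _ + _).
    have [_ //] : w (eta s') = w x + s' * l /\ v (eta s') = v x.
    by near: s'; exact: en.
  - move=> V2 w2 hw2 Ve2.
    have [b [c hn]] := tcoord_compat hw hw2 Ve Ve2.
    have hn' : \forall s' \near s, w2 (eta s') = (-1) ^+ b * w (eta s') + c.
      exact: (eta_cont s hs _ hn).
    exists b, ((-1) ^+ b * w x + c); near=> s'.
    have -> : w2 (eta s') = (-1) ^+ b * w (eta s') + c by near: s'; exact: hn'.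
    have [-> _] : w (eta s') = w x + s' * l /\ v (eta s') = v x.
      by near: s'; exact: en.
    by ring.
have eta0 : eta 0 = x.
  by rewrite /eta /z mul0r addr0 -ephi// chartK.
have eta1 : eta 1 = y.
  by rewrite /eta /z mul1r /l addrC subrK -vyx -ephi// chartK.
(* Sets that h maps into one local model with [im_sq] at most 1. They form a cover by neighbourhoods
   since [im_sq] vanishes at the centre of a model. *)
pose C : set (set T1) := [set A | exists p k phi, local_model F2 G2 p k phi /\
  A = [set y | dom phi (h y) /\ im_sq k (phi (h y)) <= 1]].
have hC (p : T1) : exists2 A, C A & nbhs p A.
  have [k [psi [lm _]]] := local_modelP (h p) t2.
  exists [set y | dom psi (h y) /\ im_sq k (psi (h y)) <= 1].
    by exists (h p), k, psi.
  have [k0 dp p0 _ _] := lm.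
  have c1 : {for p, continuous (fun y => im_sq k (psi (h y)))}.
    apply: (@continuous_comp _ _ _ (fun y => psi (h y)) (im_sq k)).
      apply: (@continuous_comp _ _ _ h psi); first exact: hmap_continuous.
      exact: chart_continuous.
    exact: im_sq_continuous.
  have h1 : \forall y \near p, im_sq k (psi (h y)) < 1.
    by apply: cvgr_lt c1 _ _; rewrite p0 im_sq0.
  have h2 : \forall y \near p, dom psi (h y).
    by apply: (@hmap_continuous _ _ h p); exact: near_dom.
  by near=> q; split; [near: q; exact: h2|apply: ltW; near: q; exact: h1].
have l10 : 0 < l1 by rewrite (lt_trans ltr01).
have l20 : 0 < l2 by rewrite (lt_trans ltr01).
have commutes_iter n q : h (iter n f1 q) = iter n f2 (h q).
  by elim: n => // n IH; rewrite !iterS commutes IH.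
(* For large n the path [iter n f1 \o eta] has speed l1^-n l, below the threshold d, so it lies in
   one member of C. Its image under h is that of [h \o eta] under the n-th iterate of f2, which
   stretches v' by l2^n. *)
have bound : \forall n \near \oo,
    l2 ^+ n * `|v' (h (eta 1)) - v' (h (eta 0))| <= 2.
  have /near_right[d d0 hd] := thin_path_in_cover hT1 cT1 t1 hC.
  have q01 : 0 <= l1^-1 < 1 by rewrite invr_ge0 ltW//= invf_lt1.
  have hn : \forall n \near \oo, `|l1^-1 ^+ n * l| < d / 2.
    have /cvgr0Pnorm_lt := geometric_to0 l q01.
    by apply; rewrite divr_gt0.
  apply: filterS hn => n hn.
  have thn := thin_path_iter n t1 F1s G1s thin.
  have ln0 : l1^-1 ^+ n * l != 0.
    by rewrite mulf_neq0// expf_neq0// invr_neq0// gt_eqF.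
  have d2 : 0 < d / 2 < d by apply/andP; split; move: (d0) => /=; lra.
  have [A [p [k [psi [lm eA]]]] hA] := hd _ d2 _ _ ln0 hn thn.
  apply: (@expanded_path _ _ _ (homeo_iter f2 n) _ p k psi U' v' (h \o eta) t2 lm) => //.
  - by rewrite exprn_gt0.
  - exact: scales_iter.
  - move=> s hs; split; last by case: (z_in s hs).
    by apply: continuous_comp; [exact: eta_cont|exact: hmap_continuous].
  - by move=> s hs; have := hA s hs; rewrite eA /= commutes_iter.
rewrite -eta1 -[in RHS]eta0; apply/eqP; rewrite -subr_eq0 -normr_eq0.
set D := `|_| in bound *.
apply/negPn/negP => D0.
have {}D0 : 0 < D by rewrite lt_neqAle eq_sym D0 normr_ge0.
have q01 : 0 <= l2^-1 < 1 by rewrite invr_ge0 ltW//= invf_lt1.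
have hn : \forall n \near \oo, `|l2^-1 ^+ n * 2| < D.
  have /cvgr0Pnorm_lt := geometric_to0 2 q01.
  exact.
have [n _ /(_ n (leqnn n)) [b1 b2]] := filterI bound hn.
move: b2; rewrite ger0_norm; last by rewrite mulr_ge0// exprn_ge0// invr_ge0 ltW.
rewrite exprVn ltr_pdivrMl ?exprn_gt0// => b2.
by have := le_lt_trans b1 b2; rewrite ltxx.
Unshelve. all: by end_near. Qed.

End Conjugacy.
End Dynamics.

(** * Singularities and leaf paths *)

Section Roots.
Variable R : realType.

(** X^k - 1 is separable in characteristic 0 and splits over the algebraically closed field R[i]. *)
Lemma unity_roots_exist k : (0 < k)%N -> exists rs : seq R[i],
  [/\ uniq rs, size rs = k & forall x, (x \in rs) = (x ^+ k == 1)].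
Proof.
move=> k0; have [rs hrs] := closed_field_poly_normal ('X^k - 1 : {poly R[i]}).
have mon : ('X^k - 1 : {poly R[i]}) \is monic by rewrite monicXnsubC.
rewrite (monicP mon) scale1r in hrs.
exists rs; split.
- rewrite -separable_prod_XsubC -hrs separable_Xn_sub_1//.
  by rewrite pnatr_eq0 -lt0n.
- have := size_Xn_sub_1 (R[i]) k0.
  by rewrite hrs size_prod_XsubC => -[].
- by move=> x; rewrite -root_prod_XsubC -hrs rootE !hornerE subr_eq0.
Qed.

Definition ofC (x : R[i]) : R * R := (complex.Re x, complex.Im x).

Lemma ofCK : cancel ofC (@toC R). Proof. by case. Qed.
Lemma toCK : cancel (@toC R) ofC. Proof. by case. Qed.

Lemma finite_unity_roots k : (0 < k)%N ->
  finite_set [set z : R * R | toC z ^+ k = 1].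
Proof.
move=> k0; have [rs [_ _ hrs]] := unity_roots_exist k0.
have -> : [set z | toC z ^+ k = 1] = ofC @` [set` rs].
  apply/seteqP; split=> [z hz|_ [x /= xrs <-]].
    by exists (toC z); [rewrite /= hrs; apply/eqP|rewrite toCK].
  by rewrite /= ofCK; apply/eqP; rewrite -hrs.
exact: finite_image.
Qed.

Lemma finite_valued_path_const (A : set (R * R)) (xi : R -> R * R) (a b : R) :
  finite_set A -> (forall s, a <= s <= b -> {for s, continuous xi} /\ A (xi s)) ->
  forall s t, a <= s <= b -> a <= t <= b -> xi t = xi s.
Proof.
move=> fA hxi s t hs ht.
apply: (@segment_invariant R a b (fun t => xi t = xi s) _ s t) => // r hr.
have [c Ar] := hxi r hr.
have hn : \forall y \near xi r, (~` (A `\ xi r)) y.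
  apply: open_nbhs_nbhs; split; last by move=> [_ ne]; apply: ne.
  apply: closed_openC.
  have acc : accessible_space (R * R)%type.
    by apply: hausdorff_accessible; exact: norm_hausdorff.
  apply: (accessible_finite_set_closed.1 acc).
  by apply: sub_finite_set fA => x [].
have hn' : \forall r' \near r, (~` (A `\ xi r)) (xi r') by exact: (c _ hn).
apply: filterS hn' => r' nA hr'.
have -> // : xi r' = xi r.
by have [_ Ar'] := hxi r' hr'; apply: contrapT => ne; apply: nA.
Qed.

Lemma sqn_toC (z : R * R) : sqn (toC z) = dot z z.
Proof. by rewrite /sqn /dot /= !expr2. Qed.

Lemma pow_norm_radius k (z : R * R) : pow_norm k z = radius z ^+ k.
Proof.
rewrite /pow_norm /radius sqn_toC.
elim: k => [|k IH]; first by rewrite !expr0 sqrtr1.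
by rewrite !exprS sqrtrM ?IH// -sqn_toC sqn_ge0.
Qed.

Lemma toC_scale (a : R) (z : R * R) : toC (a *: z) = (a%:C)%C * toC z.
Proof. by case: z => x y; rewrite /toC /=; congr Complex; rewrite /GRing.scale /=; ring. Qed.

Definition direction (z : R * R) : R * R := (radius z)^-1 *: z.

Lemma radius_gt0 (z : R * R) : z <> 0 -> 0 < radius z.
Proof. by move=> hz; rewrite sqrtr_gt0 dot_gt0. Qed.

Lemma directionK (z : R * R) : z <> 0 -> radius z *: direction z = z.
Proof.
by move=> /radius_gt0 h; rewrite scalerA mulfV ?scale1r// gt_eqF.
Qed.

(** [im_sq k z = 0] means that z^k is a nonnegative real: the prongs of the first foliation in a
    local model are the rays through the k-th roots of unity. *)
Lemma direction_root k (z : R * R) : z <> 0 -> im_sq k z = 0 -> toC (direction z) ^+ k = 1.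
Proof.
move=> hz; have r0 := radius_gt0 hz.
rewrite /im_sq => /eqP; rewrite mulf_eq0 invr_eq0 pnatr_eq0 orbF subr_eq0.
move=> /eqP hr.
have hi : complex.Im (toC z ^+ k) = 0.
  have : pow_norm k z ^+ 2 = sqn (toC z ^+ k).
    by rewrite /pow_norm sqr_sqrtr ?sqnX// exprn_ge0// sqn_ge0.
  rewrite /sqn hr => /eqP; rewrite -subr_eq0 opprD addNKr oppr_eq0 sqrf_eq0.
  by move=> /eqP.
rewrite toC_scale exprMn.
have -> : toC z ^+ k = ((radius z ^+ k)%:C)%C.
  rewrite -pow_norm_radius; case: (toC z ^+ k) hr hi => a b /= -> ->; by [].
by rewrite -rmorphXn -rmorphM -exprMn mulVf ?gt_eqF// expr1n.
Qed.

End Roots.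

(** * Numbers of prongs under a conjugacy *)

Section SingularitiesPreserved.
Variables (R : realType) (T1 T2 : topologicalType) (h : homeo T1 T2).
Variables (f1 : homeo T1 T1) (f2 : homeo T2 T2).
Variables (F1 G1 : measured_foliation R T1) (F2 G2 : measured_foliation R T2).
Variables (l1 l2 : R).
Hypotheses (H1 : contracting f1 F1 G1 l1) (H2 : contracting f2 F2 G2 l2).
Hypothesis commutes : forall x, h (f1 x) = f2 (h x).

(* The prongs of F1 at p are sent into prongs of F2 at h p, and two prongs
   sent into the same one would meet outside p. *)
Lemma prong_count p k1 phi1 k2 phi2 :
  local_model F1 G1 p k1 phi1 -> local_model F2 G2 (h p) k2 phi2 -> (k1 <= k2)%N.
Proof.
move=> lm1 lm2.
have t1 := contracting_transverse H1; have t2 := contracting_transverse H2.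
have s1 : sing F1 = sing G1 by case: t1.
have s2 : sing F2 = sing G2 by case: t2.
have [k10 dp1 p10 reg1 _] := lm1; have [k20 dp2 p20 reg2 _] := lm2.
have hbox : \forall z \near phi1 p,
    (phi1 @` dom phi1) z /\ dom phi2 (h (chart_inv phi1 z)).
  have cc : {for phi1 p, continuous (fun z => h (chart_inv phi1 z))}.
    apply: continuous_comp; last exact: hmap_continuous.
    by apply: chart_inv_continuous; exists p.
  have h2 : \forall z \near phi1 p, dom phi2 (h (chart_inv phi1 z)).
    by apply: cc; apply: near_dom; rewrite chartK.
  exact: filterI (near_chart_image dp1) h2.
have /nbhs_normP[e e0 he] := hbox.
have {}he z : `|z| < e -> (phi1 @` dom phi1) z /\ dom phi2 (h (chart_inv phi1 z)).
  by move=> hz; apply: he; rewrite /= p10 sub0r normrN.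
(* The prong of [F1] in the direction of a root of unity E, and its image under h read in [phi2]. *)
pose ray (E : R * R) (t : R) := chart_inv phi1 (t *: E).
pose Y (E : R * R) (t : R) := phi2 (h (ray E t)).
have e20 : 0 < e / 2 by rewrite divr_gt0.
have e2e : e / 2 < e by move: (e0) => /=; lra.
have unit_norm (E : R * R) : toC E ^+ k1 = 1 -> dot E E = 1.
  move=> hE; apply: (pexpIrn k10).
  - by rewrite nnegrE -sqn_toC sqn_ge0.
  - by rewrite nnegrE.
  - by rewrite /= expr1n -sqn_toC -sqnX hE sqn1.
have small (E : R * R) (t : R) : toC E ^+ k1 = 1 -> `|t| < e -> `|t *: E| < e.
  move=> hE; apply: le_lt_trans; rewrite normrZ ler_piMr// prod_normE /= ge_max.
  have := unit_norm E hE; rewrite /dot -!expr2 => h1.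
  have sq (a b : R) : a ^+ 2 + b ^+ 2 = 1 -> `|a| <= 1.
    move=> hab; rewrite -(@expr_le1 _ 2)// real_normK ?num_real//.
    by rewrite -hab lerDl sqr_ge0.
  by apply/andP; split; [exact: sq h1|apply: (sq _ E.1); rewrite addrC].
have ray_cont (E : R * R) (t : R) : toC E ^+ k1 = 1 -> `|t| < e -> {for t, continuous (ray E)}.
  move=> hE ht; have [iz _] := he _ (small E t hE ht).
  have cs : {for t, continuous (fun t : R => t *: E)} by apply: cvgZl; exact: cvg_id.
  exact: (continuous_comp cs (chart_inv_continuous iz)).
have Y_cont (E : R * R) (t : R) : toC E ^+ k1 = 1 -> `|t| < e -> {for t, continuous (Y E)}.
  move=> hE ht; have [_ d2] := he _ (small E t hE ht).
  apply: (@continuous_comp _ _ _ (ray E) (phi2 \o h)); first exact: ray_cont.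
  by apply: continuous_comp; [exact: hmap_continuous|exact: chart_continuous].
have ray0 (E : R * R) : ray E 0 = p by rewrite /ray scale0r -p10 chartK.
have Y0 (E : R * R) : Y E 0 = 0 by rewrite /Y ray0.
have rayP (E : R * R) (t : R) : toC E ^+ k1 = 1 -> 0 < t < e ->
   [/\ dom phi1 (ray E t), phi1 (ray E t) = t *: E, ray E t <> p &
       dom phi2 (h (ray E t))].
  move=> hE /andP[t0 te].
  have nt : `|t| < e by rewrite gtr0_norm.
  have [iz d2] := he _ (small E t hE nt); have [d1 e1] := chart_invK iz.
  split => // hp; move: e1; rewrite -/(ray E t) hp p10 => /esym hz.
  have : radius (t *: E) = 0 by rewrite hz /radius /dot /= mulr0 addr0 sqrtr0.
  rewrite /radius (_ : dot _ _ = t ^+ 2 * dot E E); last first.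
    by rewrite /dot /GRing.scale /= /GRing.scale /=; ring.
  by rewrite unit_norm// mulr1 sqrtr_sqr gtr0_norm// => tE; rewrite tE ltxx in t0.
have Y_neq0 (E : R * R) (t : R) : toC E ^+ k1 = 1 -> 0 < t < e -> Y E t <> 0.
  move=> hE ht; have [_ _ ne d2] := rayP E t hE ht.
  rewrite /Y -p20 => /(congr1 (chart_inv phi2)); rewrite !chartK//.
  by move=> /(congr1 (hinv h)); rewrite !hmapK.
have ray_flat (E : R * R) (t : R) : toC E ^+ k1 = 1 -> 0 < t < e ->
    im_sq k1 (phi1 (ray E t)) = 0.
  move=> hE ht; have [_ -> _ _] := rayP E t hE ht; have /andP[t0 _] := ht.
  rewrite /im_sq pow_norm_radius toC_scale exprMn hE mulr1 -rmorphXn /=.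
  rewrite /radius (_ : dot _ _ = t ^+ 2 * dot E E); last first.
    by rewrite /dot /GRing.scale /= /GRing.scale /=; ring.
  by rewrite unit_norm// mulr1 sqrtr_sqr gtr0_norm// subrr mul0r.
have near_open (t : R) : 0 < t < e -> \forall t' \near t, 0 < t' < e.
  move=> /andP[t0 te]; near=> t'; apply/andP; split; near: t'.
    exact: lt_nbhsr.
  exact: lt_nbhsl.
(* For t > 0 the points are regular and the prong has a locally constant transverse coordinate, so
   [plaque_to_plaque] applies to its image. *)
have flat_loc (E : R * R) (t : R) : toC E ^+ k1 = 1 -> 0 < t < e -> \forall t' \near t,
    im_sq k2 (Y E t') = im_sq k2 (Y E t).
  move=> hE ht; have [d1 _ ne d2] := rayP E t hE ht.
  have nt : `|t| < e by have /andP[? ?] := ht; rewrite gtr0_norm.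
  have cr := ray_cont E t hE nt.
  have ns1 := reg1 _ d1 ne.
  have [U [v [hv Ux]]] := regular_coord ns1.
  have [V [w [hw Vx]]] : exists V w, tcoord G1 (V, w) /\ V (ray E t).
    by apply: regular_coord; rewrite -s1.
  have ns2 : ~ sing F2 (h (ray E t)).
    apply: reg2 => // /(congr1 (hinv h)); by rewrite !hmapK.
  have [U' [v' [hv' Ux']]] := regular_coord ns2.
  have [V' [w' [hw' Vx']]] : exists V w, tcoord G2 (V, w) /\ V (h (ray E t)).
    by apply: regular_coord; rewrite -s2.
  have [c1 [b1 q1]] := local_model_squares lm1 d1 hv hw Ux Vx.
  have [c2 [b2 q2]] := local_model_squares lm2 d2 hv' hw' Ux' Vx'.
  have key := plaque_to_plaque H1 H2 commutes hv hv' Ux Ux'.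
  have key' : \forall t' \near t, v (ray E t') = v (ray E t) ->
      v' (h (ray E t')) = v' (h (ray E t)) by exact: (cr _ key).
  have q1' : \forall t' \near t, im_sq k1 (phi1 (ray E t')) = (v (ray E t') + b1) ^+ 2 /\
    re_sq k1 (phi1 (ray E t')) = (w (ray E t') + c1) ^+ 2 by exact: (cr _ q1).
  have chr : {for t, continuous (h \o ray E)}.
    by apply: continuous_comp => //; exact: hmap_continuous.
  have q2' : \forall t' \near t, im_sq k2 (Y E t') = (v' (h (ray E t')) + b2) ^+ 2 /\
    re_sq k2 (Y E t') = (w' (h (ray E t')) + c2) ^+ 2 by exact: (chr _ q2).
  have z1 : v (ray E t) = - b1.
    have [e1 _] := nbhs_singleton q1'; move: e1; rewrite ray_flat// => /esym /eqP.
    by rewrite sqrf_eq0 addr_eq0 => /eqP.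
  have z2 := (nbhs_singleton q2').1.
  near=> t'.
  have ht' : 0 < t' < e by near: t'; exact: near_open.
  have [-> _] : im_sq k2 (Y E t') = (v' (h (ray E t')) + b2) ^+ 2 /\
    re_sq k2 (Y E t') = (w' (h (ray E t')) + c2) ^+ 2 by near: t'; exact: q2'.
  rewrite z2; congr ((_ + _) ^+ 2).
  have : v (ray E t') = v (ray E t) -> v' (h (ray E t')) = v' (h (ray E t)).
    by near: t'; exact: key'.
  apply; rewrite z1.
  have [e1 _] : im_sq k1 (phi1 (ray E t')) = (v (ray E t') + b1) ^+ 2 /\
    re_sq k1 (phi1 (ray E t')) = (w (ray E t') + c1) ^+ 2 by near: t'; exact: q1'.
  by move: e1; rewrite ray_flat// => /esym /eqP; rewrite sqrf_eq0 addr_eq0 => /eqP.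
(* [im_sq] of the image is locally constant for t > 0 and tends to 0 at p, so it vanishes: the image
   lies on the prongs of [F2]. *)
have Y_flat (E : R * R) (t : R) : toC E ^+ k1 = 1 -> 0 < t < e -> im_sq k2 (Y E t) = 0.
  move=> hE ht; apply/eqP; apply/negPn/negP => nz.
  have ct : {for 0, continuous (fun t => im_sq k2 (Y E t))}.
    apply: (@continuous_comp _ _ _ (Y E) (im_sq k2)); last exact: im_sq_continuous.
    by apply: Y_cont => //; rewrite normr0.
  have hn : \forall s \near (0 : R), `|im_sq k2 (Y E s)| < `|im_sq k2 (Y E t)|.
    have cn : {for 0, continuous (fun t => `|im_sq k2 (Y E t)|)} by exact: cvg_norm.
    apply: cvgr_lt cn _ _.
    by rewrite Y0 im_sq0// normr0 normr_gt0.
  have /nbhs_normP[d d0 hd] := hn.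
  have /andP[t0 te] := ht.
  pose s := Num.min t (d / 2).
  have d20 : 0 < d / 2 by rewrite divr_gt0.
  have s0 : 0 < s by rewrite lt_min t0.
  have st : s <= t by rewrite ge_min lexx.
  have sd : s < d.
    by apply: le_lt_trans (_ : s <= d / 2) _; rewrite ?ge_min ?lexx ?orbT//; move: (d0) => /=; lra.
  have : `|im_sq k2 (Y E s)| < `|im_sq k2 (Y E t)|.
    by apply: hd; rewrite /= sub0r normrN gtr0_norm.
  suff -> : im_sq k2 (Y E s) = im_sq k2 (Y E t) by rewrite ltxx.
  apply: (@segment_invariant R s t (fun r => im_sq k2 (Y E r) = im_sq k2 (Y E t)) _ t s) => //.
  - move=> r /andP[sr rt].
    have hr : 0 < r < e by rewrite (lt_le_trans s0)//= (le_lt_trans rt).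
    by apply: filterS (flat_loc E r hE hr) => r' ->.
  - by rewrite st lexx.
  - by rewrite st lexx.
(* The direction along the image is continuous with values among finitely many roots of unity, so
   its value at e / 2 is also its value at all smaller t > 0. *)
pose D E := direction (Y E (e / 2)).
have he2 : 0 < e / 2 < e by rewrite e20.
have D_const (E : R * R) (t : R) : toC E ^+ k1 = 1 -> 0 < t <= e / 2 ->
    direction (Y E t) = D E.
  move=> hE /andP[t0 te].
  apply: (@finite_valued_path_const R _ (fun t => direction (Y E t)) t (e / 2)
    (finite_unity_roots R k20)); rewrite ?lexx ?te ?andbT//.
  move=> s /andP[ts se].
  have hs : 0 < s < e by rewrite (lt_le_trans t0)//= (le_lt_trans se).
  split; last by apply: direction_root; [exact: Y_neq0|exact: Y_flat].
  have cY : {for s, continuous (Y E)}.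
    by apply: Y_cont => //; have /andP[? ?] := hs; rewrite gtr0_norm.
  apply: cvgZ => //; apply: cvgV; first by rewrite gt_eqF// radius_gt0//; exact: Y_neq0.
  exact: radius_continuous.
(* The radius varies continuously from 0, so the image covers an initial segment of the ray of
   direction [D E]. *)
have reach (E : R * R) (m : R) : toC E ^+ k1 = 1 -> 0 < m <= radius (Y E (e / 2)) ->
    exists2 t, 0 < t < e & Y E t = m *: D E.
  move=> hE /andP[m0 mR].
  have rc : {within `[0, e / 2], continuous (fun t => radius (Y E t))}.
    apply: continuous_in_subspaceT => s; rewrite inE /= in_itv /= => /andP[sa sb].
    apply: radius_continuous; apply: Y_cont => //.
    by rewrite ger0_norm// (le_lt_trans sb).
  have r00 : radius (Y E 0) = 0 by rewrite Y0 /radius /dot /= mulr0 addr0 sqrtr0.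
  have hm : Num.min (radius (Y E 0)) (radius (Y E (e / 2))) <= m <=
      Num.max (radius (Y E 0)) (radius (Y E (e / 2))).
    by rewrite r00 ge_min le_max mR orbT andbT ltW.
  have [t] := IVT (ltW e20) rc hm.
  rewrite in_itv /= => /andP[ta tb] tm.
  have t0 : 0 < t.
    rewrite lt_neqAle ta andbT; apply/eqP => t0.
    by move: m0; rewrite -tm -t0 r00 ltxx.
  have ht : 0 < t < e by rewrite t0 (le_lt_trans tb).
  exists t => //; rewrite -(D_const E t hE) ?t0 ?tb// -tm directionK//.
  exact: Y_neq0.
(* Two images with the same direction both contain the point at the smaller of their radii at e / 2;
   injectivity of h then brings the two prongs together at a point other than p. *)
have D_inj (E E' : R * R) : toC E ^+ k1 = 1 -> toC E' ^+ k1 = 1 -> D E = D E' -> E = E'.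
  move=> hE hE' eD.
  pose m := Num.min (radius (Y E (e / 2))) (radius (Y E' (e / 2))).
  have m0 : 0 < m by rewrite lt_min !radius_gt0//; exact: Y_neq0.
  have [|t ht ht2] := reach E m hE; first by rewrite m0 ge_min lexx.
  have [|t' ht' ht2'] := reach E' m hE'; first by rewrite m0 ge_min lexx orbT.
  have : Y E t = Y E' t' by rewrite ht2 ht2' eD.
  have [d1 p1 _ d2] := rayP E t hE ht; have [d1' p1' _ d2'] := rayP E' t' hE' ht'.
  rewrite /Y => /(congr1 (chart_inv phi2)); rewrite !chartK//.
  move=> /(congr1 (hinv h)); rewrite !hmapK => /(congr1 phi1).
  rewrite p1 p1' => eq.
  have rE (E0 : R * R) (t0 : R) : toC E0 ^+ k1 = 1 -> 0 < t0 < e -> radius (t0 *: E0) = t0.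
    move=> h0 /andP[t00 _].
    rewrite /radius (_ : dot _ _ = t0 ^+ 2 * dot E0 E0); last first.
      by rewrite /dot /GRing.scale /= /GRing.scale /=; ring.
    by rewrite unit_norm// mulr1 sqrtr_sqr gtr0_norm.
  have tt : t = t' by rewrite -(rE E t)// eq rE.
  have /andP[t0 _] := ht.
  apply: (@scalerI _ _ t); first by rewrite gt_eqF.
  by rewrite eq tt.
have [rs [urs szrs hrs]] := unity_roots_exist R k10.
rewrite -szrs -(size_map (fun x => toC (D (ofC x)))).
have hroot x : x \in rs -> toC (ofC x) ^+ k1 = 1.
  by rewrite hrs ofCK => /eqP.
(* The k1 roots E yield k1 distinct k2-th roots of unity, of which there are at most k2. *)
apply: max_unity_roots => //.
  apply/allP => _ /mapP[x /hroot hx ->]; apply/unity_rootP.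
  by apply: direction_root; [exact: Y_neq0|exact: Y_flat].
rewrite map_inj_in_uniq// => x y /hroot hx /hroot hy hxy.
by rewrite -(ofCK x) -(ofCK y) (D_inj _ _ hx hy (can_inj (@toCK R) hxy)).
Unshelve. all: by end_near. Qed.

End SingularitiesPreserved.

Lemma within_comp (X S T : topologicalType) (A : set X) (g : X -> S) (h : S -> T) :
  {within A, continuous g} -> continuous h -> {within A, continuous (h \o g)}.
Proof.
move=> /subspace_continuousP cg ch; apply/subspace_continuousP => x Ax.
by apply: cvg_comp; [exact: cg|exact: ch].
Qed.

Section LeafPaths.
Variables (R : realType).

Lemma sing_preserved (T1 T2 : topologicalType) (h : homeo T1 T2)
    (f1 : homeo T1 T1) (f2 : homeo T2 T2) (F1 G1 : measured_foliation R T1)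
    (F2 G2 : measured_foliation R T2) (l1 l2 : R) :
  contracting f1 F1 G1 l1 -> contracting f2 F2 G2 l2 ->
  (forall x, h (f1 x) = f2 (h x)) -> forall p, sing F1 p <-> sing F2 (h p).
Proof.
move=> H1 H2 commutes p.
have [k1 [phi1 [lm1 s1]]] := local_modelP p (contracting_transverse H1).
have [k2 [phi2 [lm2 s2]]] := local_modelP (h p) (contracting_transverse H2).
have commutes' y : homeo_sym h (f2 y) = f1 (homeo_sym h y).
  by rewrite /= -[y in LHS](hinvK h) -commutes hmapK.
have k12 := prong_count H1 H2 commutes lm1 lm2.
have lm1' : local_model F1 G1 (homeo_sym h (h p)) k1 phi1 by rewrite /= hmapK.
have k21 := prong_count H2 H1 commutes' lm2 lm1'.
have ek : k1 = k2 by apply/eqP; rewrite eqn_leq k12 k21.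
by rewrite s1 s2 ek.
Qed.

(** Being a leaf path is a local condition at regular points only. By [sing_preserved] a point with
    regular image is itself regular, and there [plaque_to_plaque] applies; passages through
    singularities go to passages through singularities. *)
Lemma leaf_path_image (T1 T2 : topologicalType) (h : homeo T1 T2)
    (f1 : homeo T1 T1) (f2 : homeo T2 T2) (F1 G1 : measured_foliation R T1)
    (F2 G2 : measured_foliation R T2) (l1 l2 : R) (gamma : R -> T1) :
  contracting f1 F1 G1 l1 -> contracting f2 F2 G2 l2 ->
  (forall x, h (f1 x) = f2 (h x)) ->
  leaf_path F1 gamma -> leaf_path F2 (h \o gamma).
Proof.
move=> H1 H2 commutes [cg hg]; split; first exact: within_comp (@hmap_continuous _ _ h).
move=> t U' v' It hv' Ux'.
have ns : ~ sing F1 (gamma t).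
  by move=> /(sing_preserved H1 H2 commutes); exact: coord_regular hv' Ux'.
have [U [v [hv Ux]]] := regular_coord ns.
have key := plaque_to_plaque H1 H2 commutes hv hv' Ux Ux'.
have hs := hg t U v It hv Ux.
have key' : \forall s \near t, I01 R s -> v (gamma s) = v (gamma t) ->
    v' (h (gamma s)) = v' (h (gamma t)).
  by move/subspace_continuousP : cg => /(_ t It) /(_ _ key).
near=> s => Is.
have : I01 R s -> v (gamma s) = v (gamma t) ->
    v' (h (gamma s)) = v' (h (gamma t)) by near: s; exact: key'.
apply => //; move: Is; near: s; exact: hs.
Unshelve. all: by end_near. Qed.

(** This is what remains of the dynamics in the transport of leaves, rectangles and rails. Both
    directions are included so that the inverse of h satisfies it too. *)
Definition leaves_to (T1 T2 : topologicalType) (h : homeo T1 T2)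
    (F1 : measured_foliation R T1) (F2 : measured_foliation R T2) :=
  (forall gamma, leaf_path F1 gamma -> leaf_path F2 (h \o gamma)) /\
  (forall gamma, leaf_path F2 gamma -> leaf_path F1 (hinv h \o gamma)).

Lemma leaves_to_sym (T1 T2 : topologicalType) (h : homeo T1 T2) F1 F2 :
  leaves_to h F1 F2 -> leaves_to (homeo_sym h) F2 F1.
Proof. by move=> []. Qed.

Lemma conjugate_leaves (T1 T2 : topologicalType) (h : homeo T1 T2)
    (f1 : homeo T1 T1) (f2 : homeo T2 T2) (F1 G1 : measured_foliation R T1)
    (F2 G2 : measured_foliation R T2) (l1 l2 : R) :
  contracting f1 F1 G1 l1 -> contracting f2 F2 G2 l2 ->
  (forall x, h (f1 x) = f2 (h x)) -> leaves_to h F1 F2.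
Proof.
move=> H1 H2 commutes; split=> gamma.
  exact: leaf_path_image H1 H2 commutes.
apply: (leaf_path_image (h := homeo_sym h) H2 H1) => y.
by rewrite /= -[y in LHS](hinvK h) -commutes hmapK.
Qed.

End LeafPaths.

(** * Images of sets, leaves and segments under a homeomorphism *)

Section ImageFacts.
Variables (S T : topologicalType) (h : homeo S T).

Lemma homeo_inj : injective h. Proof. exact: can_inj (@hmapK _ _ h). Qed.

Lemma image_homeoP (A : set S) y : (h @` A) y <-> A (hinv h y).
Proof.
split=> [[x Ax <-]|Ay]; first by rewrite hmapK.
by exists (hinv h y) => //; rewrite hinvK.
Qed.

Lemma image_homeo_mem (A : set S) x : (h @` A) (h x) <-> A x.
Proof. by rewrite image_homeoP hmapK. Qed.

Lemma homeo_imageK (A : set S) : hinv h @` (h @` A) = A.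
Proof.
rewrite image_comp; apply/seteqP; split=> [_ [x Ax <-]|x Ax] /=.
  by rewrite hmapK.
by exists x => //=; rewrite hmapK.
Qed.

Lemma homeo_imageKV (A : set T) : h @` (hinv h @` A) = A.
Proof.
rewrite image_comp; apply/seteqP; split=> [_ [x Ax <-]|x Ax] /=.
  by rewrite hinvK.
by exists x => //=; rewrite hinvK.
Qed.

Lemma homeo_imageI (A B : set S) : h @` (A `&` B) = h @` A `&` h @` B.
Proof.
apply/seteqP; split=> y; last by move=> [/image_homeoP a /image_homeoP b]; apply/image_homeoP.
by move=> /image_homeoP[a b]; split; apply/image_homeoP.
Qed.

Lemma homeo_imageD (A B : set S) : h @` (A `\` B) = h @` A `\` h @` B.
Proof.
apply/seteqP; split=> y.
  by move=> /image_homeoP[a b]; split; [apply/image_homeoP|move=> /image_homeoP].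
by move=> [/image_homeoP a b]; apply/image_homeoP; split => // c; apply/b/image_homeoP.
Qed.

Lemma homeo_open (A : set S) : open A -> open (h @` A).
Proof.
move=> oA; have -> : h @` A = hinv h @^-1` A.
  by apply/seteqP; split=> y /image_homeoP.
by have /continuousP := @hinv_continuous _ _ h; exact.
Qed.

End ImageFacts.

Lemma homeo_closure (S T : topologicalType) (h : homeo S T) (A : set S) :
  h @` closure A = closure (h @` A).
Proof.
have sub (S' T' : topologicalType) (k : homeo S' T') (B : set S') :
    k @` closure B `<=` closure (k @` B).
  move=> _ [x cx <-] N /= hN.
  have [z [Bz Nz]] := cx _ (@hmap_continuous _ _ k x _ hN).
  by exists (k z); split => //; exists z.
apply/seteqP; split; first exact: sub.
move=> y cy; have := sub _ _ (homeo_sym h) (h @` A) (hinv h y).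
rewrite /= homeo_imageK => hc; exists (hinv h y); last by rewrite hinvK.
by apply: hc; exists y.
Qed.

Lemma embedding_on_homeo (X S T : topologicalType) (h : homeo S T) (D : set X) g :
  embedding_on D g -> embedding_on D (h \o g).
Proof.
move=> [cg ig og]; split.
- exact: within_comp (@hmap_continuous _ _ h).
- by move=> x y Dx Dy /homeo_inj; exact: ig.
- move=> V /og[W oW e]; exists (h @` W); first exact: homeo_open.
  by rewrite -(image_comp g h (D `&` V)) -(image_comp g h D) e homeo_imageI.
Qed.

Lemma embedding_on_precomp (X Y S : topologicalType) (k : homeo X Y) (D : set Y)
    (g : Y -> S) :
  embedding_on D g -> embedding_on (k @^-1` D) (g \o k).
Proof.
move=> [cg ig og].
have eim (B : set Y) : (g \o k) @` (k @^-1` B) = g @` B.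
  apply/seteqP; split=> [_ [x Bx <-]|_ [y By <-]] /=; first by exists (k x).
  by exists (hinv k y); rewrite /= hinvK.
split.
- apply/subspace_continuousP => x Dx.
  have /subspace_continuousP /(_ (k x) Dx) hc := cg.
  apply: cvg_trans hc => A hA.
  have hn : \forall y \near k x, D y -> A (g y) by exact: hA.
  have hn' : \forall z \near x, D (k z) -> A (g (k z)).
    exact: (@hmap_continuous _ _ k x _ hn).
  exact: hn'.
- by move=> x y Dx Dy /(ig _ _ Dx Dy) /homeo_inj.
- move=> V oV; have [W oW e] := og _ (homeo_open k oV).
  exists W => //; rewrite eim -e -eim; congr (_ @` _).
  by apply/seteqP; split=> x [Dx Vx]; split => //; apply/(image_homeo_mem k).
Qed.

Section LeafTransport.
Variables (R : realType) (T1 T2 : topologicalType) (h : homeo T1 T2).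
Variables (F1 : measured_foliation R T1) (F2 : measured_foliation R T2).
Hypothesis hF : leaves_to h F1 F2.

Lemma leaf_component_image A x :
  h @` leaf_component F1 A x = leaf_component F2 (h @` A) (h x).
Proof.
apply/seteqP; split=> [_ [y [g [lg g0 g1 gA]] <-]|y [g [lg g0 g1 gA]]].
  exists (h \o g); split; rewrite /= ?g0 ?g1//; first exact: hF.1.
  by move=> t It; exists (g t) => //; exact: gA.
exists (hinv h y); last by rewrite hinvK.
exists (hinv h \o g); split; rewrite /= ?g0 ?g1 ?hmapK//; first exact: hF.2.
by move=> t It; apply/image_homeoP; exact: gA.
Qed.

Lemma homeo_imageT (S T : topologicalType) (k : homeo S T) : k @` setT = setT.
Proof. by apply/seteqP; split=> y // _; apply/image_homeoP. Qed.

Lemma leaf_image x : h @` leaf F1 x = leaf F2 (h x).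
Proof. by rewrite /leaf leaf_component_image homeo_imageT. Qed.

Lemma homeo_imageC1 (S T : topologicalType) (k : homeo S T) p :
  k @` (~` [set p]) = ~` [set k p].
Proof.
apply/seteqP; split=> [_ [x xp <-] /= /homeo_inj //|y yp].
apply/image_homeoP => /= e; apply: yp.
by rewrite /= -e hinvK.
Qed.

Lemma separatrix_image p A : separatrix F1 p A -> separatrix F2 (h p) (h @` A).
Proof.
move=> [x [lx xp eA]]; exists (h x); split.
- by rewrite -leaf_image; exists x.
- by move=> /homeo_inj.
- by rewrite eA leaf_component_image homeo_imageC1.
Qed.

Lemma arc_between_image (S T : topologicalType) (k : homeo S T) I a b :
  arc_between R I a b -> arc_between R (k @` I) (k a) (k b).
Proof.
move=> [g [eg <- <- <-]]; exists (k \o g); split => //.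
  exact: embedding_on_homeo.
by rewrite image_comp.
Qed.

Lemma leaf_interval_image I a b :
  leaf_interval F1 I a b -> leaf_interval F2 (h @` I) (h a) (h b).
Proof.
move=> [arc sub]; split; first exact: arc_between_image.
by rewrite -leaf_image; exact: image_subset.
Qed.

End LeafTransport.

Definition image_family (T1 T2 : topologicalType) (h : homeo T1 T2) (d : set (set T1)) :
  set (set T2) := (fun I => h @` I) @` d.

Section SegmentTransport.
Variables (R : realType) (T1 T2 : surface R) (h : homeo T1 T2).
Variables (F1 : measured_foliation R T1) (F2 : measured_foliation R T2).
Hypothesis hF : leaves_to h F1 F2.

Lemma leaf_segment_image p x :
  h @` leaf_segment F1 p x = leaf_segment F2 (h p) (h x).
Proof.
apply/seteqP; split=> [_ [y [A hA Ay] <-]|y [A hA Ay]].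
  by exists (h @` A); [exact: (leaf_interval_image hF)|exists y].
exists (hinv h y); last by rewrite hinvK.
exists (hinv h @` A); last by exists y.
have := leaf_interval_image (leaves_to_sym hF) hA.
by rewrite /= !hmapK.
Qed.

Lemma interior_of_image I a b :
  h @` interior_of I a b = interior_of (h @` I) (h a) (h b).
Proof. by rewrite /interior_of homeo_imageD image_setU !image_set1. Qed.

Lemma segments_to_image_sub P B :
  image_family h (segments_to F1 P B) `<=` segments_to F2 (h @` P) (h @` B).
Proof.
move=> _ [I [a [b [hI Pa Bb e]]] <-]; exists (h a), (h b); split.
- exact: (leaf_interval_image hF).
- by exists a.
- by exists b.
- by rewrite -interior_of_image -homeo_imageI e image_set0.
Qed.

Lemma family_union_image d : family_union (image_family h d) = h @` family_union d.
Proof.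
apply/seteqP; split=> [y [_ [I dI <-] [x Ix <-]]|_ [x [I dI Ix] <-]].
  by exists x => //; exists I.
by exists (h @` I); [exists I|exists x].
Qed.

End SegmentTransport.

Lemma image_familyK (T1 T2 : topologicalType) (h : homeo T1 T2) d :
  image_family (homeo_sym h) (image_family h d) = d.
Proof.
rewrite /image_family image_comp; apply/seteqP; split=> [_ [I dI <-]|I dI] /=.
  by rewrite homeo_imageK.
by exists I => //=; rewrite homeo_imageK.
Qed.

Lemma segments_to_image (R : realType) (S1 S2 : surface R) (h : homeo S1 S2)
    (F1 : measured_foliation R S1) (F2 : measured_foliation R S2) P B :
  leaves_to h F1 F2 ->
  image_family h (segments_to F1 P B) = segments_to F2 (h @` P) (h @` B).
Proof.
move=> hF; apply/seteqP; split; first exact: segments_to_image_sub.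
move=> I hI.
(* The reverse inclusion is the first one applied to the inverse of h. *)
have := @segments_to_image_sub R _ _ _ _ _ (leaves_to_sym hF) (h @` P) (h @` B).
rewrite /= !homeo_imageK => hs.
exists (hinv h @` I); last exact: homeo_imageKV.
by apply: hs; exists I.
Qed.

(** * Rectangles and rails *)

Section Reflections.
Variable R : realType.

Lemma reflectionK : cancel (@reflection R) (@reflection R).
Proof. by case=> a b; rewrite /reflection /= opprB addrC subrK. Qed.

Definition reflection_homeo : homeo (R * R)%type (R * R)%type :=
  Homeo (@reflection_continuous R) (@reflection_continuous R) reflectionK reflectionK.

Lemma flip_continuous : continuous (fun t : R => 1 - t).
Proof. by move=> t; apply: cvgB; [exact: cvg_cst|exact: cvg_id]. Qed.

Lemma flipK : cancel (fun t : R => 1 - t) (fun t => 1 - t).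
Proof. by move=> t; rewrite opprB addrC subrK. Qed.

Definition flip : homeo R R :=
  Homeo flip_continuous flip_continuous flipK flipK.

Lemma flip_I01 t : I01 R (1 - t) <-> I01 R t.
Proof. by rewrite !I01P; split=> /andP[? ?]; apply/andP; split; lra. Qed.

Lemma flip_I01E : flip @^-1` I01 R = I01 R.
Proof. by apply/seteqP; split=> t /=; rewrite flip_I01. Qed.

Lemma closed_square_reflection z :
  @closed_square R (reflection z) <-> @closed_square R z.
Proof. by split=> -[/= /flip_I01 ? ?]. Qed.

Lemma reflection_closed_square :
  reflection_homeo @^-1` (@closed_square R) = @closed_square R.
Proof. by apply/seteqP; split=> z /closed_square_reflection. Qed.

Lemma reflection_open_square :
  reflection_homeo @^-1` (@open_square R) = @open_square R.
Proof.
apply/seteqP; split=> z.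
  move=> /open_squareP[/= /andP[a b] c]; apply/open_squareP.
  by split => //; apply/andP; split; lra.
move=> /open_squareP[/andP[a b] c]; apply/open_squareP.
by split => //=; apply/andP; split; lra.
Qed.

End Reflections.

(** Separated from the orientation because composition with h always preserves this part, as does
    reflection of the square, while the orientation may require the reflection. *)
Definition unoriented_parametrization (R : realType) (S : surface R)
    (F G : measured_foliation R S) (Q : set S) (rho : R * R -> S) :=
  [/\ {within @closed_square R, continuous rho},
      rho @` @closed_square R = Q,
      embedding_on (@open_square R) rho,
      (forall y, I01 R y ->
         embedding_on (I01 R) (fun x => rho (x, y)) /\
         exists c, hleaf rho y `<=` leaf F c) &
      (forall x, I01 R x ->
         embedding_on (I01 R) (fun y => rho (x, y)) /\
         exists c, vleaf rho x `<=` leaf G c)].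

Lemma parametrizationP (R : realType) (S : surface R)
    (F G : measured_foliation R S) (Q : set S) (rho : R * R -> S) :
  parametrization F G Q rho <-> unoriented_parametrization F G Q rho /\
    orientation_preserving_on (@open_square R) rho.
Proof. by split=> [[? ? [? ?] ? ?]|[[? ? ? ? ?] ?]]. Qed.

Section RectangleTransport.
Variables (R : realType) (S1 S2 : surface R) (h : homeo S1 S2).
Variables (F1 G1 : measured_foliation R S1) (F2 G2 : measured_foliation R S2).
Hypotheses (hF : leaves_to h F1 F2) (hG : leaves_to h G1 G2).

Lemma trivially_bifoliated_image r :
  trivially_bifoliated F1 G1 r -> trivially_bifoliated F2 G2 (h @` r).
Proof.
move=> [oR cR nR tr]; split.
- exact: homeo_open.
- apply: connected_continuous_connected => //.
  by apply: continuous_subspaceT => x; exact: hmap_continuous.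
- by have [x rx] := nR; exists (h x); exists x.
- move=> _ _ [x rx <-] [y ry <-] /=.
  have [[a [b hI]] [c [d hJ]] [z rz e]] := tr x y rx ry.
  rewrite -!(leaf_component_image hF) -!(leaf_component_image hG) -!homeo_closure.
  split.
  + by exists (h a), (h b); exact: arc_between_image.
  + by exists (h c), (h d); exact: arc_between_image.
  + by exists (h z); [exists z|rewrite -homeo_imageI e image_set1].
Qed.

Lemma rectangle_image Q : rectangle F1 G1 Q -> rectangle F2 G2 (h @` Q).
Proof.
move=> [r tr ->]; exists (h @` r); first exact: trivially_bifoliated_image.
by rewrite homeo_closure.
Qed.

Lemma hleaf_image rho y : hleaf (h \o rho) y = h @` hleaf rho y.
Proof. by rewrite /hleaf image_comp. Qed.

Lemma vleaf_image rho x : vleaf (h \o rho) x = h @` vleaf rho x.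
Proof. by rewrite /vleaf image_comp. Qed.

Lemma leaf_image_sub A c (F : measured_foliation R S1) (F' : measured_foliation R S2) :
  leaves_to h F F' -> A `<=` leaf F c -> h @` A `<=` leaf F' (h c).
Proof. by move=> hF' sub; rewrite -(leaf_image hF'); exact: image_subset. Qed.

Lemma unoriented_parametrization_image Q rho :
  unoriented_parametrization F1 G1 Q rho ->
  unoriented_parametrization F2 G2 (h @` Q) (h \o rho).
Proof.
move=> [c im e hh hv]; split.
- exact: within_comp (@hmap_continuous _ _ h).
- by rewrite -(image_comp rho h) im.
- exact: embedding_on_homeo.
- move=> y Iy; have [ey [x ex]] := hh y Iy.
  split; first exact: (embedding_on_homeo h ey).
  by exists (h x); rewrite hleaf_image; exact: (leaf_image_sub hF).
- move=> y Iy; have [ey [x ex]] := hv y Iy.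
  split; first exact: (embedding_on_homeo h ey).
  by exists (h x); rewrite vleaf_image; exact: (leaf_image_sub hG).
Qed.

End RectangleTransport.

Section Reflected.
Variables (R : realType) (S : surface R).
Implicit Types (F G : measured_foliation R S) (rho : R * R -> S).

Lemma hleaf_reflection rho y : hleaf (rho \o @reflection R) y = hleaf rho y.
Proof.
rewrite /hleaf; apply/seteqP; split=> [_ [x Ix <-]|_ [x Ix <-]].
  by exists (1 - x) => //; apply/flip_I01.
exists (1 - x); first exact/flip_I01.
by rewrite /= /reflection /= opprB addrC subrK.
Qed.

Lemma vleaf_reflection rho x :
  vleaf (rho \o @reflection R) x = vleaf rho (1 - x).
Proof. by []. Qed.

Lemma unoriented_parametrization_reflection F G Q rho :
  unoriented_parametrization F G Q rho ->
  unoriented_parametrization F G Q (rho \o @reflection R).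
Proof.
move=> [c im e hh hv]; split.
- have /subspace_continuousP hc := c; apply/subspace_continuousP => x Dx.
  have Dx' : @closed_square R (reflection x).
    exact/closed_square_reflection.
  apply: cvg_trans (hc _ Dx') => A hA.
  have hn : \forall y \near reflection x, @closed_square R y -> A (rho y) by exact: hA.
  have hn' : \forall z \near x, @closed_square R (reflection z) -> A (rho (reflection z)).
    exact: (@reflection_continuous R x _ hn).
  suff : \forall z \near x, @closed_square R z -> A (rho (reflection z)) by [].
  apply: filterS hn' => z hz Dz; apply: hz.
  exact/closed_square_reflection.
- rewrite -im; apply/seteqP; split=> [_ [x Dx <-]|_ [x Dx <-]].
    exists (reflection x) => //.
    exact/closed_square_reflection.
  exists (reflection x); last by rewrite /= reflectionK.
  exact/closed_square_reflection.
- have := embedding_on_precomp (reflection_homeo R) e.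
  by rewrite reflection_open_square.
- move=> y Iy; have [ey [x ex]] := hh y Iy; rewrite hleaf_reflection.
  split; last by exists x.
  have := embedding_on_precomp (flip R) ey.
  by rewrite flip_I01E.
- move=> x Ix; rewrite vleaf_reflection.
  by have := hv (1 - x); rewrite flip_I01 => /(_ Ix).
Qed.

End Reflected.

Lemma endpoints_image_sub (R : realType) (S1 S2 : surface R)
    (h : homeo S1 S2) d : h @` endpoints d `<=` endpoints (image_family h d).
Proof.
move=> _ [a [I [b [dI arc]]] <-]; exists (h @` I), (h b); split.
  by exists I.
exact: arc_between_image.
Qed.

Lemma endpoints_image (R : realType) (S1 S2 : surface R) (h : homeo S1 S2) d :
  endpoints (image_family h d) = h @` endpoints d.
Proof.
apply/seteqP; split; last exact: endpoints_image_sub.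
move=> y hy; apply/image_homeoP.
have := @endpoints_image_sub R _ _ (homeo_sym h) (image_family h d).
by rewrite image_familyK; apply; exists y.
Qed.

Lemma regular_part_image (R : realType) (S1 S2 : surface R) (h : homeo S1 S2) d :
  regular_part (image_family h d) = h @` regular_part d.
Proof. by rewrite /regular_part family_union_image endpoints_image homeo_imageD. Qed.

Section RailTransport.
Variables (R : realType) (S1 S2 : surface R) (h : homeo S1 S2).
Variables (f1 : homeo S1 S1) (f2 : homeo S2 S2).
Hypotheses (o1 : orientation_preserving f1) (o2 : orientation_preserving f2).
Variables (F1 G1 : measured_foliation R S1) (F2 G2 : measured_foliation R S2).
Hypotheses (hF : leaves_to h F1 F2) (hG : leaves_to h G1 G2).

Lemma embedded_rectangle_image Q rho : embedded_rectangle F1 G1 Q rho ->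
  embedded_rectangle F2 G2 (h @` Q) (h \o rho) \/
  embedded_rectangle F2 G2 (h @` Q) (h \o rho \o @reflection R).
Proof.
move=> [rQ pQ eQ].
have /parametrizationP[uQ o] := pQ.
have rQ' : rectangle F2 G2 (h @` Q) by exact: (rectangle_image hF hG).
have uQ' := unoriented_parametrization_image hF hG uQ.
have cw : {within @open_square R, continuous rho} by case: uQ => _ _ [].
have [por|por] := orientation_transport h o1 o2 cw o.
  left; split => //; last exact: embedding_on_homeo.
  exact/parametrizationP.
right; split => //.
  apply/parametrizationP; split=> //.
  exact: unoriented_parametrization_reflection.
have := embedding_on_precomp (reflection_homeo R) (embedding_on_homeo h eQ).
by rewrite reflection_closed_square.
Qed.

Lemma regular_rail_image d J :
  regular_rail G1 d J -> regular_rail G2 (image_family h d) (h @` J).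
Proof.
move=> [a [b [hJ e ra rb]]]; exists (h a), (h b); split.
- exact: (leaf_interval_image hG).
- by rewrite family_union_image -interior_of_image -homeo_imageI e image_set0.
- by rewrite regular_part_image; exists a.
- by rewrite regular_part_image; exists b.
Qed.

Lemma extreme_rail_image d J :
  extreme_rail F1 G1 d J -> extreme_rail F2 G2 (image_family h d) (h @` J).
Proof.
move=> [[a [b [hJ nr]]] [Q [rho [eQ sub [x0 [hx0 eJ hr]]]]]]; split.
  exists (h a), (h b); split; first exact: (leaf_interval_image hG).
  by rewrite regular_part_image !image_homeo_mem.
have [eQ'|eQ'] := embedded_rectangle_image eQ.
  exists (h @` Q), (h \o rho); split => //.
    by rewrite !hleaf_image -image_setU family_union_image; exact: image_subset.
  exists x0; split => //; first by rewrite eJ vleaf_image.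
  by move=> x Ix ne; rewrite vleaf_image; apply: regular_rail_image; exact: hr.
exists (h @` Q), (h \o rho \o @reflection R); split => //.
  rewrite !hleaf_reflection !hleaf_image -image_setU family_union_image.
  exact: image_subset.
(* The reflection keeps each horizontal leaf as a set and exchanges the two vertical sides. *)
exists (1 - x0); split.
- by case: hx0 => ->; [right; rewrite subr0|left; rewrite subrr].
- by rewrite vleaf_reflection vleaf_image opprB addrC subrK eJ.
- move=> x Ix ne; rewrite vleaf_reflection vleaf_image.
  apply: regular_rail_image; apply: hr; first exact/flip_I01.
  by move=> e; apply: ne; rewrite -e opprB addrC subrK.
Qed.

End RailTransport.

Section CompatibleTransport.
Variables (R : realType) (S1 S2 : surface R) (h : homeo S1 S2).
Variables (f1 : homeo S1 S1) (f2 : homeo S2 S2).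
Hypotheses (o1 : orientation_preserving f1) (o2 : orientation_preserving f2).
Variables (F1 G1 : measured_foliation R S1) (F2 G2 : measured_foliation R S2).
Hypotheses (hF : leaves_to h F1 F2) (hG : leaves_to h G1 G2).

(** Inclusions of endpoints are pushed forward by h, but an extreme rail of the image family is
    first pulled back by its inverse; hence the exchange of [o1] and [o2]. *)
Lemma compatible_image d d' : compatible F1 G1 d d' ->
  compatible F2 G2 (image_family h d) (image_family h d').
Proof.
move=> [e1 e2 r1 r2]; split.
- by rewrite endpoints_image family_union_image; exact: image_subset.
- by rewrite endpoints_image family_union_image; exact: image_subset.
- move=> J /(extreme_rail_image o2 o1 (leaves_to_sym hF) (leaves_to_sym hG)).
  rewrite image_familyK => /r1 sub; rewrite family_union_image.
  by rewrite -(homeo_imageKV h J); exact: image_subset.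
- move=> J /(extreme_rail_image o2 o1 (leaves_to_sym hG) (leaves_to_sym hF)).
  rewrite image_familyK => /r2 sub; rewrite family_union_image.
  by rewrite -(homeo_imageKV h J); exact: image_subset.
Qed.

End CompatibleTransport.

(** * Compatibility orders *)

Section PseudoAnosov.
Variable R : realType.
Implicit Types f g : gen_pseudo_Anosov R.

Lemma pA_contracting_stable f :
  contracting (pA_map f) (Fs f) (Fu f) (dilatation f).
Proof.
split.
- exact: surface_hausdorff.
- exact: surface_compact.
- exact: Fs_Fu_transverse.
- exact: dilatation_gt1.
- exact: Fs_scaled.
- exact: Fu_scaled.
Qed.

(** The inverse map contracts unstable leaves: f scales [Fu] by the inverse of the dilatation, so
    its inverse scales [Fu] by the dilatation. *)
Lemma pA_contracting_unstable f :
  contracting (homeo_sym (pA_map f)) (Fu f) (Fs f) (dilatation f).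
Proof.
have l0 : dilatation f != 0.
  by rewrite gt_eqF// (lt_trans ltr01)// dilatation_gt1.
split.
- exact: surface_hausdorff.
- exact: surface_compact.
- apply: transverse_sym; exact: Fs_Fu_transverse.
- exact: dilatation_gt1.
- rewrite -[dilatation f]invrK; apply: scales_sym; last exact: Fu_scaled.
  by rewrite invr_neq0.
- by apply: scales_sym => //; exact: Fs_scaled.
Qed.

Section Conjugation.
Variables (f g : gen_pseudo_Anosov R).
Variable h : homeo (pA_surface f) (pA_surface g).
Hypothesis hconj : conjugated_through h.

Lemma conjugation_forward x : h (f x) = g (h x).
Proof. by rewrite hconj hinvK. Qed.

Lemma conjugation_backward x : h (hinv f x) = hinv g (h x).
Proof. by rewrite -[in RHS](hinvK f x) conjugation_forward hmapK. Qed.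

Lemma conjugation_stable : leaves_to h (Fs f) (Fs g).
Proof.
exact: conjugate_leaves (pA_contracting_stable f) (pA_contracting_stable g)
  conjugation_forward.
Qed.

Lemma conjugation_unstable : leaves_to h (Fu f) (Fu g).
Proof.
exact: conjugate_leaves (pA_contracting_unstable f) (pA_contracting_unstable g)
  conjugation_backward.
Qed.

(** Singularities are determined by the foliations, which h respects. In their absence [Sing] is a
    chosen family of periodic points, and the condition asks h to match the two choices. *)
Lemma Sing_image : (sing (Fs f) = set0 -> h @` Sing f = Sing g) ->
  h @` Sing f = Sing g.
Proof.
move=> hmarked; have [e|/eqP/set0P ne] := pselect (sing (Fs f) = set0).
  exact: hmarked.
have hs := sing_preserved (pA_contracting_stable f) (pA_contracting_stable g)
  conjugation_forward.
have ne' : sing (Fs g) !=set0.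
  by have [x sx] := ne; exists (h x); apply/hs.
rewrite (Sing_singular ne) (Sing_singular ne'); apply/seteqP; split=> y.
  by move=> /image_homeoP sy; rewrite -(hinvK h y); apply/hs.
by move=> sy; apply/image_homeoP/hs; rewrite hinvK.
Qed.

Hypothesis hSing : h @` Sing f = Sing g.
Let hs := conjugation_stable.
Let hu := conjugation_unstable.

Lemma first_intersection_image p q x :
  first_intersection p q x -> first_intersection (h p) (h q) (h x).
Proof.
move=> [sp sq nx [A [B [sA sB Ax Bx]]] e]; split.
- by rewrite -hSing; exists p.
- by rewrite -hSing; exists q.
- by rewrite -hSing image_homeo_mem.
- exists (h @` A), (h @` B); split; [exact: separatrix_image hs _ _ sA| | |].
  + exact: separatrix_image hu _ _ sB.
  + by exists x.
  + by exists x.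
- rewrite -(leaf_segment_image hs) -(leaf_segment_image hu).
  rewrite -[[set h p]](image_set1 h p) -[[set h q]](image_set1 h q).
  by rewrite -!homeo_imageD -homeo_imageI e image_set1.
Qed.

Lemma iter_backward i x : h (iter i (hinv f) x) = iter i (hinv g) (h x).
Proof. by elim: i => // i IH; rewrite !iterS conjugation_backward IH. Qed.

Lemma iter_forward i x : h (iter i f x) = iter i g (h x).
Proof. by elim: i => // i IH; rewrite !iterS conjugation_forward IH. Qed.

Lemma backward_orbit_arc_image q z :
  backward_orbit_arc (h q) (h z) = h @` backward_orbit_arc q z.
Proof.
rewrite /backward_orbit_arc -(leaf_segment_image hu); apply/seteqP; split=> y.
  move=> [i _ [_ [x sx <-] <-]]; rewrite -iter_backward.
  by exists (iter i (hinv f) x) => //; exists i => //; exists x.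
move=> [_ [i _ [x sx <-]] <-]; exists i => //; rewrite iter_backward.
by exists (h x) => //; exists x.
Qed.

Lemma delta_s_image q z : delta_s (h q) (h z) = image_family h (delta_s q z).
Proof.
by rewrite /delta_s (segments_to_image _ _ hs) hSing backward_orbit_arc_image.
Qed.

Lemma delta_u_image q z : delta_u (h q) (h z) = image_family h (delta_u q z).
Proof.
by rewrite /delta_u (segments_to_image _ _ hu) hSing delta_s_image family_union_image.
Qed.

Lemma push_family_image n d :
  push_family n (image_family h d) = image_family h (push_family n d).
Proof.
have e I : iter n g @` (h @` I) = h @` (iter n f @` I).
  apply/seteqP; split=> [_ [_ [x Ix <-] <-]|_ [_ [x Ix <-] <-]].
    by exists (iter n f x); [exists x|exact: iter_forward].
  by exists (h x); [exists x|rewrite iter_forward].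
apply/seteqP; split=> [_ [_ [I dI <-] <-]|_ [_ [I dI <-] <-]].
  by exists (iter n f @` I); [exists I|rewrite e].
by exists (h @` I); [exists I|exact: e].
Qed.

Lemma eventually_compatible_image q z :
  eventually_compatible (h q) (h z) = eventually_compatible q z.
Proof.
have of1 := @pA_orient R f; have og := @pA_orient R g.
apply/seteqP; split=> N hN n /hN; rewrite delta_s_image delta_u_image push_family_image.
  move=> /(compatible_image og of1 (leaves_to_sym hs) (leaves_to_sym hu)).
  by rewrite !image_familyK.
exact: (compatible_image of1 og hs hu).
Qed.

Lemma compat_coefficient_image q z :
  compat_coefficient (h q) (h z) = compat_coefficient q z.
Proof. by rewrite /compat_coefficient eventually_compatible_image. Qed.

Lemma compat_coefficients_sub : compat_coefficients f `<=` compat_coefficients g.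
Proof.
move=> N [p [q [z [fi ->]]]]; exists (h p), (h q), (h z); split.
  exact: first_intersection_image.
by rewrite compat_coefficient_image.
Qed.

End Conjugation.

Lemma conjugated_through_sym f g (h : homeo (pA_surface f) (pA_surface g)) :
  conjugated_through h -> conjugated_through (homeo_sym h).
Proof. by move=> hc y; rewrite /= hc !hinvK. Qed.

End PseudoAnosov.

Local Close Scope ring_scope.

Theorem corollary4 (R : realType) (f g : gen_pseudo_Anosov R)
  (h : homeo (pA_surface f) (pA_surface g))
  (hconj : conjugated_through h)
  (* only constrains the marked family of periodic points used when the
     foliations have no singularity *)
  (hmarked : sing (Fs f) = set0 -> h @` Sing f = Sing g) :
  compat_order f = compat_order g.
Proof.
have hS := Sing_image hconj hmarked.
have hS' : homeo_sym h @` Sing g = Sing f by rewrite -hS; exact: homeo_imageK.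
(* [compat_order] is a function of the set of coefficients alone, including when [xget] returns its
   default value. *)
suff e : compat_coefficients f = compat_coefficients g by rewrite /compat_order e.
apply/seteqP; split; first exact: compat_coefficients_sub hconj hS.
exact: compat_coefficients_sub (conjugated_through_sym hconj) hS'.
Qed.
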